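(* Let $M$ be a manifold of dimension $n\geq 3$, let $\alpha,\bar\alpha$ be Riemannian metrics on $M$ and $\beta,\bar\beta$ non-zero 1-forms on $M$, and let $\epsilon$ and $k\neq 0$ be constants. Let the (regular) Finsler metric $F=\alpha+\epsilon\beta+k\frac{\beta^2}{\alpha}$ be projectively equivalent to the (regular) Finsler metric $\bar F=\frac{\bar\alpha^2}{\bar\alpha-\bar\beta}$, and suppose that $\bar F$ has isotropic Berwald curvature. Then $F$ has isotropic Berwald curvature if and only if $F$ has isotropic S-curvature.
   Context: Local coordinates on $TM$ are $(x^i,y^i)$; $\alpha=\sqrt{a_{ij}(x)y^iy^j}$, $\beta=b_i(x)y^i$. For a Finsler metric $F=F(x,y)$ with $g_{ij}=\frac12\,\partial^2F^2/\partial y^i\partial y^j$, the spray coefficients are $G^i=\frac14 g^{il}\{[F^2]_{x^my^l}y^m-[F^2]_{x^l}\}$. Two Finsler metrics on $M$ are projectively equivalent (projectively related) if they have the same geodesics as point sets; equivalently, $G^i=\bar G^i+P\,y^i$ for some scalar function $P$ on $TM\setminus\{0\}$, homogeneous of degree one in $y$. The Berwald tensor of $F$ is $B^i_{jkl}=\frac{\partial^3G^i}{\partial y^j\partial y^k\partial y^l}$. $F$ is of isotropic Berwald curvature if $$B^i_{jkl}=c\,(F_{y^jy^k}\delta^i_l+F_{y^jy^l}\delta^i_k+F_{y^ky^l}\delta^i_j+F_{y^jy^ky^l}y^i)$$ for some scalar function $c=c(x)$ on $M$. $F$ has isotropic S-curvature if $\mathbf{S}=(n+1)c(x)F$ for some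 scalar function $c=c(x)$ on $M$, where $\mathbf S=\frac{\partial G^m}{\partial y^m}-y^m\frac{\partial}{\partial x^m}\ln\sigma_F$ is the S-curvature with respect to the Busemann–Hausdorff volume form $dV_F=\sigma_F(x)\,dx^1\cdots dx^n$, $\sigma_F(x)=\mathrm{Vol}(\mathbb B^n)/\mathrm{Vol}\{(y^i)\in\mathbb R^n: F(x,y^i\partial_i)<1\}$. A regular $(\alpha,\beta)$-metric is $F=\alpha\phi(s)$, $s=\beta/\alpha$, where $\phi$ is a positive $C^\infty$ function on $|s|<b_0$ with $\phi(s)-s\phi'(s)+(b^2-s^2)\phi''(s)>0$ for $|s|\le b<b_0$, and $\|\beta_x\|_\alpha<b_0$ for all $x\in M$. For $F=\alpha+\epsilon\beta+k\beta^2/\alpha$ one has $\phi(s)=1+\epsilon s+ks^2$ (the inequality being $1+2kb^2-3ks^2>0$). The Matsumoto metric $\bar F=\bar\alpha^2/(\bar\alpha-\bar\beta)$ has $\phi(s)=1/(1-s)$ and is regular when $\|\bar\beta_x\|_{\bar\alpha}<\frac12$ for all $x\in M$. *)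

(* Defs.v *)
From HB Require Import structures.
From mathcomp Require Import all_boot all_order all_algebra.
From mathcomp Require Import all_classical all_reals all_analysis.

Set Implicit Arguments.
Unset Strict Implicit.
Unset Printing Implicit Defensive.
Import Order.TTheory GRing.Theory Num.Theory.
Import numFieldNormedType.Exports.
Local Open Scope classical_set_scope.
Local Open Scope ring_scope.

Section Calculus.
Context {R : realType} {n : nat}.

Definition pd (i : 'I_n) (f : 'rV[R]_n -> R) : 'rV[R]_n -> R :=
  fun x => 'D_(delta_mx 0 i) f x.

(* C^oo on the open set U: partial derivatives of all orders are
   differentiable (hence exist and are continuous) on U. *)
Definition smooth_on (U : set 'rV[R]_n) (f : 'rV[R]_n -> R) : Prop :=
  forall (s : seq 'I_n) (x : 'rV[R]_n), U x -> differentiable (foldr pd f s) x.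

End Calculus.

(* Iterated Lebesgue integral of the indicator function of A; by Tonelli this
   is the n-dimensional Lebesgue measure of a Borel set A. *)
Fixpoint volume {R : realType} (n : nat) : set 'rV[R]_n -> \bar R :=
  match n with
  | 0 => fun A => (\1_A 0)%:E
  | m.+1 => fun A => (\int[@lebesgue_measure R]_t
      volume [set v : 'rV[R]_m | A (row_mx (t%:M : 'rV[R]_1) v)])%E
  end.

Record manifold (R : realType) (n : nat) := Manifold {
  carrier :> topologicalType;
  manifold_hausdorff : hausdorff_space carrier;
  manifold_second_countable : @second_countable carrier;
  chart : Type;
  dom : chart -> set carrier;
  coord : chart -> carrier -> 'rV[R]_n;
  param : chart -> 'rV[R]_n -> carrier;
  dom_open : forall i, open (dom i);
  dom_cover : forall p, exists i, dom i p;
  img_open : forall i, open (coord i @` dom i);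
  coordK : forall i p, dom i p -> param i (coord i p) = p;
  coord_continuous : forall i, {within dom i, continuous (coord i)};
  param_continuous : forall i, {within coord i @` dom i, continuous (param i)};
  transition_smooth : forall (i j : chart) (l : 'I_n),
    smooth_on (coord i @` (dom i `&` dom j))
      (fun x => coord j (param i x) 0 l)
}.
Arguments chart {R n}.
Arguments dom {R n m}.
Arguments coord {R n m}.
Arguments param {R n m}.

Section Manifold.
Context {R : realType} {n : nat} (M : manifold R n).

(* Entry (k, l) is the derivative of the l-th new coordinate with respect to
   the k-th old one: a tangent vector with components y in the chart i has
   components y *m transition_jacobian i j p in the chart j. *)
Definition transition_jacobian (i j : chart M) (p : M) : 'M[R]_n :=
  jacobian (fun x => coord j (param i x)) (coord i p).

Record riemannian_metric := RiemannianMetric {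
  mcoef :> chart M -> 'rV[R]_n -> 'M[R]_n;
  mcoef_smooth : forall i k l,
    smooth_on (coord i @` dom i) (fun x => mcoef i x k l);
  mcoef_sym : forall i p, dom i p ->
    (mcoef i (coord i p))^T = mcoef i (coord i p);
  mcoef_posdef : forall i p (y : 'rV[R]_n), dom i p -> y != 0 ->
    0 < (y *m mcoef i (coord i p) *m y^T) 0 0;
  mcoef_change : forall i j p, dom i p -> dom j p ->
    mcoef i (coord i p) = transition_jacobian i j p *m
      mcoef j (coord j p) *m (transition_jacobian i j p)^T
}.

Record one_form := OneForm {
  fcoef :> chart M -> 'rV[R]_n -> 'rV[R]_n;
  fcoef_smooth : forall i k,
    smooth_on (coord i @` dom i) (fun x => fcoef i x 0 k);
  fcoef_change : forall i j p, dom i p -> dom j p ->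
    fcoef i (coord i p) =
      fcoef j (coord j p) *m (transition_jacobian i j p)^T
}.

Definition nonzero_form (b : one_form) : Prop :=
  exists i p, dom i p /\ b i (coord i p) <> 0.

(* Functions on TM, given by their expressions in the local coordinates
   (x, y) of TM attached to each chart. *)
Definition tmfun := chart M -> 'rV[R]_n -> 'rV[R]_n -> R.

Definition slit_scalar (P : tmfun) : Prop :=
  forall i j p (y : 'rV[R]_n), dom i p -> dom j p -> y != 0 ->
    P i (coord i p) y = P j (coord j p) (y *m transition_jacobian i j p).

End Manifold.

Section FinslerLocal.
Context {R : realType} {n : nat}.
Implicit Types (F G : 'rV[R]_n -> 'rV[R]_n -> R) (x y : 'rV[R]_n).

Definition dx (i : 'I_n) F : 'rV[R]_n -> 'rV[R]_n -> R :=
  fun x y => pd i (fun x' => F x' y) x.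
Definition dy (i : 'I_n) F : 'rV[R]_n -> 'rV[R]_n -> R :=
  fun x y => pd i (F x) y.
Definition sq F : 'rV[R]_n -> 'rV[R]_n -> R := fun x y => F x y ^+ 2.

Definition fundamental F x y : 'M[R]_n :=
  \matrix_(i, j) (2^-1 * dy j (dy i (sq F)) x y).

Definition spray F (i : 'I_n) x y : R :=
  4^-1 * \sum_l invmx (fundamental F x y) i l *
    (\sum_m dy l (dx m (sq F)) x y * y 0 m - dx l (sq F) x y).

Definition berwald F (i j k l : 'I_n) x y : R :=
  dy l (dy k (dy j (spray F i))) x y.

Definition BH_density F x : R :=
  fine (volume [set y : 'rV[R]_n | \sum_i y 0 i ^+ 2 < 1]) /
  fine (volume [set y : 'rV[R]_n | F x y < 1]).

Definition S_curvature F x y : R :=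
  \sum_m dy m (spray F m) x y
  - \sum_m y 0 m * pd m (fun x' => ln (BH_density F x')) x.

End FinslerLocal.

Section Finsler.
Context {R : realType} {n : nat} {M : manifold R n}.
Implicit Types (F : tmfun M) (a : riemannian_metric M) (b : one_form M).

Definition projectively_equivalent F F' : Prop :=
  exists P : tmfun M,
  [/\ slit_scalar P,
      forall i p (y : 'rV[R]_n) (t : R), dom i p -> y != 0 -> 0 < t ->
        P i (coord i p) (t *: y) = t * P i (coord i p) y
    & forall i p (y : 'rV[R]_n) (l : 'I_n), dom i p -> y != 0 ->
        spray (F i) l (coord i p) y =
        spray (F' i) l (coord i p) y + P i (coord i p) y * y 0 l].

Definition isotropic_berwald F : Prop :=
  exists c : M -> R, forall ch p (y : 'rV[R]_n) (i j k l : 'I_n),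
    dom ch p -> y != 0 ->
    let f := F ch in let x := coord ch p in
    berwald f i j k l x y =
    c p * (dy k (dy j f) x y * (i == l)%:R
           + dy l (dy j f) x y * (i == k)%:R
           + dy l (dy k f) x y * (i == j)%:R
           + dy l (dy k (dy j f)) x y * y 0 i).

Definition isotropic_S F : Prop :=
  exists c : M -> R, forall i p (y : 'rV[R]_n), dom i p -> y != 0 ->
    S_curvature (F i) (coord i p) y = n.+1%:R * c p * F i (coord i p) y.

Definition alpha a : tmfun M :=
  fun i x y => Num.sqrt (\sum_k \sum_l a i x k l * y 0 k * y 0 l).
Definition beta b : tmfun M := fun i x y => \sum_k b i x 0 k * y 0 k.

Definition form_norm a b (i : chart M) (x : 'rV[R]_n) : R :=
  Num.sqrt (\sum_k \sum_l invmx (a i x) k l * b i x 0 k * b i x 0 l).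

Definition regular_alpha_beta (phi : R -> R) a b : Prop :=
  exists b0 : R,
  [/\ 0 < b0,
      forall (m : nat) (s : R), `|s| < b0 -> derivable (derive1n m phi) s 1,
      forall s : R, `|s| < b0 -> 0 < phi s,
      forall s t : R, `|s| <= t -> t < b0 ->
        0 < phi s - s * derive1n 1 phi s
            + (t ^+ 2 - s ^+ 2) * derive1n 2 phi s
    & forall i p, dom i p -> form_norm a b i (coord i p) < b0].

(* At y = 0 the divisions by zero below evaluate to 0, so that both metrics
   vanish there, as they should. *)
Definition quadratic_metric (eps k : R) a b : tmfun M := fun i x y =>
  alpha a i x y + eps * beta b i x y
  + k * (beta b i x y ^+ 2 / alpha a i x y).
Definition quadratic_phi (eps k : R) : R -> R :=
  fun s => 1 + eps * s + k * s ^+ 2.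

Definition matsumoto_metric a b : tmfun M := fun i x y =>
  alpha a i x y ^+ 2 / (alpha a i x y - beta b i x y).
Definition matsumoto_phi : R -> R := fun s => (1 - s)^-1.

End Finsler.

(* Main.v *)
(* If [F] has isotropic S-curvature, write [F'] for the Matsumoto metric: projective
   equivalence and the isotropic Berwald curvature of [F'] give
   [G^i = h^i + Q y^i] with [h] quadratic in [y] and [Q] positively homogeneous of
   degree one.  Taking divergences, [S = (n+1) c F] determines [Q] as [c F] plus
   a linear form, so [G^i] is quadratic up to [c F y^i].

   Conversely, if [G^i - c F y^i] is quadratic, it is given by a symmetric connection
   [H], and the Euler-Lagrange equations integrate to
   [F_{x^l} = F_i H^i_{lj} y^j + 2 c F F_{y^l}].  Splitting this identity for
   [F = alpha + eps beta + k beta^2 / alpha] into even and odd parts in [y] shows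
   that [H] is metric for [alpha] and, where [beta] does not vanish, that [beta] is
   parallel.  Hence [|beta|_alpha] is locally constant, indicatrices at nearby
   points are linear images of each other, and the Busemann-Hausdorff density is a
   constant multiple of [sqrt (det a)], whose logarithmic derivative is the trace
   of [H]; this cancels the divergence of the quadratic part of [G]. *)

(* The zeros of [beta] are the obstacle in the direction from Berwald to S-curvature. Where [beta]
   is nonzero, the first-order identity first forces [c = 0], and only then is [beta] parallel.
   Where [beta] vanishes, [c] is left free and [beta] need not be parallel, but the connection is
   still metric, and the derivative of [|beta|^2] vanishes because each of its terms contains the
   vector dual to [beta]. Hence that derivative is zero on the whole chart, whatever the zero set
   looks like.

   The hypothesis [k != 0] acts through one device. Let [u] be dual to [beta] and [v] in its kernel.
   Along [u + t v] the form [beta] is constant and the identity is polynomial in [t]. Read at a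
   formal, non-real zero of [alpha^2], all that remains is a power of [k] times the unknown.

   No indicatrix volume is computed, and the density is not assumed differentiable. Volumes only
   have to be positive, finite and compatible with linear maps; the ratio of two nearby densities is
   then a power of a determinant. Since volume is an iterated integral, this compatibility is
   derived from Tonelli and row reduction. *)
Require Import Defs.
From HB Require Import structures.
From mathcomp Require Import all_boot all_order all_algebra.
From mathcomp Require Import all_classical all_reals all_analysis.
From mathcomp Require Import perm measurable_realfun.
From mathcomp Require Import ring lra.
Import Order.TTheory GRing.Theory Num.Theory.
Import numFieldNormedType.Exports.
Set Implicit Arguments.
Unset Strict Implicit.
Unset Printing Implicit Defensive.
Local Open Scope classical_set_scope.
Local Open Scope ring_scope.

(** * Partial derivatives and smooth functions *)

Section PartialDerivatives.
Context {R : realType} {n : nat}.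
Local Notation E := 'rV[R]_n.
Implicit Types (f g : E -> R) (U : set E) (i j : 'I_n).

(** The explicit formulas below hold on open sets only, so differentiability has to pass between
    functions with the same germ. *)
Lemma near_eq_differentiable f g x :
  (\near x, f x = g x) -> differentiable f x -> differentiable g x.
Proof.
move=> fg /diff_locallyP[dc df].
have Df : g \o shift x = cst (g x) + 'd f x +o_ (0 : E) id.
  have fgx : f x = g x := nbhs_singleton fg.
  apply/eqaddoP => _/posnumP[e].
  have /eqaddoP/(_ e%:num)/(_ [gt0 of e%:num]) := df.
  have fg' : \forall h \near (0 : E), f (h + x) = g (h + x).
    by move: fg; rewrite (near_shift 0 x)/=; apply: filterS => h; rewrite subr0.
  move=> H; move: H fg'; apply: filterS2 => h H fgh.
  suff -> : (g \o shift x - (cst (g x) + 'd f x)) h =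
            (f \o shift x - (cst (f x) + 'd f x)) h by [].
  by rewrite -![(_ - _ : _ -> _) _]/(_ - _) /= fgh -![(_ + _ : _ -> _) _]/(_ + _) /cst fgx.
by apply/diff_locallyP; rewrite (diff_unique dc Df); split.
Qed.

Lemma pd_cst i (c : R) (x : E) : pd i (fun=> c) x = 0.
Proof. exact: derive_cst. Qed.

Lemma pdD i f g x : differentiable f x -> differentiable g x ->
  pd i (fun z => f z + g z) x = pd i f x + pd i g x.
Proof. by move=> df dg; apply: deriveD; exact: diff_derivable. Qed.

Lemma pdB i f g x : differentiable f x -> differentiable g x ->
  pd i (fun z => f z - g z) x = pd i f x - pd i g x.
Proof. by move=> df dg; apply: deriveB; exact: diff_derivable. Qed.

Lemma pdM i f g x : differentiable f x -> differentiable g x ->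
  pd i (fun z => f z * g z) x = f x * pd i g x + g x * pd i f x.
Proof. by move=> df dg; apply: deriveM; exact: diff_derivable. Qed.

Lemma pdZ i (c : R) f x : differentiable f x ->
  pd i (fun z => c * f z) x = c * pd i f x.
Proof. by move=> df; apply: deriveZ; exact: diff_derivable. Qed.

Lemma pdV i f x : f x != 0 -> differentiable f x ->
  pd i (fun z => (f z)^-1) x = - f x ^- 2 * pd i f x.
Proof. by move=> f0 df; apply: deriveV => //; exact: diff_derivable. Qed.

Lemma derive_pd f x v : differentiable f x ->
  'D_v f x = \sum_i v 0 i * pd i f x.
Proof.
move=> df; rewrite deriveE// {1}(row_sum_delta v) linear_sum; apply: eq_bigr => i _.
by rewrite linearZ/= /pd deriveE.
Qed.

Lemma pd_comp i (phi : R -> R) f x : differentiable f x ->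
  derivable phi (f x) 1 ->
  pd i (fun z => phi (f z)) x = derive1 phi (f x) * pd i f x.
Proof.
move=> df dphi; have dphi' : differentiable phi (f x) by exact/derivable1_diffP.
rewrite /pd deriveE; last exact: differentiable_comp.
rewrite (@diff_comp _ _ _ _ f phi)//= deriveE// derive1E'//.
by rewrite -[X in 'd phi _ X]mulr1 [LHS]linearZ mulrC.
Qed.

Lemma pd_coord i j x : pd i (fun z : E => z 0 j) x = (i == j)%:R.
Proof.
have lin : linear (fun z : E => z 0 j) by move=> c u v; rewrite !mxE.
pose F := GRing.isLinear.Build _ _ _ _ _ lin.
pose L : {linear E -> R} := HB.pack (fun z : E => z 0 j) F.
rewrite /pd; change (fun z : E => z 0 j) with (L : E -> R); rewrite deriveE; last exact: differentiable_coord.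
rewrite diff_lin; last exact: coord_continuous.
by rewrite /L/= mxE eqxx eq_sym.
Qed.

End PartialDerivatives.

Section Smooth.
Context {R : realType} {n : nat}.
Local Notation E := 'rV[R]_n.
Implicit Types (f g : E -> R) (U : set E) (i j : 'I_n).

Lemma open_near U (P : E -> Prop) x : open U -> U x -> (forall z, U z -> P z) ->
  \near x, P x.
Proof. by move=> oU Ux H; apply: filterS (open_nbhs_nbhs (conj oU Ux)). Qed.

Lemma pd_eq_on U f g i x : open U -> U x -> (forall z, U z -> f z = g z) ->
  pd i f x = pd i g x.
Proof. by move=> oU Ux H; apply: near_eq_derive; exact: (open_near oU Ux). Qed.

Lemma differentiable_eq_on U f g x : open U -> U x ->
  (forall z, U z -> f z = g z) -> differentiable f x -> differentiable g x.
Proof.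
by move=> oU Ux H; apply: near_eq_differentiable; exact: (open_near oU Ux).
Qed.

(** [smooth_on] ranges over lists of directions, on which the product and chain rules have no direct
    induction. With the order as parameter, each rule reduces order [m.+1] of a compound function to
    order [m] of its ingredients and their derivatives. *)
Fixpoint diff_upto (m : nat) U f : Prop :=
  (forall x, U x -> differentiable f x) /\
  if m is m'.+1 then forall i, diff_upto m' U (pd i f) else True.

Lemma smooth_onP U f : smooth_on U f <-> forall m, diff_upto m U f.
Proof.
split=> [sf m|H s].
  elim: m f sf => [|m IH] f sf /=; (split; first exact: (sf [::])) => // i.
  by apply: IH => s x Ux; have := sf (rcons s i) x Ux; rewrite foldr_rcons.
elim/last_ind: s f H => [|s i IH] f H x Ux; first by case: (H 0%N) => + _; exact.
by rewrite foldr_rcons; apply: IH => // m; case: (H m.+1) => _; exact.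
Qed.

Lemma diff_upto_eq m U f g : open U -> (forall z, U z -> f z = g z) ->
  diff_upto m U f -> diff_upto m U g.
Proof.
move=> oU; elim: m f g => [|m IH] f g fg /= [df Hf]; split.
- by move=> x Ux; exact: (differentiable_eq_on oU Ux fg (df x Ux)).
- by [].
- by move=> x Ux; exact: (differentiable_eq_on oU Ux fg (df x Ux)).
- by move=> i; apply: IH (Hf i) => z Uz; exact: (pd_eq_on _ oU Uz fg).
Qed.

Lemma diff_uptoW m U f : diff_upto m.+1 U f -> diff_upto m U f.
Proof.
elim: m f => [|m IH] f /= [df Hf]; split=> // i; exact: IH (Hf i).
Qed.

Lemma diff_uptoD m U f g : open U -> diff_upto m U f -> diff_upto m U g ->
  diff_upto m U (fun z => f z + g z).
Proof.
move=> oU; elim: m f g => [|m IH] f g /= [df Hf] [dg Hg].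
  by split=> // x Ux; apply: differentiableD; [exact: df|exact: dg].
split=> [x Ux|i]; first by apply: differentiableD; [exact: df|exact: dg].
apply: (diff_upto_eq oU) (IH _ _ (Hf i) (Hg i)) => z Uz.
by rewrite pdD; [|exact: df|exact: dg].
Qed.

Lemma diff_uptoM m U f g : open U -> diff_upto m U f -> diff_upto m U g ->
  diff_upto m U (fun z => f z * g z).
Proof.
move=> oU; elim: m f g => [|m IH] f g Df Dg.
  case: Df => df _; case: Dg => dg _.
  by split=> // x Ux; apply: differentiableM; [exact: df|exact: dg].
have Df' := diff_uptoW Df; have Dg' := diff_uptoW Dg.
case: Df => df Hf; case: Dg => dg Hg.
split=> [x Ux|i]; first by apply: differentiableM; [exact: df|exact: dg].
apply: (diff_upto_eq oU) (diff_uptoD oU (IH _ _ Df' (Hg i)) (IH _ _ Dg' (Hf i))).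
by move=> z Uz; rewrite pdM; [|exact: df|exact: dg].
Qed.

Lemma diff_upto_cst m U (c : R) : diff_upto m U (fun=> c).
Proof.
elim: m c => [|m IH] c /=; split=> //; try by move=> x _; exact: differentiable_cst.
move=> i; rewrite [X in diff_upto _ _ X](_ : _ = fun=> 0) ?IH//.
by apply/funext => x; exact: pd_cst.
Qed.

(** [phi] is a tower of successive derivatives: the chain rule turns order [m.+1] of [phi k] along
    [f] into order [m] of [phi k.+1] along [f], so the induction must hold for all [k] at once. *)
Lemma diff_upto_comp m U (V : set R) (phi : nat -> R -> R) f : open U ->
  (forall x, U x -> V (f x)) ->
  (forall k s, V s -> is_derive s (1 : R) (phi k) (phi k.+1 s)) ->
  diff_upto m U f -> forall k, diff_upto m U (fun z => phi k (f z)).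
Proof.
move=> oU UV dphi; elim: m f UV => [|m IH] f UV Df k.
  case: Df => df _; split=> // x Ux; apply: differentiable_comp; first exact: df.
  by apply/derivable1_diffP; case: (dphi k _ (UV _ Ux)).
have Df' := diff_uptoW Df; case: Df => df Hf; split=> [x Ux|i].
  apply: differentiable_comp; first exact: df.
  by apply/derivable1_diffP; case: (dphi k _ (UV _ Ux)).
apply: (diff_upto_eq oU) (diff_uptoM oU (IH _ UV Df' k.+1) (Hf i)) => z Uz.
have [dk dkE] := dphi k _ (UV _ Uz).
by rewrite pd_comp ?derive1E ?dkE//; exact: df.
Qed.

Lemma smooth_on_eq U f g : open U -> (forall z, U z -> f z = g z) ->
  smooth_on U f -> smooth_on U g.
Proof.
by move=> oU fg /smooth_onP sf; apply/smooth_onP => m; exact: diff_upto_eq (sf m).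
Qed.

Lemma smooth_on_diff U f x : smooth_on U f -> U x -> differentiable f x.
Proof. by move=> /(_ [::] x). Qed.

Lemma smooth_on_pd U f i : smooth_on U f -> smooth_on U (pd i f).
Proof. by move=> sf s x Ux; rewrite -foldr_rcons; exact: sf. Qed.

Lemma smooth_on_cst U (c : R) : smooth_on U (fun=> c).
Proof. by apply/smooth_onP => m; exact: diff_upto_cst. Qed.

Lemma smooth_onD U f g : open U -> smooth_on U f -> smooth_on U g ->
  smooth_on U (fun z => f z + g z).
Proof.
by move=> oU /smooth_onP sf /smooth_onP sg; apply/smooth_onP => m; exact: diff_uptoD.
Qed.

Lemma smooth_onM U f g : open U -> smooth_on U f -> smooth_on U g ->
  smooth_on U (fun z => f z * g z).
Proof.
by move=> oU /smooth_onP sf /smooth_onP sg; apply/smooth_onP => m; exact: diff_uptoM.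
Qed.

Lemma smooth_onZ U (c : R) f : open U -> smooth_on U f ->
  smooth_on U (fun z => c * f z).
Proof. by move=> oU sf; apply: smooth_onM => //; exact: smooth_on_cst. Qed.

Lemma smooth_onN U f : open U -> smooth_on U f -> smooth_on U (fun z => - f z).
Proof.
move=> oU sf; apply: smooth_on_eq (smooth_onZ (-1) oU sf) => // z _.
by rewrite mulN1r.
Qed.

Lemma smooth_onB U f g : open U -> smooth_on U f -> smooth_on U g ->
  smooth_on U (fun z => f z - g z).
Proof. by move=> oU sf sg; apply: smooth_onD => //; exact: smooth_onN. Qed.

Lemma smooth_on_sum U I (r : seq I) (P : pred I) (f : I -> E -> R) : open U ->
  (forall k, P k -> smooth_on U (f k)) ->
  smooth_on U (fun z => \sum_(k <- r | P k) f k z).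
Proof.
move=> oU sf; elim: r => [|k r IH].
  by refine (smooth_on_eq oU _ (smooth_on_cst 0)) => z _; rewrite big_nil.
case: (boolP (P k)) => Pk.
  apply: smooth_on_eq (smooth_onD oU (sf k Pk) IH) => // z _.
  by rewrite big_cons Pk.
by apply: smooth_on_eq IH => // z _; rewrite big_cons (negbTE Pk).
Qed.

Lemma smooth_on_prod U I (r : seq I) (P : pred I) (f : I -> E -> R) : open U ->
  (forall k, P k -> smooth_on U (f k)) ->
  smooth_on U (fun z => \prod_(k <- r | P k) f k z).
Proof.
move=> oU sf; elim: r => [|k r IH].
  by refine (smooth_on_eq oU _ (smooth_on_cst 1)) => z _; rewrite big_nil.
case: (boolP (P k)) => Pk.
  apply: smooth_on_eq (smooth_onM oU (sf k Pk) IH) => // z _.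
  by rewrite big_cons Pk.
by apply: smooth_on_eq IH => // z _; rewrite big_cons (negbTE Pk).
Qed.

Lemma smooth_on_comp U (V : set R) (phi : nat -> R -> R) f : open U ->
  (forall x, U x -> V (f x)) ->
  (forall k s, V s -> is_derive s (1 : R) (phi k) (phi k.+1 s)) ->
  smooth_on U f -> forall k, smooth_on U (fun z => phi k (f z)).
Proof.
move=> oU UV dphi /smooth_onP sf k; apply/smooth_onP => m.
exact: (diff_upto_comp oU UV dphi).
Qed.

Lemma smooth_on_coord U i : open U -> smooth_on U (fun z : E => z 0 i).
Proof.
move=> oU; apply/smooth_onP => m.
have dc x : U x -> differentiable (fun z : E => z 0 i) x.
  by move=> _; exact: differentiable_coord.
case: m => [|m]; split=> // j.
apply: diff_upto_eq (diff_upto_cst m U (j == i)%:R) => // z _.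
by rewrite pd_coord.
Qed.

Lemma smooth_onV U f : open U -> smooth_on U f -> (forall x, U x -> f x != 0) ->
  smooth_on U (fun z => (f z)^-1).
Proof.
move=> oU /smooth_onP sf f0; apply/smooth_onP => m; move: (sf m).
elim: m => [|m IH] Df.
  by case: Df => df _; split=> // x Ux; apply: differentiableV; [exact: df|exact: f0].
have Df' := diff_uptoW Df; case: Df => df Hf; split=> [x Ux|i].
  by apply: differentiableV; [exact: df|exact: f0].
have D := diff_uptoM oU (diff_uptoM oU (IH Df') (IH Df')) (Hf i).
apply: (diff_upto_eq oU) (diff_uptoM oU (diff_upto_cst m U (-1)) D) => z Uz.
rewrite pdV; [|exact: f0|exact: df].
by rewrite mulN1r mulNr expr2 invfM.
Qed.

Lemma smooth_on_sqrt U f : open U -> smooth_on U f -> (forall x, U x -> 0 < f x) ->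
  smooth_on U (fun z => Num.sqrt (f z)).
Proof.
move=> oU sf f0.
have dsqrt x : U x -> differentiable (fun z => Num.sqrt (f z)) x.
  move=> Ux; apply: differentiable_comp; first exact: smooth_on_diff Ux.
  by apply/derivable1_diffP; case: (is_derive1_sqrt (f0 _ Ux)).
(* The derivative is written as a smooth multiple of the square root itself, so that the induction
   on the order can feed on its own hypothesis. *)
have pdsqrt x i : U x -> pd i (fun z => Num.sqrt (f z)) x =
    2^-1 * (f x)^-1 * (pd i f x * Num.sqrt (f x)).
  move=> Ux; have [d dE] := is_derive1_sqrt (f0 _ Ux).
  rewrite pd_comp ?derive1E ?dE//; last exact: smooth_on_diff Ux.
  have s0 : Num.sqrt (f x) != 0 by rewrite gt_eqF// sqrtr_gt0 f0.
  by rewrite -[in (f x)^-1](@sqr_sqrtr _ (f x)) ?ltW ?f0//; field.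
apply/smooth_onP; elim=> [|m IH]; split=> // i.
have A : diff_upto m U (fun z => 2^-1 * (f z)^-1).
  move: m {IH}; apply/smooth_onP/smooth_onZ => //; apply: smooth_onV => // x Ux.
  by rewrite gt_eqF// f0.
have B : diff_upto m U (pd i f) by move: m {IH A}; exact/smooth_onP/smooth_on_pd.
apply: (diff_upto_eq oU) (diff_uptoM oU A (diff_uptoM oU B IH)) => z Uz.
by rewrite pdsqrt.
Qed.

End Smooth.

(* Otherwise unification unfolds iterated derivatives and becomes intractable. *)
#[local] Opaque smooth_on pd.

(** * Functions on the slit space *)

Section SlitSpace.
Context {R : realType} {n : nat}.
Local Notation E := 'rV[R]_n.
Implicit Types (f g u : E -> R) (i j k l : 'I_n).

Definition slit : set E := [set y | y != 0].

Lemma open_slit : open slit.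
Proof.
rewrite (_ : slit = ~` [set 0]); first exact/closed_openC/accessible_closed_set1/hausdorff_accessible/norm_hausdorff.
by apply/seteqP; split => y /=; rewrite /slit/= => /eqP.
Qed.

Definition pd3 j k l f : E -> R := pd l (pd k (pd j f)).

Lemma pd_on_slitD i f g y : smooth_on slit f -> smooth_on slit g -> slit y ->
  pd i (fun z => f z + g z) y = pd i f y + pd i g y.
Proof. by move=> sf sg Vy; rewrite pdD//; apply: smooth_on_diff Vy. Qed.

Lemma pd_on_slitM i f g y : smooth_on slit f -> smooth_on slit g -> slit y ->
  pd i (fun z => f z * g z) y = f y * pd i g y + g y * pd i f y.
Proof. by move=> sf sg Vy; rewrite pdM//; apply: smooth_on_diff Vy. Qed.

Lemma pd_on_slitZ i (c : R) f y : smooth_on slit f -> slit y ->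
  pd i (fun z => c * f z) y = c * pd i f y.
Proof. by move=> sf Vy; rewrite pdZ//; apply: smooth_on_diff Vy. Qed.

Lemma pd_on_slit_sum i (f : 'I_n -> E -> R) y :
  (forall m, smooth_on slit (f m)) -> slit y ->
  pd i (fun z => \sum_m f m z) y = \sum_m pd i (f m) y.
Proof.
move=> sf Vy; elim: (index_enum _) => [|m r IH].
  by rewrite big_nil (pd_eq_on (g := fun=> 0) _ open_slit Vy) ?pd_cst// => z _; rewrite big_nil.
rewrite big_cons -IH -pd_on_slitD//; last exact: (smooth_on_sum _ open_slit).
by apply: (pd_eq_on _ open_slit Vy) => z _; rewrite big_cons.
Qed.

Lemma pd3_eq f g j k l y : (forall z, slit z -> f z = g z) -> slit y ->
  pd3 j k l f y = pd3 j k l g y.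
Proof.
move=> fg Vy; apply: (pd_eq_on _ open_slit Vy) => {Vy}y Vy.
by apply: (pd_eq_on _ open_slit Vy) => {Vy}y Vy; exact: (pd_eq_on _ open_slit).
Qed.

Lemma pd3D j k l f g y : smooth_on slit f -> smooth_on slit g -> slit y ->
  pd3 j k l (fun z => f z + g z) y = pd3 j k l f y + pd3 j k l g y.
Proof.
move=> sf sg Vy; rewrite /pd3 -pd_on_slitD//; try by do 2!apply: smooth_on_pd.
apply: (pd_eq_on _ open_slit Vy) => {Vy}y Vy.
rewrite -pd_on_slitD//; try exact: smooth_on_pd.
by apply: (pd_eq_on _ open_slit Vy) => {Vy}y Vy; rewrite pd_on_slitD.
Qed.

Lemma pd3Z j k l (c : R) f y : smooth_on slit f -> slit y ->
  pd3 j k l (fun z => c * f z) y = c * pd3 j k l f y.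
Proof.
move=> sf Vy; rewrite /pd3 -pd_on_slitZ//; last by do 2!apply: smooth_on_pd.
apply: (pd_eq_on _ open_slit Vy) => {Vy}y Vy.
rewrite -pd_on_slitZ//; last exact: smooth_on_pd.
by apply: (pd_eq_on _ open_slit Vy) => {Vy}y Vy; rewrite pd_on_slitZ.
Qed.

Lemma smooth_on_slit_coord i : smooth_on slit (fun z => z 0 i).
Proof. exact: smooth_on_coord open_slit. Qed.

(** The bracket of the isotropic Berwald condition. It is the third derivative of [u y_i], so the
    condition says that [G^i - c F y^i] has vanishing third derivatives in [y]. *)
Definition radial_pd3 i j k l u (y : E) : R :=
  pd k (pd j u) y * (i == l)%:R + pd l (pd j u) y * (i == k)%:R
  + pd l (pd k u) y * (i == j)%:R + pd l (pd k (pd j u)) y * y 0 i.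

Lemma pd3_radial i j k l u y : smooth_on slit u -> slit y ->
  pd3 j k l (fun z => u z * z 0 i) y = radial_pd3 i j k l u y.
Proof.
move=> su Vy; have sc := smooth_on_slit_coord i.
have s1 a := smooth_on_pd a su.
have s2 a b := smooth_on_pd a (s1 b).
have o := open_slit.
have E1 a v z : smooth_on slit v -> slit z ->
    pd a (fun z => v z * z 0 i) z = (i == a)%:R * v z + pd a v z * z 0 i.
  by move=> sv Vz; rewrite pd_on_slitM// pd_coord eq_sym; ring.
have E2 a b v z : smooth_on slit v -> slit z ->
    pd b (pd a (fun z => v z * z 0 i)) z =
    (i == a)%:R * pd b v z + ((i == b)%:R * pd a v z + pd b (pd a v) z * z 0 i).
  move=> sv Vz; rewrite (pd_eq_on _ o Vz (fun z' Vz' => E1 a v z' sv Vz')).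
  rewrite pd_on_slitD//; [|exact: smooth_onZ|].
    by rewrite pd_on_slitZ// E1//; exact: smooth_on_pd.
  by apply: smooth_onM => //; exact: smooth_on_pd.
rewrite /pd3 (pd_eq_on _ o Vy (fun z' Vz' => E2 j k u z' su Vz')).
have s3 : smooth_on slit (fun z => pd k (pd j u) z * z 0 i) by exact: smooth_onM.
rewrite pd_on_slitD//; [|exact: smooth_onZ|by apply: smooth_onD => //; exact: smooth_onZ].
rewrite pd_on_slitD//; last exact: smooth_onZ.
rewrite (pd_on_slitZ l _ (s1 k) Vy) (pd_on_slitZ l _ (s1 j) Vy) E1//.
rewrite /radial_pd3.
move: (pd l (pd k u) y) (pd l (pd j u) y) (pd k (pd j u) y) (pd l _ y) => A B C D.
by ring.
Qed.

Lemma radial_pd3_smooth_sum i j k l u v (c : R) y :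
  smooth_on slit u -> smooth_on slit v -> slit y ->
  radial_pd3 i j k l (fun z => u z + c * v z) y =
  radial_pd3 i j k l u y + c * radial_pd3 i j k l v y.
Proof.
move=> su sv Vy; have o := open_slit; have sc := smooth_on_slit_coord i.
have su' : smooth_on slit (fun z => u z * z 0 i) by exact: smooth_onM.
have sv' : smooth_on slit (fun z => v z * z 0 i) by exact: smooth_onM.
have scv : smooth_on slit (fun z => c * (v z * z 0 i)) by exact: smooth_onZ.
have suv : smooth_on slit (fun z => u z + c * v z).
  by apply: smooth_onD => //; exact: smooth_onZ.
rewrite -(pd3_radial i j k l suv Vy) -(pd3_radial i j k l su Vy).
rewrite -(pd3_radial i j k l sv Vy) -(pd3Z j k l c sv' Vy) -(pd3D j k l su' scv Vy).
by apply: pd3_eq Vy => z _; rewrite mulrDl mulrA.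
Qed.

Lemma derive_line (V W : normedModType R) (f : V -> W) x v : 'D_v f x = 'D_1 (fun h : R => f (h *: v + x)) 0.
Proof.
rewrite /derive; congr (lim (_ @ 0^')).
by apply/funext => h /=; rewrite addr0 scale0r add0r [_%:A]mulr1.
Qed.

(** On the ray through [y], [f ((h + 1) y) = (h + 1) f y] as soon as [h + 1] is positive, which
    holds near [h = 0]. *)
Lemma euler_homogeneous f y : differentiable f y ->
  (forall t : R, 0 < t -> f (t *: y) = t * f y) ->
  \sum_m y 0 m * pd m f y = f y.
Proof.
move=> df hf; rewrite -derive_pd// derive_line.
rewrite (near_eq_derive (g := fun h : R => (h + 1) * f y)).
  have [ds dsE] := is_derive_shift (0 : R) (1 : R) (1 : R).
  by rewrite deriveMr// dsE mulr1.
near=> h; rewrite -[X in _ + X]scale1r -scalerDl hf//.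
by rewrite -ltrBlDr sub0r; near: h; apply: lt_nbhsr; rewrite oppr_lt0.
Unshelve. all: by end_near. Qed.

Lemma pd_id_sum (y : E) k (lam : 'I_n -> R) : slit y ->
  pd k (fun z => \sum_m z 0 m * lam m) y = lam k.
Proof.
move=> Vy; have sc m : smooth_on slit (fun z : E => lam m * z 0 m).
  by apply: smooth_onZ; [exact: open_slit|exact: smooth_on_slit_coord].
rewrite (pd_eq_on (g := fun z => \sum_m lam m * z 0 m) _ open_slit Vy); last first.
  by move=> z _; apply: eq_bigr => m _; rewrite mulrC.
rewrite pd_on_slit_sum// (bigD1 k)//= big1 => [|m mk].
  by rewrite (pd_on_slitZ _ _ (smooth_on_slit_coord k) Vy) pd_coord eqxx mulr1 addr0.
by rewrite (pd_on_slitZ _ _ (smooth_on_slit_coord m) Vy) pd_coord eq_sym (negbTE mk) mulr0.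
Qed.

(* If [G] is projectively related to [G'] and [G' i - c' F' y_i] is quadratic,
   then [G i = h i + Q y_i] with [h] quadratic, and the divergence of [G]
   determines [Q] up to a linear form. *)
Lemma radial_pd3_of_divergence (G G' : 'I_n -> E -> R) (F F' P : E -> R)
    (c c' : R) (lam : 'I_n -> R) :
  (forall i, smooth_on slit (G i)) -> (forall i, smooth_on slit (G' i)) ->
  smooth_on slit F -> smooth_on slit F' ->
  (forall y (t : R), slit y -> 0 < t -> F' (t *: y) = t * F' y) ->
  (forall y (t : R), slit y -> 0 < t -> P (t *: y) = t * P y) ->
  (forall i y, slit y -> G i y = G' i y + P y * y 0 i) ->
  (forall i j k l y, slit y ->
    pd3 j k l (G' i) y = c' * radial_pd3 i j k l F' y) ->
  (forall y, slit y -> \sum_m pd m (G m) y - \sum_m y 0 m * lam m =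
    n.+1%:R * c * F y) ->
  forall i j k l y, slit y -> pd3 j k l (G i) y = c * radial_pd3 i j k l F y.
Proof.
move=> sG sG' sF sF' hF' hP GG' BG' SG.
have o := open_slit; have sc := smooth_on_slit_coord.
have sF'c i : smooth_on slit (fun z => F' z * z 0 i) by exact: smooth_onM.
pose h i (z : E) := G' i z + (- c') * (F' z * z 0 i).
have sh i : smooth_on slit (h i) by apply: smooth_onD => //; exact: smooth_onZ.
have h3 i j k l y : slit y -> pd3 j k l (h i) y = 0.
  move=> Vy; rewrite (pd3D j k l (sG' i) (smooth_onZ _ o (sF'c i)) Vy).
  by rewrite (pd3Z j k l _ (sF'c i) Vy) BG'// pd3_radial// mulNr subrr.
pose Q (z : E) := P z + c' * F' z.
have GQ i z : slit z -> G i z = h i z + Q z * z 0 i.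
  by move=> Vz; rewrite GG'// /h /Q; ring.
have normE (z : E) : slit z -> \sum_i z 0 i ^+ 2 != 0.
  move=> /eqP z0; apply/eqP => /eqP.
  rewrite psumr_eq0 => [/allP H|i _]; last exact: sqr_ge0.
  apply: z0; apply/rowP => i; rewrite mxE; apply/eqP.
  by have := H i (mem_index_enum _); rewrite sqrf_eq0.
(* [P] comes with no regularity. Contracting [G - h = Q y] with [y] and dividing by the Euclidean
   [|y|^2] exhibits [Q] as a smooth function. *)
have sQ : smooth_on slit Q.
  have s2 : smooth_on slit (fun z : E => \sum_i z 0 i ^+ 2).
    apply: smooth_on_sum => // i _.
    exact: (smooth_on_eq o _ (smooth_onM o (sc i) (sc i))).
  have s1 : smooth_on slit (fun z : E => \sum_i z 0 i * (G i z - h i z)).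
    apply: smooth_on_sum => // i _; apply: smooth_onM => //; exact: smooth_onB.
  apply: (smooth_on_eq o _ (smooth_onM o s1 (smooth_onV o s2 normE))) => z Vz.
  apply: (mulIf (normE z Vz)); rewrite mulfVK ?normE// mulr_sumr.
  by apply: eq_bigr => i _; rewrite GQ//; ring.
pose D (z : E) := \sum_m pd m (h m) z.
have sD : smooth_on slit D by apply: smooth_on_sum => // m _; exact: smooth_on_pd.
(* The divergence of [Q y] is [n Q] plus the radial derivative of [Q], which is again [Q] by
   homogeneity. *)
have divG z : slit z -> \sum_m pd m (G m) z = D z + n.+1%:R * Q z.
  move=> Vz; have euQ : \sum_m z 0 m * pd m Q z = Q z.
    apply: euler_homogeneous => [|t t0]; first exact: smooth_on_diff Vz.
    by rewrite /Q hP// hF'//; ring.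
  rewrite (eq_bigr (fun m => pd m (h m) z + (Q z + z 0 m * pd m Q z))).
    rewrite big_split; congr (_ + _); rewrite big_split/= euQ -natr1 mulrDl mul1r.
    by congr (_ + _); rewrite (sumr_const _ (Q z)) card_ord mulr_natl.
  move=> m _; rewrite (pd_eq_on _ o Vz (GQ m)).
  rewrite (pd_on_slitD m (sh m) (smooth_onM o sQ (sc m)) Vz).
  by rewrite (pd_on_slitM m sQ (sc m) Vz) pd_coord eqxx mulr1.
pose lin (z : E) := \sum_m z 0 m * lam m.
have slin : smooth_on slit lin.
  by apply: smooth_on_sum => // m _; apply: smooth_onM => //; exact: smooth_on_cst.
pose W (z : E) := (n.+1%:R)^-1 * lin z + (- (n.+1%:R)^-1) * D z.
have sW : smooth_on slit W by apply: smooth_onD => //; exact: smooth_onZ.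
have n0 : n.+1%:R != 0 :> R by rewrite pnatr_eq0.
have QW z : slit z -> Q z = W z + c * F z.
  move=> Vz; have := SG z Vz; rewrite divG// -/(lin z) /W.
  move: n0; set N := n.+1%:R; move: (lin z) (D z) (Q z) (F z) N => a b q f N N0 H.
  apply: (mulfI N0); have -> : N * q = N * c * f + a - b by rewrite -H; ring.
  by field.
(* The linear form dies after two derivatives, and second derivatives of the divergence [D] are sums
   of third derivatives of the [h m]. *)
have W2 j k z : slit z -> pd k (pd j W) z = 0.
  move=> Vz.
  rewrite (pd_eq_on (g := fun z => (n.+1%:R)^-1 * lam j +
      (- (n.+1%:R)^-1) * \sum_m pd j (pd m (h m)) z) _ o Vz); last first.
    move=> {}z {}Vz.
    rewrite (pd_on_slitD j (smooth_onZ _ o slin) (smooth_onZ _ o sD) Vz).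
    rewrite (pd_on_slitZ j _ slin Vz) (pd_on_slitZ j _ sD Vz) (pd_id_sum _ _ Vz).
    rewrite (pd_on_slit_sum j _ Vz)// => m; exact: smooth_on_pd.
  have sjh m : smooth_on slit (pd j (pd m (h m))) by do 2!apply: smooth_on_pd.
  have sS : smooth_on slit (fun z => \sum_m pd j (pd m (h m)) z).
    exact: smooth_on_sum.
  rewrite (pd_on_slitD k (smooth_on_cst _) (smooth_onZ _ o sS) Vz) pd_cst.
  rewrite (pd_on_slitZ k _ sS Vz) (pd_on_slit_sum k sjh Vz) big1 ?mulr0 ?addr0//.
  by move=> m _; exact: h3.
move=> i j k l y Vy.
have sWF : smooth_on slit (fun z => W z + c * F z).
  by apply: smooth_onD => //; exact: smooth_onZ.
rewrite (pd3_eq j k l (g := fun z => h i z + (W z + c * F z) * z 0 i) _ Vy); last first.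
  by move=> z Vz; rewrite GQ// QW.
rewrite (pd3D j k l (sh i) (smooth_onM o sWF (sc i)) Vy) h3// add0r.
rewrite (pd3_radial i j k l sWF Vy) (radial_pd3_smooth_sum i j k l c sW sF Vy).
have W3 : pd l (pd k (pd j W)) y = 0.
  rewrite (pd_eq_on (g := fun=> 0) _ o Vy (fun z Vz => W2 j k z Vz)).
  exact: pd_cst.
have -> : radial_pd3 i j k l W y = 0; last exact: add0r.
have sum0 (A B C B' a b d e : R) : A = 0 -> B = 0 -> C = 0 -> B' = 0 ->
  A * a + B * b + C * d + B' * e = 0 by move=> -> -> -> ->; ring.
exact: sum0 (W2 j k y Vy) (W2 j l y Vy) (W2 k l y Vy) W3.
Qed.

End SlitSpace.

(** * Functions on the slit space whose third derivatives vanish *)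

Section QuadraticOnSlit.
Context {R : realType} {n : nat}.
Local Notation E := 'rV[R]_n.
Implicit Types (f g h : E -> R) (i j k l : 'I_n) (x y v : E).

Lemma is_derive_line f x v (t : R) : differentiable f (t *: v + x) ->
  is_derive t (1 : R) (fun s : R => f (s *: v + x))
    (\sum_i v 0 i * pd i f (t *: v + x)).
Proof.
move=> df.
have dl : differentiable (fun s : R => s *: v + x) t.
  by apply: differentiableD; [exact: differentiableZl|exact: differentiable_cst].
have dc : differentiable (fun s : R => f (s *: v + x)) t.
  exact: (differentiable_comp dl df).
apply: DeriveDef; first exact/derivable1_diffP.
rewrite -(derive_pd v df).
apply: etrans (derive_line _ _ _) _.
apply: etrans (esym (derive_line f (t *: v + x) v)).
apply: (congr1 (fun g : R -> R => 'D_1 g 0)).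
by apply/funext => s; rewrite [_%:A]mulr1 scalerDl addrA.
Qed.

(** Subtracting the quadratic [t A + t^2 B / 2] from [f] on the segment leaves a function of zero
    derivative, constant by the mean value theorem. *)
Lemma line_increment f x v (A B : R) :
  (forall t : R, 0 <= t <= 1 -> differentiable f (t *: v + x)) ->
  (forall t : R, 0 <= t <= 1 ->
    \sum_i v 0 i * pd i f (t *: v + x) = A + t * B) ->
  f (v + x) - f x = A + B / 2.
Proof.
move=> df dE; pose g (t : R) := f (t *: v + x) - (t * A + t ^+ 2 * (B / 2)).
have dg (t : R) : 0 <= t <= 1 -> is_derive t (1 : R) g 0.
  move=> t01; have H := is_derive_line (df t t01).
  apply: is_derive_eq; rewrite dE// /GRing.scale/=; by field.
have : {within `[0, 1], continuous g}.
  apply: derivable_within_continuous => t; rewrite in_itv/= => t01.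
  by have [] := dg t t01.
move=> /(MVT (ltr01 : (0 : R) < 1) (df := fun=> 0)) [t|c _].
  by rewrite in_itv/= => /andP[t0 t1]; apply: dg; rewrite !ltW.
rewrite mul0r => /eqP; rewrite subr_eq0 /g scale1r scale0r add0r => /eqP H.
rewrite !mul1r expr0n/= !mul0r addr0 subr0 expr1n mul1r in H.
by rewrite -H; ring.
Qed.

Lemma line_avoids_zero y v (t : R) : slit y -> (forall c : R, v != c *: y) ->
  slit (t *: (v - y) + y).
Proof.
move=> y0 vy; rewrite /slit/=; apply/eqP => H.
have [t0|t0] := eqVneq t 0.
  by move/eqP: y0; apply; rewrite -H t0 scale0r add0r.
have /eqP := vy ((t - 1) / t); apply.
apply: (scalerI t0); rewrite scalerA mulrCA divff// mulr1 scalerBl scale1r.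
rewrite scalerBr in H; apply/eqP.
by rewrite -subr_eq0 opprB [y - _]addrC addrA H.
Qed.

(** The segment from [y] to a vector off the line of [y] avoids the origin. Two points of one line,
    possibly on opposite sides of the origin, are compared through a basis vector off that line. *)
Lemma slit_constant f : (1 < n)%N -> smooth_on slit f ->
  (forall i y, slit y -> pd i f y = 0) ->
  forall y z, slit y -> slit z -> f y = f z.
Proof.
move=> n1 sf f0.
have indep y v : slit y -> (forall c : R, v != c *: y) -> f v = f y.
  move=> Vy vy; apply/eqP; rewrite -subr_eq0 -{1}(subrK y v).
  rewrite (@line_increment f y (v - y) 0 0) ?mul0r ?addr0// => t _.
    exact: (smooth_on_diff sf (line_avoids_zero t Vy vy)).
  rewrite big1 ?mulr0 ?addr0// => i _.
  by rewrite f0 ?mulr0//; exact: line_avoids_zero.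
move=> y z Vy Vz.
have [[c zc]|zy] := pselect (exists c : R, z = c *: y); last first.
  by apply/esym/indep => // c; apply/eqP => zc; apply: zy; exists c.
have [i yi] : exists i, y 0 i != 0.
  apply/existsP; apply: contraT; rewrite negb_exists => /forallP H.
  by move/eqP: Vy; case; apply/rowP => i; rewrite mxE; apply/eqP/negPn/H.
have [j ji] : exists j, j != i.
  pose i0 := Ordinal (ltnW n1); pose i1 := Ordinal n1.
  by have [->|ii0] := eqVneq i i0; [exists i1|exists i0; rewrite eq_sym].
have c0 : c != 0 by apply: contraTneq Vz => c0; rewrite /slit/= zc c0 scale0r eqxx.
have wE (d : R) : delta_mx 0 j != d *: y.
  apply/eqP => /rowP H; have := H i; rewrite !mxE eqxx/= eq_sym (negbTE ji).
  move=> /esym/eqP; rewrite mulf_eq0 (negbTE yi) orbF => /eqP d0.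
  by have := H j; rewrite !mxE !eqxx d0 mul0r => /eqP; rewrite oner_eq0.
rewrite -(indep y _ Vy wE) -(indep z (delta_mx 0 j) Vz)// => d.
by rewrite zc scalerA; exact: wE.
Qed.

(** [slit_constant] applies to the second derivatives, which gives [H], and then to the first
    derivatives minus their linear part, which gives [C]. Symmetry of [H] comes from going round a
    square in two ways. *)
Lemma affine_gradient h : (1 < n)%N -> smooth_on slit h ->
  (forall j k l y, slit y -> pd3 j k l h y = 0) ->
  exists (H : 'M[R]_n) (C : 'I_n -> R), H^T = H /\
    forall l y, slit y -> pd l h y = \sum_j H l j * y 0 j + C l.
Proof.
move=> n1 sh h3; have o := open_slit (R := R) (n := n).
have [u Vu] : exists u : E, slit u.
  exists (delta_mx 0 (Ordinal (ltn_trans (ltn0Sn _) n1))); apply/eqP => /rowP.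
  by move=> /(_ (Ordinal (ltn_trans (ltn0Sn _) n1))) /eqP; rewrite !mxE !eqxx oner_eq0.
have sl l := smooth_on_pd l sh; have sll k l := smooth_on_pd k (sl l).
have sc := @smooth_on_slit_coord R n.
have [H Hc] : exists H : 'M[R]_n, forall j l y, slit y -> pd j (pd l h) y = H l j.
  exists (\matrix_(l, j) pd j (pd l h) u) => j l y Vy; rewrite mxE.
  by apply: (slit_constant n1 (sll j l) _ Vy Vu) => k z Vz; exact: h3.
have sHl l : smooth_on slit (fun y => \sum_j y 0 j * H l j).
  by apply: smooth_on_sum => // j _; apply: smooth_onM => //; exact: smooth_on_cst.
pose C l := pd l h u - \sum_j u 0 j * H l j.
have HC l y : slit y -> pd l h y = \sum_j H l j * y 0 j + C l.
  move=> Vy; have sB : smooth_on slit (fun y => pd l h y + (-1) * \sum_j y 0 j * H l j).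
    by apply: smooth_onD => //; exact: smooth_onZ.
  have := slit_constant n1 sB _ Vy Vu; rewrite !mulN1r -/(C l) => <-.
    by rewrite addrC; under eq_bigr do rewrite mulrC; rewrite subrK.
  move=> k z Vz; rewrite (pd_on_slitD k (sl l) (smooth_onZ _ o (sHl l)) Vz).
  by rewrite (pd_on_slitZ k _ (sHl l) Vz) pd_id_sum// Hc//; ring.
exists H, C; split => //.
apply/matrixP => j l; rewrite [LHS]mxE.
have [->//|lj] := eqVneq l j.
pose N k (y : E) := \sum_i H k i * y 0 i + C k.
(* Unit coordinate steps starting where [y_l >= 1] and [y_k >= 0] stay off the origin. The two paths
   from [y0] to its opposite corner then give increments of [h] differing by [H j l - H l j]. *)
have incr k y : 0 <= y 0 k -> 1 <= y 0 l ->
    h (delta_mx 0 k + y) - h y = N k y + H k k / 2.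
  move=> yk yl; have Vt (t : R) : 0 <= t -> slit (t *: delta_mx 0 k + y).
    move=> t0; apply/eqP => /rowP /(_ l) /eqP; rewrite !mxE gt_eqF//.
    apply: ltr_wpDl; last exact: lt_le_trans yl.
    by rewrite mulr_ge0// ler0n.
  apply: line_increment => t /andP[t0 _]; first exact: (smooth_on_diff sh (Vt _ t0)).
  rewrite (bigD1 k)//= big1 => [|i ik]; last by rewrite mxE (negbTE ik) andbF mul0r.
  rewrite mxE !eqxx mul1r addr0 HC; last exact: Vt.
  rewrite /N -addrA [in RHS]addrCA [in RHS]addrC; congr (_ + _).
  under eq_bigr do rewrite !mxE mulrDr; rewrite big_split/= addrC; congr (_ + _).
  rewrite (bigD1 k)//= big1 => [|i ik]; last by rewrite (negbTE ik) ?andbF ?mulr0n ?mulr0.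
  by rewrite !eqxx mulr1 addr0 mulrC.
have NE k m y : N k (delta_mx 0 m + y) = N k y + H k m.
  rewrite /N -[RHS]addrAC; congr (_ + _).
  under eq_bigr do rewrite !mxE mulrDr; rewrite big_split/= addrC; congr (_ + _).
  rewrite (bigD1 m)//= big1 => [|i im]; last by rewrite (negbTE im) ?andbF ?mulr0n ?mulr0.
  by rewrite !eqxx mulr1 addr0.
pose y0 : E := delta_mx 0 l + delta_mx 0 j.
have y0l : y0 0 l = 1 by rewrite !mxE !eqxx (negbTE lj) addr0.
have y0j : y0 0 j = 1 by rewrite !mxE !eqxx eq_sym (negbTE lj) add0r.
have dE (m m' : 'I_n) (z : E) : (delta_mx 0 m + z) 0 m' = (m' == m)%:R + z 0 m'.
  by rewrite !mxE.
have jl : (j == l) = false by rewrite eq_sym (negbTE lj).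
have e1 : h (delta_mx 0 l + y0) - h y0 = N l y0 + H l l / 2.
  by apply: incr; rewrite y0l ?ler01.
have e3 : h (delta_mx 0 j + y0) - h y0 = N j y0 + H j j / 2.
  by apply: incr; rewrite ?y0l ?y0j ?ler01.
have e2 : h (delta_mx 0 j + (delta_mx 0 l + y0)) - h (delta_mx 0 l + y0) =
    N j y0 + H j l + H j j / 2.
  by rewrite incr ?NE// dE ?y0l ?y0j ?jl ?eqxx ?add0r ?ler01// lerDl ler01.
have e4 : h (delta_mx 0 l + (delta_mx 0 j + y0)) - h (delta_mx 0 j + y0) =
    N l y0 + H l j + H l l / 2.
  by rewrite incr ?NE// dE ?y0l ?y0j (negbTE lj) add0r ?ler01.
move: e4; rewrite [X in h X - _](_ : _ = delta_mx 0 j + (delta_mx 0 l + y0)).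
  by move=> e4; lra.
by rewrite addrCA.
Qed.

End QuadraticOnSlit.

(** * Fibrewise calculus of (alpha, beta)-functions *)

Section QuadraticForms.
Context {R : realType} {n : nat}.
Local Notation E := 'rV[R]_n.
Implicit Types (A : 'M[R]_n) (b u v w y : E).

Definition bil A u v : R := (u *m A *m v^T) 0 0.
Definition lin b y : R := (b *m y^T) 0 0.

Lemma bilE A u v : bil A u v = \sum_k \sum_l A k l * u 0 k * v 0 l.
Proof.
rewrite /bil mxE exchange_big; apply: eq_bigr => l _; rewrite !mxE mulr_suml.
by apply: eq_bigr => k _; rewrite [A k l * _]mulrC.
Qed.

Lemma linE b y : lin b y = \sum_k b 0 k * y 0 k.
Proof. by rewrite /lin mxE; apply: eq_bigr => k _; rewrite mxE. Qed.

Lemma linC b y : lin b y = lin y b.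
Proof. by rewrite !linE; apply: eq_bigr => k _; rewrite mulrC. Qed.

Lemma linDr b u v : lin b (u + v) = lin b u + lin b v.
Proof. by rewrite /lin linearD mulmxDr mxE. Qed.

Lemma linZr b (c : R) u : lin b (c *: u) = c * lin b u.
Proof. by rewrite /lin linearZ -scalemxAr mxE. Qed.

Lemma linDl b u v : lin (u + v) b = lin u b + lin v b.
Proof. by rewrite !(linC _ b) linDr. Qed.

Lemma linZl b (c : R) u : lin (c *: u) b = c * lin u b.
Proof. by rewrite !(linC _ b) linZr. Qed.

Lemma bil_lin A u v : bil A u v = lin (u *m A) v.
Proof. by []. Qed.

Lemma bilDl A u v w : bil A (u + v) w = bil A u w + bil A v w.
Proof. by rewrite /bil !mulmxDl mxE. Qed.

Lemma bilZl A (c : R) u v : bil A (c *: u) v = c * bil A u v.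
Proof. by rewrite /bil -!scalemxAl mxE. Qed.

Lemma bilDr A u v w : bil A u (v + w) = bil A u v + bil A u w.
Proof. exact: linDr. Qed.

Lemma bilZr A (c : R) u v : bil A u (c *: v) = c * bil A u v.
Proof. exact: linZr. Qed.

Lemma bilC A u v : A^T = A -> bil A u v = bil A v u.
Proof.
move=> At; rewrite /bil -[in LHS](trmxK (u *m A *m v^T)) mxE !trmx_mul trmxK At.
by rewrite mulmxA.
Qed.

Definition posdef A := A^T = A /\ forall y, y != 0 -> 0 < bil A y y.

Section PositiveDefinite.
Variable A : 'M[R]_n.
Hypothesis Apos : posdef A.

Lemma bil_ge0 y : 0 <= bil A y y.
Proof.
have [->|y0] := eqVneq y 0; first by rewrite /bil !mul0mx mxE.
by rewrite ltW//; case: Apos => _; apply.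
Qed.

Lemma bil_eq0 y : bil A y y = 0 -> y = 0.
Proof.
by move=> y0; apply/eqP; apply: contraT => /(proj2 Apos); rewrite y0 ltxx.
Qed.

Lemma posdef_unit : A \in unitmx.
Proof.
rewrite unitmxE unitfE; apply/det0P => -[v v0 vA].
by have := proj2 Apos v v0; rewrite bil_lin vA /lin mul0mx mxE ltxx.
Qed.

Lemma bil_cauchy w v : bil A w v ^+ 2 <= bil A w w * bil A v v.
Proof.
have [->|v0] := eqVneq v 0.
  by rewrite /bil trmx0 !mulmx0 mxE expr0n/= mulr0.
have vpos := proj2 Apos v v0.
pose u := bil A v v *: w + (- bil A w v) *: v.
have := bil_ge0 u.
rewrite /u !(bilDl, bilDr, bilZl, bilZr) (bilC v w (proj1 Apos)).
rewrite [X in 0 <= X](_ : _ = bil A v v * (bil A w w * bil A v v - bil A w v ^+ 2)).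
  by rewrite pmulr_rge0// subr_ge0.
by ring.
Qed.

Definition sharp b : E := b *m invmx A.

Lemma bil_sharp b v : bil A (sharp b) v = lin b v.
Proof. by rewrite bil_lin /sharp mulmxKV// posdef_unit. Qed.

Lemma sqnormE b : bil (invmx A) b b = lin b (sharp b).
Proof. by rewrite bil_lin linC. Qed.

Lemma sqnorm_ge0 b : 0 <= bil (invmx A) b b.
Proof. by rewrite sqnormE -bil_sharp bil_ge0. Qed.

Lemma lin_cauchy b v : lin b v ^+ 2 <= bil (invmx A) b b * bil A v v.
Proof. by rewrite -bil_sharp sqnormE -bil_sharp bil_cauchy. Qed.

(* With [v'] the component of [v] orthogonal to [y] and [w] that of [sharp b],
   [F_vv alpha = |v'|^2 P + D <w, v'>^2], and [|w|^2 = |b|^2 - s^2]. *)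
Lemma alpha_beta_definite b y v (al s f f1 D : R) (P := f - s * f1) :
  0 < al -> al ^+ 2 = bil A y y -> s * al = lin b y -> 0 < f -> 0 < P ->
  0 < P + (bil (invmx A) b b - s ^+ 2) * D ->
  let av := bil A y v / al in
  (av * P + f1 * lin b v) ^+ 2 +
  al * f * (((bil A v v - av ^+ 2) * P + D * (lin b v - s * av) ^+ 2) / al) = 0 ->
  v = 0.
Proof.
move=> al0 alE sE f0 P0 D0 av; set F1 := av * P + _.
have alN0 : al != 0 by rewrite gt_eqF.
pose t := bil A y v / al ^+ 2; pose v' := v + (- t) *: y.
pose w := sharp b + (- (s / al)) *: y.
have AC := bilC _ _ (proj1 Apos).
have yv' : bil A y v' = 0.
  by rewrite bilDr bilZr -alE /t mulNr divfK ?subrr// expf_neq0.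
have m' : bil A v' v' = bil A v v - av ^+ 2.
  rewrite {1}/v' bilDl bilZl yv' mulr0 addr0 bilDr bilZr (AC v y) /av /t.
  by field.
have r' : bil A w v' = lin b v - s * av.
  rewrite bilDl bilZl yv' mulr0 addr0 bil_sharp linDr linZr -sE /t /av.
  by field.
have w' : bil A w w = bil (invmx A) b b - s ^+ 2.
  rewrite {1}/w bilDl bilZl bil_sharp (AC y w) bilDl bilZl bil_sharp linDr linZr.
  by rewrite -sE -alE sqnormE; field.
rewrite -m' -r' => H.
have cs : bil A w v' ^+ 2 <= (bil (invmx A) b b - s ^+ 2) * bil A v' v'.
  by rewrite -w' bil_cauchy.
have m0 := bil_ge0 v'.
have Q0 : 0 <= bil A v' v' * P + D * bil A w v' ^+ 2 /\
    (bil A v' v' != 0 -> 0 < bil A v' v' * P + D * bil A w v' ^+ 2).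
  have [m00|mN0] := eqVneq (bil A v' v') 0.
    have -> : bil A w v' ^+ 2 = 0.
      by apply/eqP; rewrite eq_le sqr_ge0 andbT; move: cs; rewrite m00 mulr0.
    by rewrite m00 mul0r mulr0 addr0; split.
  have mpos : 0 < bil A v' v' by rewrite lt_neqAle eq_sym mN0.
  suff : 0 < bil A v' v' * P + D * bil A w v' ^+ 2 by move=> ?; split => //; exact: ltW.
  (* For negative [D] the worst case of [<w, v'>^2] is the Cauchy-Schwarz bound, and there the
     regularity inequality [D0] decides. *)
  case: (leP 0 D) => D_0.
    by rewrite ltr_pwDl ?mulr_gt0// mulr_ge0// sqr_ge0.
  have : 0 < bil A v' v' * (P + (bil (invmx A) b b - s ^+ 2) * D) by rewrite mulr_gt0.
  move/lt_le_trans; apply; rewrite mulrDr lerD2l mulrA [_ * D]mulrC.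
  by rewrite ler_nM2l// mulrC.
have [Q1 Q2] := Q0.
have al_f : 0 < al * f by rewrite mulr_gt0.
have Qd : 0 <= al * f * ((bil A v' v' * P + D * bil A w v' ^+ 2) / al).
  by rewrite mulr_ge0// ?(ltW al_f)// divr_ge0// ltW.
move/eqP: H; rewrite paddr_eq0// ?sqr_ge0// => /andP[/eqP F10 /eqP Qz].
have mz : bil A v' v' = 0.
  apply/eqP; apply: contraT => /Q2 Qpos.
  by move: Qz => /eqP; rewrite gt_eqF// mulr_gt0// divr_gt0.
(* With its orthogonal part gone, [v] is radial, so [F_v = t F]; this must vanish too, and [F > 0]
   gives [t = 0]. *)
have vt : v = t *: y.
  by apply/eqP; rewrite -subr_eq0 -scaleNr; apply/eqP/bil_eq0.
have : F1 = t * al * f.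
  by rewrite /F1 /av {1 2}vt bilZr linZr -alE -sE /P; field.
move: F10 => /eqP; rewrite sqrf_eq0 => /eqP -> /esym/eqP.
rewrite mulf_eq0 (gt_eqF f0) orbF mulf_eq0 (negbTE alN0) orbF => /eqP t0.
by rewrite vt t0 scale0r.
Qed.

End PositiveDefinite.
End QuadraticForms.

(** * First and second derivatives of [alpha phi(beta / alpha)] *)

Section AlphaBetaCalculus.
Context {R : realType} {n : nat}.
Local Notation E := 'rV[R]_n.

Lemma diff_pd_sum I (r : seq I) (f : I -> E -> R) x :
  (forall m, differentiable (f m) x) ->
  differentiable (fun z => \sum_(m <- r) f m z) x /\
  forall i, pd i (fun z => \sum_(m <- r) f m z) x = \sum_(m <- r) pd i (f m) x.
Proof.
move=> df; elim: r => [|m r [IHd IH]].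
  have -> : (fun z => \sum_(m <- [::]) f m z) = (fun=> 0 : R).
    by apply/funext => z; rewrite big_nil.
  by split=> [|i]; [exact: differentiable_cst|rewrite pd_cst big_nil].
have -> : (fun z => \sum_(k <- m :: r) f k z) =
    (fun z => f m z + \sum_(k <- r) f k z).
  by apply/funext => z; rewrite big_cons.
by split=> [|i]; [exact: differentiableD|rewrite pdD// IH big_cons].
Qed.

Definition pd_mx (a : E -> 'M[R]_n) l x : 'M[R]_n :=
  \matrix_(i, j) pd l (fun z => a z i j) x.
Definition pd_row_form (b : E -> E) l x : E := \row_i pd l (fun z => b z 0 i) x.

(** [Q] and [B] are arbitrary because the formula serves twice: with the base point fixed, for
    derivatives in [y], and with [y] fixed, for derivatives in [x]. *)
Lemma pd_alpha_beta (Q B : E -> R) (phi : R -> R) i z :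
  differentiable Q z -> differentiable B z -> 0 < Q z ->
  derivable phi (B z / Num.sqrt (Q z)) 1 ->
  let al := Num.sqrt (Q z) in let s := B z / al in
  differentiable (fun z => Num.sqrt (Q z) * phi (B z / Num.sqrt (Q z))) z /\
  pd i (fun z => Num.sqrt (Q z) * phi (B z / Num.sqrt (Q z))) z =
  pd i Q z / (2 * al) * (phi s - s * derive1 phi s) + derive1 phi s * pd i B z.
Proof.
move=> dQ dB Q0 dphi al s.
have al0 : al != 0 by rewrite gt_eqF// sqrtr_gt0.
have [dsq dsqE] := is_derive1_sqrt Q0.
have dal : differentiable (fun z => Num.sqrt (Q z)) z.
  by apply: differentiable_comp => //; exact/derivable1_diffP.
have pdal : pd i (fun z => Num.sqrt (Q z)) z = pd i Q z / (2 * al).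
  by rewrite pd_comp// derive1E dsqE mulrC.
have dV : differentiable (fun z => (Num.sqrt (Q z))^-1) z by exact: differentiableV.
have ds : differentiable (fun z => B z / Num.sqrt (Q z)) z by exact: differentiableM.
have pds : pd i (fun z => B z / Num.sqrt (Q z)) z =
    (pd i B z - s * (pd i Q z / (2 * al))) / al.
  rewrite (pdM i dB dV) (pdV i al0 dal) pdal /s -/al; move: (pd i Q z) (pd i B z) => q b.
  by field.
have dps : differentiable (fun z => phi (B z / Num.sqrt (Q z))) z.
  move/derivable1_diffP: (dphi) => dp.
  exact: (differentiable_comp ds dp).
split; first exact: differentiableM.
rewrite (pdM i dal dps) pdal (pd_comp i ds dphi) pds -/al -/s.
by move: (pd i Q z) (pd i B z) (derive1 phi s) => q b f1; field.
Qed.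

Definition regular_phi (phi : R -> R) (b0 : R) : Prop :=
  [/\ 0 < b0,
      forall (m : nat) (s : R), `|s| < b0 -> derivable (derive1n m phi) s 1,
      forall s : R, `|s| < b0 -> 0 < phi s
    & forall s t : R, `|s| <= t -> t < b0 ->
        0 < phi s - s * derive1n 1 phi s
            + (t ^+ 2 - s ^+ 2) * derive1n 2 phi s].

Definition ab_norm (A : 'M[R]_n) (y : E) : R := Num.sqrt (bil A y y).
Definition ab_ratio (A : 'M[R]_n) (b y : E) : R := lin b y / ab_norm A y.
(** The coefficient [phi - s phi'] of the derivative of [alpha] in any first derivative of
    [alpha phi(s)]. *)
Definition ab_slope (phi : R -> R) (A : 'M[R]_n) (b y : E) : R :=
  phi (ab_ratio A b y) - ab_ratio A b y * derive1 phi (ab_ratio A b y).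
Definition alpha_beta (phi : R -> R) (A : 'M[R]_n) (b y : E) : R :=
  ab_norm A y * phi (ab_ratio A b y).
(** The derivative of [alpha] in [y^i]. *)
Definition ab_dir (A : 'M[R]_n) i (y : E) : R := (y *m A) 0 i / ab_norm A y.

Section Fiber.
Variables (phi : R -> R) (b0 : R) (A : 'M[R]_n) (b : E).
Hypotheses (rphi : regular_phi phi b0) (Apos : posdef A).
Hypothesis bnorm : Num.sqrt (bil (invmx A) b b) < b0.

Local Notation al := (ab_norm A).
Local Notation s := (ab_ratio A b).
Local Notation P := (ab_slope phi A b).
Local Notation F := (alpha_beta phi A b).
Local Notation al_ := (ab_dir A).

Lemma al_gt0 y : slit y -> 0 < al y.
Proof. by move=> Vy; rewrite sqrtr_gt0; exact: (proj2 Apos). Qed.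

Lemma al_sqr y : al y ^+ 2 = bil A y y.
Proof. by rewrite sqr_sqrtr// bil_ge0. Qed.

Lemma s_al y : slit y -> s y * al y = lin b y.
Proof. by move=> Vy; rewrite mulfVK// gt_eqF// al_gt0. Qed.

Lemma s_bound y : slit y -> `|s y| <= Num.sqrt (bil (invmx A) b b).
Proof.
move=> Vy; rewrite -(ler_pXn2r (ltn0Sn 1))// ?nnegrE ?sqrtr_ge0// real_normK ?num_real//.
rewrite sqr_sqrtr ?sqnorm_ge0// expr_div_n ler_pdivrMr ?exprn_gt0 ?al_gt0//.
by rewrite al_sqr lin_cauchy.
Qed.

Lemma s_lt y : slit y -> `|s y| < b0.
Proof. by move=> Vy; exact: le_lt_trans (s_bound Vy) bnorm. Qed.

(** Regularity at [t = |s|], where the second-order term drops out. *)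
Lemma P_gt0 y : slit y -> 0 < P y.
Proof.
move=> Vy; have [_ _ _ H] := rphi.
have := H (s y) `|s y| (lexx _) (s_lt Vy).
by rewrite real_normK ?num_real// subrr mul0r addr0 derive1n1.
Qed.

Lemma F_gt0 y : slit y -> 0 < F y.
Proof.
by move=> Vy; rewrite mulr_gt0 ?al_gt0//; case: rphi => _ _ + _; apply; exact: s_lt.
Qed.

Lemma derive_phi k r : `|r| < b0 ->
  is_derive r (1 : R) (derive1n k phi) (derive1n k.+1 phi r).
Proof.
move=> rb; have [_ dphi _ _] := rphi.
by apply: DeriveDef; [exact: dphi|rewrite derive1nS derive1E].
Qed.

Lemma alZ (t : R) y : 0 < t -> al (t *: y) = t * al y.
Proof.
move=> t0; rewrite /ab_norm bilZl bilZr mulrA -expr2 sqrtrM ?sqr_ge0//.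
by rewrite sqrtr_sqr gtr0_norm.
Qed.

Lemma sZ (t : R) y : 0 < t -> s (t *: y) = s y.
Proof.
by move=> t0; rewrite /ab_ratio alZ// linZr invfM mulrACA divff ?gt_eqF// mul1r.
Qed.

Lemma FZ (t : R) y : 0 < t -> F (t *: y) = t * F y.
Proof. by move=> t0; rewrite /alpha_beta alZ// sZ// mulrA. Qed.

Lemma smooth_row (B : 'M[R]_n) i : smooth_on slit (fun y : E => (y *m B) 0 i).
Proof.
have o := @open_slit R n.
apply: (smooth_on_eq (f := fun y : E => \sum_k y 0 k * B k i) o) => [y _|].
  by rewrite mxE.
apply: smooth_on_sum => // k _; apply: smooth_onM => //.
  exact: smooth_on_slit_coord.
exact: smooth_on_cst.
Qed.

Lemma smooth_lin (c : E) : smooth_on slit (lin c).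
Proof.
have o := @open_slit R n.
apply: (smooth_on_eq (f := fun y : E => \sum_k c 0 k * y 0 k) o) => [y _|].
  by rewrite linE.
by apply: smooth_on_sum => // k _; apply: smooth_onZ => //; exact: smooth_on_slit_coord.
Qed.

Lemma smooth_bil (B : 'M[R]_n) : smooth_on slit (fun y : E => bil B y y).
Proof.
have o := @open_slit R n.
apply: (smooth_on_eq (f := fun y : E => \sum_k (y *m B) 0 k * y 0 k) o) => [y _|].
  by rewrite bil_lin linE.
apply: smooth_on_sum => // k _; apply: smooth_onM => //; first exact: smooth_row.
exact: smooth_on_slit_coord.
Qed.

Lemma smooth_al : smooth_on slit al.
Proof.
apply: smooth_on_sqrt (smooth_bil A) _; first exact: open_slit.
by move=> y Vy; exact: (proj2 Apos).
Qed.

Lemma smooth_alV : smooth_on slit (fun y => (al y)^-1).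
Proof.
apply: (smooth_onV (@open_slit R n) smooth_al) => y Vy.
by rewrite gt_eqF// al_gt0.
Qed.

Lemma smooth_s : smooth_on slit s.
Proof. exact: (smooth_onM (@open_slit R n) (smooth_lin b) smooth_alV). Qed.

Lemma smooth_phi k : smooth_on slit (fun y => derive1n k phi (s y)).
Proof.
apply: (@smooth_on_comp _ _ slit [set r | `|r| < b0] (fun m => derive1n m phi)).
- exact: open_slit.
- exact: s_lt.
- exact: derive_phi.
- exact: smooth_s.
Qed.

Lemma smooth_phi1 : smooth_on slit (fun y => derive1 phi (s y)).
Proof. by rewrite -derive1n1; exact: smooth_phi. Qed.

Lemma smooth_P : smooth_on slit P.
Proof.
apply: (smooth_onB (@open_slit R n) (smooth_phi 0)).
exact: (smooth_onM (@open_slit R n) smooth_s smooth_phi1).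
Qed.

Lemma smooth_F : smooth_on slit F.
Proof. exact: (smooth_onM (@open_slit R n) smooth_al (smooth_phi 0)). Qed.

Lemma smooth_al_ i : smooth_on slit (al_ i).
Proof. exact: (smooth_onM (@open_slit R n) (smooth_row A i) smooth_alV). Qed.

Lemma pd_row (B : 'M[R]_n) i k y : slit y ->
  pd i (fun y : E => (y *m B) 0 k) y = B i k.
Proof.
move=> Vy; rewrite -[RHS](pd_id_sum i (fun m => B m k) Vy).
by apply: (pd_eq_on _ (@open_slit R n) Vy) => z _; rewrite mxE.
Qed.

Lemma pd_lin (c : E) i y : slit y -> pd i (lin c) y = c 0 i.
Proof.
move=> Vy; rewrite -[RHS](pd_id_sum i (c 0) Vy).
apply: (pd_eq_on _ (@open_slit R n) Vy) => z _; rewrite linE.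
by apply: eq_bigr => k _; rewrite mulrC.
Qed.

Lemma pd_bil (B : 'M[R]_n) i y : B^T = B -> slit y ->
  pd i (fun y : E => bil B y y) y = 2 * (y *m B) 0 i.
Proof.
move=> Bt Vy; have o := @open_slit R n.
have sr := smooth_row B; have sc := @smooth_on_slit_coord R n.
rewrite (pd_eq_on (g := fun y : E => \sum_k (y *m B) 0 k * y 0 k) i o Vy); last first.
  by move=> z _; rewrite bil_lin linE.
rewrite (pd_on_slit_sum i (fun m => smooth_onM o (sr m) (sc m)) Vy).
rewrite (eq_bigr (fun k => (y *m B) 0 k * (i == k)%:R + y 0 k * B k i)); last first.
  move=> k _; rewrite (pd_on_slitM i (sr k) (sc k) Vy) pd_coord pd_row//.
  by congr (_ + _ * _); rewrite -[in LHS]Bt mxE.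
rewrite big_split/= -[X in _ + X = _](_ : (y *m B) 0 i = _); last by rewrite mxE.
rewrite (bigD1 i)//= big1 => [|k ki]; last by rewrite eq_sym (negbTE ki) mulr0.
by rewrite eqxx mulr1 addr0; ring.
Qed.

Lemma pd_F i y : slit y -> pd i F y = al_ i y * P y + derive1 phi (s y) * b 0 i.
Proof.
move=> Vy.
have dphi : derivable phi (lin b y / Num.sqrt (bil A y y)) 1.
  by have [] := derive_phi 0 (s_lt Vy).
rewrite (proj2 (pd_alpha_beta i (smooth_on_diff (smooth_bil A) Vy)
  (smooth_on_diff (smooth_lin b) Vy) (proj2 Apos y Vy) dphi)).
rewrite (pd_bil i (proj1 Apos) Vy) (pd_lin b i Vy) -/(al y) -/(s y) -/(P y).
by congr (_ * _ + _); rewrite /ab_dir -mulf_div divff ?mul1r// pnatr_eq0.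
Qed.

Lemma pd_al j y : slit y -> pd j al y = al_ j y.
Proof.
move=> Vy; have [d dE] := is_derive1_sqrt (proj2 Apos y Vy).
rewrite (pd_comp j (smooth_on_diff (smooth_bil A) Vy) d) derive1E dE.
rewrite (pd_bil j (proj1 Apos) Vy) -/(al y) /ab_dir.
by have al0 := al_gt0 Vy; field; rewrite gt_eqF.
Qed.

Lemma pd_al_ i j y : slit y -> pd j (al_ i) y = (A i j - al_ i y * al_ j y) / al y.
Proof.
move=> Vy; have al0 : al y != 0 by rewrite gt_eqF// al_gt0.
rewrite (pd_on_slitM j (smooth_row A i) smooth_alV Vy) (pd_row A j i Vy).
rewrite (pdV j al0 (smooth_on_diff smooth_al Vy)) (pd_al j Vy).
have -> : A j i = A i j by rewrite -[in LHS](proj1 Apos) mxE.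
by rewrite /ab_dir; field.
Qed.

Lemma pd_s j y : slit y -> pd j s y = (b 0 j - s y * al_ j y) / al y.
Proof.
move=> Vy; have al0 : al y != 0 by rewrite gt_eqF// al_gt0.
rewrite (pd_on_slitM j (smooth_lin b) smooth_alV Vy) (pd_lin b j Vy).
rewrite (pdV j al0 (smooth_on_diff smooth_al Vy)) (pd_al j Vy).
by rewrite /ab_ratio /ab_dir; field.
Qed.

Lemma pd_phi k j y : slit y ->
  pd j (fun y => derive1n k phi (s y)) y = derive1n k.+1 phi (s y) * pd j s y.
Proof.
move=> Vy; have [d dE] := derive_phi k (s_lt Vy).
by rewrite (pd_comp j (smooth_on_diff smooth_s Vy) d) derive1E dE.
Qed.

(** The slope [phi - s phi'] has derivative [- s phi''] in [s], so [phi''] only meets the product of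
    the two covectors [b - s d alpha]. The closed form makes symmetry in [i], [j] and degeneracy
    along [y] computable. *)
Lemma pd2_F i j y : slit y -> pd j (pd i F) y =
  ((A i j - al_ i y * al_ j y) * P y +
   derive1n 2 phi (s y) * (b 0 i - s y * al_ i y) * (b 0 j - s y * al_ j y)) / al y.
Proof.
move=> Vy; have o := @open_slit R n.
have al0 : al y != 0 by rewrite gt_eqF// al_gt0.
rewrite (pd_eq_on j o Vy (fun z Vz => pd_F i Vz)).
have s1 : smooth_on slit (fun z => al_ i z * P z).
  exact: (smooth_onM o (smooth_al_ i) smooth_P).
have s2 : smooth_on slit (fun z => derive1 phi (s z) * b 0 i).
  exact: (smooth_onM o smooth_phi1 (smooth_on_cst _)).
rewrite (pd_on_slitD j s1 s2 Vy) (pd_on_slitM j (smooth_al_ i) smooth_P Vy).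
rewrite (pd_on_slitM j smooth_phi1 (smooth_on_cst _) Vy) pd_cst mulr0 add0r.
have ph1 : pd j (fun z => derive1 phi (s z)) y = derive1n 2 phi (s y) * pd j s y.
  by rewrite -(pd_phi 1 j Vy) derive1n1.
have ph0 : pd j (fun z => phi (s z)) y = derive1 phi (s y) * pd j s y.
  by rewrite -derive1n1 -(pd_phi 0 j Vy).
have s3 : smooth_on slit (fun z => s z * derive1 phi (s z)).
  exact: (smooth_onM o smooth_s smooth_phi1).
have -> : pd j P y = - s y * (derive1n 2 phi (s y) * pd j s y).
  rewrite (pdB j (smooth_on_diff (smooth_phi 0) Vy) (smooth_on_diff s3 Vy)).
  by rewrite (pd_on_slitM j smooth_s smooth_phi1 Vy) ph1 ph0; ring.
rewrite ph1 (pd_al_ i j Vy) (pd_s j Vy).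
move: (derive1n 2 phi (s y)) (P y) (al_ i y) (al_ j y) (s y) => f2 p ai aj r.
by field.
Qed.

Lemma pd2_F_sym i j y : slit y -> pd j (pd i F) y = pd i (pd j F) y.
Proof.
move=> Vy; rewrite (pd2_F i j Vy) (pd2_F j i Vy).
have -> : A j i = A i j by rewrite -[in LHS](proj1 Apos) mxE.
by congr (_ / _); ring.
Qed.

Lemma euler2_F j y : slit y -> \sum_i y 0 i * pd j (pd i F) y = 0.
Proof.
move=> Vy; have al0 : al y != 0 by rewrite gt_eqF// al_gt0.
have sal : \sum_i y 0 i * al_ i y = al y.
  have /eqP := al_sqr y; rewrite bil_lin linE => /eqP H.
  apply: (mulIf al0); rewrite -expr2 H mulr_suml; apply: eq_bigr => i _.
  by rewrite /ab_dir; field.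
have sb : \sum_i y 0 i * b 0 i = s y * al y.
  by rewrite s_al// linE; apply: eq_bigr => i _; rewrite mulrC.
have sA : \sum_i y 0 i * A i j = al_ j y * al y by rewrite /ab_dir mulfVK// mxE.
set f2 := derive1n 2 phi (s y).
rewrite (eq_bigr (fun i => (P y / al y) * (y 0 i * A i j)
  - (P y / al y * al_ j y) * (y 0 i * al_ i y)
  + (f2 * (b 0 j - s y * al_ j y) / al y) * (y 0 i * b 0 i)
  - (f2 * (b 0 j - s y * al_ j y) / al y * s y) * (y 0 i * al_ i y))); last first.
  by move=> i _; rewrite pd2_F// -/f2; field.
rewrite !big_split/= !sumrN -!mulr_sumr sal sb sA.
by field.
Qed.

Definition metric y : 'M[R]_n :=
  \matrix_(i, j) (pd i F y * pd j F y + F y * pd j (pd i F) y).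

(** A kernel vector [v] satisfies [F_v^2 + F F_vv = 0], which [alpha_beta_definite] excludes unless
    [v = 0]; its curvature hypothesis is regularity at [t = |b|]. *)
Lemma metric_unit y : slit y -> metric y \in unitmx.
Proof.
move=> Vy; rewrite unitmxE unitfE; apply/det0P => -[v v0 vg].
have al0 := al_gt0 Vy; have alN0 : al y != 0 by rewrite gt_eqF.
have : bil (metric y) v v = 0 by rewrite bil_lin vg /lin mul0mx mxE.
set av := bil A y v / al y.
have sal : \sum_i v 0 i * al_ i y = av.
  rewrite /av bil_lin linE mulr_suml; apply: eq_bigr => i _.
  by rewrite /ab_dir; ring.
have sb : \sum_i v 0 i * b 0 i = lin b v.
  by rewrite linE; apply: eq_bigr => i _; rewrite mulrC.
have sF : \sum_i v 0 i * pd i F y = av * P y + derive1 phi (s y) * lin b v.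
  rewrite -sal -sb mulr_suml mulr_sumr -big_split/=; apply: eq_bigr => i _.
  by rewrite pd_F//; ring.
have sF2 : \sum_i \sum_j v 0 i * v 0 j * pd j (pd i F) y =
    ((bil A v v - av ^+ 2) * P y +
     derive1n 2 phi (s y) * (lin b v - s y * av) ^+ 2) / al y.
  set f2 := derive1n 2 phi (s y).
  transitivity (\sum_i \sum_j ((P y / al y) * (A i j * v 0 i * v 0 j)
    + (- (P y / al y)) * ((v 0 i * al_ i y) * (v 0 j * al_ j y))
    + (f2 / al y) * ((v 0 i * b 0 i - s y * (v 0 i * al_ i y)) *
                      (v 0 j * b 0 j - s y * (v 0 j * al_ j y))))).
    by apply: eq_bigr => i _; apply: eq_bigr => j _; rewrite pd2_F// -/f2; field.
  have sprod (f g : 'I_n -> R) : \sum_i \sum_j f i * g j = (\sum_i f i) * (\sum_j g j).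
    by rewrite mulr_suml; apply: eq_bigr => i _; rewrite mulr_sumr.
  have sum3 (c1 c2 c3 : R) (X Y Z : 'I_n -> 'I_n -> R) :
      \sum_i \sum_j (c1 * X i j + c2 * Y i j + c3 * Z i j) =
      c1 * (\sum_i \sum_j X i j) + c2 * (\sum_i \sum_j Y i j)
      + c3 * (\sum_i \sum_j Z i j).
    rewrite !mulr_sumr -!big_split/=; apply: eq_bigr => i _.
    by rewrite !mulr_sumr -!big_split.
  rewrite sum3 -bilE !sprod sal.
  by rewrite sumrB sb -mulr_sumr sal; field.
rewrite bilE => H.
move/eqP: v0; apply; apply: (alpha_beta_definite Apos (y := y) (al := al y) (s := s y)
  (f := phi (s y)) (f1 := derive1 phi (s y)) (D := derive1n 2 phi (s y))) => //.
- exact: al_sqr.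
- exact: s_al.
- by case: rphi => _ _ + _; apply; exact: s_lt.
- exact: P_gt0.
- have [_ _ _ reg] := rphi.
  have := reg _ _ (s_bound Vy) bnorm.
  by rewrite derive1n1 sqr_sqrtr ?sqnorm_ge0.
rewrite -/av -[al y * phi (s y)]/(F y) -sF2 -sF; apply: etrans H.
rewrite expr2 mulr_suml mulr_sumr -big_split/=; apply: eq_bigr => i _.
rewrite !mulr_sumr -big_split/=; apply: eq_bigr => j _.
have alg (p q r f c d : R) : c * p * (d * q) + f * (c * d * r) =
  (p * q + f * r) * c * d by ring.
by rewrite mxE; exact: alg.
Qed.

End Fiber.
End AlphaBetaCalculus.

(** * The spray and the Euler-Lagrange equations *)

Section EulerLagrange.
Context {R : realType} {n : nat}.
Local Notation E := 'rV[R]_n.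
Variables (f : E -> R) (X G : 'I_n -> E -> R).
Hypotheses (sf : smooth_on slit f) (sX : forall m, smooth_on slit (X m)).
Hypothesis f0 : forall y, slit y -> 0 < f y.
Hypothesis euf : forall y, slit y -> \sum_i y 0 i * pd i f y = f y.
Hypothesis eu2f : forall j y, slit y -> \sum_i y 0 i * pd j (pd i f) y = 0.
Hypothesis symf : forall i j y, slit y -> pd j (pd i f) y = pd i (pd j f) y.
Hypothesis euX : forall m y, slit y -> \sum_i y 0 i * pd i (X m) y = X m y.
Hypothesis sprayG : forall l y, slit y ->
  \sum_i (pd l f y * pd i f y + f y * pd i (pd l f) y) * G i y =
  2^-1 * (\sum_m (pd l f y * X m y + f y * pd l (X m) y) * y 0 m - f y * X l y).

(** In one fibre, [f] is [F] and [X m] is its derivative in [x^m]; the conclusion says that [F] is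
    constant along its spray. The equation for [G] reads [f_l (U0 - 2 V0) + f T_l = 0], with [T_l]
    the Euler-Lagrange defect. Contraction with [y] kills [T] by homogeneity and leaves
    [f (U0 - 2 V0) = 0]. *)
Lemma spray_first_integral y : slit y ->
  \sum_m X m y * y 0 m = 2 * \sum_i pd i f y * G i y.
Proof.
move=> Vy; set U0 := \sum_m _; set V0 := \sum_i _.
pose T l := \sum_m pd l (X m) y * y 0 m - X l y - 2 * \sum_i pd i (pd l f) y * G i y.
have TE l : pd l f y * (U0 - 2 * V0) + f y * T l = 0.
  have := sprayG l Vy.
  rewrite (eq_bigr (fun i => pd l f y * (pd i f y * G i y) +
     f y * (pd i (pd l f) y * G i y))); last by move=> i _; rewrite mulrDl !mulrA.
  rewrite [X in 2^-1 * (X - _)](eq_bigr (fun m => pd l f y * (X m y * y 0 m) +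
     f y * (pd l (X m) y * y 0 m))); last by move=> i _; rewrite mulrDl !mulrA.
  rewrite !big_split/= -!mulr_sumr -/U0 -/V0 /T.
  move: (\sum_i _) (\sum_i _) (pd l f y) (f y) (X l y) => a b p q r H.
  by lra.
have yT : \sum_l y 0 l * T l = 0.
  rewrite /T (eq_bigr (fun l => (\sum_m y 0 m * (y 0 l * pd l (X m) y))
     - y 0 l * X l y - 2 * \sum_i G i y * (y 0 l * pd i (pd l f) y))); last first.
    move=> l _; rewrite !mulrBr; congr (_ - _ - _).
      by rewrite mulr_sumr; apply: eq_bigr => m _; move: (pd l (X m) y) => p; ring.
    rewrite mulrCA; congr (_ * _); rewrite mulr_sumr; apply: eq_bigr => i _.
    by move: (pd i (pd l f) y) => p; ring.
  rewrite !sumrB -mulr_sumr exchange_big/= [X in _ - 2 * X]exchange_big/=.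
  rewrite (eq_bigr (fun m => y 0 m * X m y)); last first.
    by move=> m _; rewrite -mulr_sumr (euX m Vy).
  rewrite subrr [X in _ - 2 * X]big1 ?mulr0 ?subr0// => i _.
  by rewrite -mulr_sumr (eu2f i Vy) mulr0.
have : f y * (U0 - 2 * V0) = 0.
  rewrite -(euf Vy) mulr_suml.
  rewrite (eq_bigr (fun l => (- f y) * (y 0 l * T l))).
    by rewrite -mulr_sumr yT mulr0.
  move=> l _; rewrite -mulrA.
  have /eqP := TE l; rewrite addr_eq0 => /eqP ->.
  by rewrite mulrN mulNr mulrCA.
by move=> /eqP; rewrite mulf_eq0 gt_eqF ?f0//= subr_eq0 => /eqP.
Qed.

Lemma spray_euler_lagrange l y : slit y ->
  \sum_m pd l (X m) y * y 0 m - X l y = 2 * \sum_i pd i (pd l f) y * G i y.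
Proof.
move=> Vy; have := sprayG l Vy.
rewrite (eq_bigr (fun i => pd l f y * (pd i f y * G i y) +
     f y * (pd i (pd l f) y * G i y))); last by move=> i _; rewrite mulrDl !mulrA.
rewrite [X in 2^-1 * (X - _)](eq_bigr (fun m => pd l f y * (X m y * y 0 m) +
     f y * (pd l (X m) y * y 0 m))); last by move=> i _; rewrite mulrDl !mulrA.
rewrite !big_split/= -!mulr_sumr (spray_first_integral Vy).
have := f0 Vy; move: (\sum_i _ * G i y) (\sum_i _ * G i y) (pd l f y) (f y) (X l y).
move: (\sum_i _) => d a b p q r q0 H; have qN0 : q != 0 by rewrite gt_eqF.
by apply: (mulfI qN0); lra.
Qed.

(** Differentiating the first integral in [y^l] and subtracting the Euler-Lagrange equation leaves
    twice [X l]. The terms [f_il h_i] cancel, and the radial part of [G] contributes nothing to them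
    because [f_il y_i] sums to zero. *)
Lemma isotropic_berwald_first_order (h : 'I_n -> E -> R) (c : R) :
  (forall i, smooth_on slit (h i)) ->
  (forall i y, slit y -> G i y = h i y + c * (f y * y 0 i)) ->
  forall l y, slit y ->
  X l y = \sum_i pd i f y * pd l (h i) y + 2 * c * (f y * pd l f y).
Proof.
move=> sh GE l y Vy; have o := @open_slit R n.
have sc := @smooth_on_slit_coord R n.
have s1 i := smooth_on_pd i sf.
have E1 z : slit z -> \sum_m X m z * z 0 m =
    2 * (\sum_i pd i f z * h i z) + 2 * c * (f z * f z).
  move=> Vz; rewrite spray_first_integral// -[in RHS](euf Vz).
  rewrite [X in _ + _ * (_ * X)](euf Vz) mulr_suml [X in _ + X]mulr_sumr.
  rewrite [in RHS]mulr_sumr [in LHS]mulr_sumr -big_split/=; apply: eq_bigr => i _.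
  rewrite (GE i z Vz).
  by move: (pd i f z) (h i z) (f z) (z 0 i) => p q r t; ring.
have sS1 : smooth_on slit (fun z => \sum_i pd i f z * h i z).
  by apply: smooth_on_sum => // i _; exact: smooth_onM.
have sff : smooth_on slit (fun z => f z * f z) by exact: smooth_onM.
have := pd_eq_on l o Vy E1.
rewrite (pd_on_slit_sum l (fun m => smooth_onM o (sX m) (sc m)) Vy).
rewrite (pd_on_slitD l (smooth_onZ _ o sS1) (smooth_onZ _ o sff) Vy).
rewrite (pd_on_slitZ l _ sS1 Vy) (pd_on_slitZ l _ sff Vy) (pd_on_slitM l sf sf Vy).
rewrite (pd_on_slit_sum l (fun i => smooth_onM o (s1 i) (sh i)) Vy).
rewrite (eq_bigr (fun m => pd l (X m) y * y 0 m + X m y * (l == m)%:R)); last first.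
  by move=> m _; rewrite (pd_on_slitM l (sX m) (sc m) Vy) pd_coord addrC mulrC [_ * y 0 m]mulrC.
rewrite big_split/= [X in _ + X = _](_ : _ = X l y); last first.
  rewrite (bigD1 l)//= eqxx mulr1 big1 ?addr0// => m ml.
  by rewrite eq_sym (negbTE ml) mulr0.
have -> : \sum_i pd l (fun z => pd i f z * h i z) y =
    \sum_i (pd i f y * pd l (h i) y + pd i (pd l f) y * h i y).
  apply: eq_bigr => i _.
  by rewrite (pd_on_slitM l (s1 i) (sh i) Vy) (symf i l Vy) [_ * h i y]mulrC.
rewrite big_split/=.
have := spray_euler_lagrange l Vy.
have -> : \sum_i pd i (pd l f) y * G i y =
    \sum_i (pd i (pd l f) y * h i y + (c * f y) * (y 0 i * pd i (pd l f) y)).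
  apply: eq_bigr => i _; rewrite (GE i y Vy).
  by move: (pd i (pd l f) y) (h i y) (f y) (y 0 i) => p q r t; ring.
rewrite big_split/= -mulr_sumr.
have -> : \sum_i y 0 i * pd i (pd l f) y = 0.
  rewrite -[RHS](eu2f l Vy); apply: eq_bigr => i _.
  by rewrite (symf i l Vy).
move: (\sum_i _) (\sum_i _) (\sum_i _) (X l y) (f y) (pd l f y) => a b d e p q H1 H2.
by lra.
Qed.

End EulerLagrange.

(** * Even and odd parts of the first-order identity at one point *)

Section ParallelAlgebra.
Context {R : realType} {n : nat}.
Local Notation E := 'rV[R]_n.

(** [e = 1] and [e = -1] stand for [y] and [-y]: [X] is even, while [B], [Y], [L] are odd. Half the
    sum and half the difference of the two instances, cleared of denominators by [a^3] and [a^4],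
    are the two conclusions. *)
Lemma parity_split (a X Y B L bl c eps k : R) : a != 0 ->
  (forall e : R, e = 1 \/ e = -1 ->
    X / a * (1 - k * (e * B / a) ^+ 2) + (eps + 2 * k * (e * B / a)) * (e * Y) =
    2 * c * (a * (1 + eps * (e * B / a) + k * (e * B / a) ^+ 2) *
     (e * L / a * (1 - k * (e * B / a) ^+ 2) + (eps + 2 * k * (e * B / a)) * bl))) ->
  let q := a ^+ 2 in
  (q - k * B ^+ 2) * X + 2 * k * q * B * Y =
    2 * c * eps * ((q + k * B ^+ 2) * q * bl
                   + B * ((q - k * B ^+ 2) * L + 2 * k * B * q * bl)) /\
  eps * q ^+ 2 * Y =
    2 * c * ((q + k * B ^+ 2) * ((q - k * B ^+ 2) * L + 2 * k * B * q * bl)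
             + eps ^+ 2 * B * q ^+ 2 * bl).
Proof.
move=> a0 H q.
have sub0 (x y : R) : x = y -> x - y = 0 by move=> ->; rewrite subrr.
have := sub0 _ _ (H 1 (or_introl erefl)); set l1 := (X in X = 0) => H1.
have := sub0 _ _ (H (-1) (or_intror erefl)); set l2 := (X in X = 0) => H2.
split; apply/eqP; rewrite -subr_eq0; apply/eqP.
  transitivity (a ^+ 3 / 2 * (l1 + l2)); last by rewrite H1 H2; ring.
  by rewrite /l1 /l2 /q; field.
transitivity (a ^+ 4 / 2 * (l1 - l2)); last by rewrite H1 H2; ring.
by rewrite /l1 /l2 /q; field.
Qed.

Variables (A : 'M[R]_n) (b : E) (eps k c : R).
Variables (Xm : 'I_n -> 'M[R]_n) (Em : 'M[R]_n).
Hypotheses (n1 : (1 < n)%N) (Apos : posdef A) (k0 : k != 0).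

Let q (y : E) := bil A y y.
Let be (y : E) := lin b y.
Let X l (y : E) := bil (Xm l) y y.
Let Y l (y : E) := (y *m Em^T) 0 l.
Let L l (y : E) := (y *m A) 0 l.

Hypothesis first_order : forall l y, slit y ->
  let al := Num.sqrt (q y) in let s := be y / al in
  X l y / al * (1 - k * s ^+ 2) + (eps + 2 * k * s) * Y l y =
  2 * c * (al * (1 + eps * s + k * s ^+ 2) *
     (L l y / al * (1 - k * s ^+ 2) + (eps + 2 * k * s) * b 0 l)).

Lemma even_odd l y : slit y ->
  (q y - k * be y ^+ 2) * X l y + 2 * k * q y * be y * Y l y =
    2 * c * eps * ((q y + k * be y ^+ 2) * q y * b 0 l
      + be y * ((q y - k * be y ^+ 2) * L l y + 2 * k * be y * q y * b 0 l)) /\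
  eps * q y ^+ 2 * Y l y =
    2 * c * ((q y + k * be y ^+ 2) *
        ((q y - k * be y ^+ 2) * L l y + 2 * k * be y * q y * b 0 l)
      + eps ^+ 2 * be y * q y ^+ 2 * b 0 l).
Proof.
move=> Vy; have q0 : 0 < q y by exact: (proj2 Apos).
have al0 : Num.sqrt (q y) != 0 by rewrite gt_eqF// sqrtr_gt0.
have alE : Num.sqrt (q y) ^+ 2 = q y by rewrite sqr_sqrtr// ltW.
have [|e1 e2] := @parity_split _ (X l y) (Y l y) (be y) (L l y) (b 0 l) c eps k al0.
  move=> e eE; have Vey : slit (e *: y).
    apply: contraNneq Vy => /eqP; rewrite scaler_eq0 => /orP[/eqP e0|//].
    by case: eE; rewrite e0 => /eqP; [rewrite eq_sym oner_eq0|rewrite eq_sym oppr_eq0 oner_eq0].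
  have ee : e * e = 1 by case: eE => ->; rewrite ?mulr1// mulrNN mulr1.
  have := first_order l Vey.
  have scE (M : 'M[R]_n) : (e *: y *m M) 0 l = e * (y *m M) 0 l.
    by rewrite -scalemxAl mxE.
  rewrite /q /be /X /Y /L !bilZl !bilZr linZr !scE.
  by rewrite !(mulrA e e) ee !mul1r.
by rewrite alE in e1 e2.
Qed.

Lemma orthogonal_vector : b != 0 -> exists v : E, v != 0 /\ lin b v = 0.
Proof.
move=> b0; have [i bi] : exists i, b 0 i != 0.
  apply/existsP; apply: contraT; rewrite negb_exists => /forallP H.
  by move/eqP: b0; case; apply/rowP => i; rewrite mxE; apply/eqP/negPn/H.
have [j ji] : exists j, j != i.
  pose i0 := Ordinal (ltnW n1); pose i1 := Ordinal n1.
  by have [->|ii0] := eqVneq i i0; [exists i1|exists i0; rewrite eq_sym].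
have dl m : lin b (delta_mx 0 m) = b 0 m.
  rewrite linE (bigD1 m)//= big1 => [|m' mm']; rewrite mxE.
    by rewrite !eqxx mulr1 addr0.
  by rewrite (negbTE mm') andbF mulr0.
exists (b 0 i *: delta_mx 0 j + (- b 0 j) *: delta_mx 0 i); split.
  apply/eqP => /rowP /(_ j) /eqP; rewrite !mxE !eqxx (negbTE ji) mulr1 mulr0 addr0.
  by rewrite (negbTE bi).
by rewrite linDr !linZr !dl; ring.
Qed.

Lemma sharp_pos : b != 0 -> 0 < lin b (sharp A b).
Proof.
move=> b0; rewrite -(bil_sharp Apos); apply: (proj2 Apos).
apply: contra_neq b0 => s0.
by rewrite -[b](mulmxKV (posdef_unit Apos)) -/(sharp A b) s0 mul0mx.
Qed.

(** Contracted with [y], the odd part becomes [eqB]. If [q] could vanish, only [2 c k^2 be^4] would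
    survive there. It has no real zero, but along [u + t v], with [v] in the kernel of [b], the
    identity is polynomial in [t] with [be = r] and [q = r + t^2 m], so it can be read at
    [t^2 = - r / m]. *)
Lemma divergence_factor_eq0 : b != 0 -> c = 0.
Proof.
move=> b0; have [v [v0 bv]] := orthogonal_vector b0.
set u := sharp A b; have r0 : 0 < lin b u by exact: sharp_pos.
set r := lin b u in r0.
have m0 : 0 < q v by exact: (proj2 Apos).
have uv : bil A u v = 0 by rewrite (bil_sharp Apos).
have vu : bil A v u = 0 by rewrite (bilC _ _ (proj1 Apos)).
pose B y := bil Em y y.
have eqB y : slit y -> eps * q y * B y =
    2 * c * ((q y + k * be y ^+ 2) ^+ 2 + eps ^+ 2 * q y * be y ^+ 2).
  move=> Vy; have qN0 : q y != 0 by rewrite gt_eqF//; exact: (proj2 Apos).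
  apply: (mulfI qN0).
  have -> : q y * (eps * q y * B y) = \sum_l y 0 l * (eps * q y ^+ 2 * Y l y).
    transitivity (eps * q y ^+ 2 * (\sum_l y 0 l * Y l y)); last first.
      by rewrite mulr_sumr; apply: eq_bigr => l _; ring.
    have -> : B y = \sum_l y 0 l * Y l y.
      rewrite /B bilE; apply: eq_bigr => l _.
      by rewrite /Y mxE mulr_sumr; apply: eq_bigr => j _; rewrite mxE; ring.
    by ring.
  set d1 := (q y + k * be y ^+ 2) * (q y - k * be y ^+ 2).
  set d2 := (q y + k * be y ^+ 2) * (2 * k * be y * q y) + eps ^+ 2 * be y * q y ^+ 2.
  rewrite (eq_bigr (fun l => 2 * c * d1 * (y 0 l * L l y) + 2 * c * d2 * (y 0 l * b 0 l))); last first.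
    by move=> l _; rewrite (proj2 (even_odd l Vy)) /d1 /d2; ring.
  rewrite big_split/= -!mulr_sumr.
  have -> : \sum_l y 0 l * L l y = q y.
    by rewrite /q bil_lin linE; apply: eq_bigr => l _; rewrite mulrC.
  have -> : \sum_l y 0 l * b 0 l = be y.
    by rewrite /be linE; apply: eq_bigr => l _; rewrite mulrC.
  by rewrite /d1 /d2; ring.
have Vt (t : R) : slit (u + t *: v).
  apply/eqP => H; have : lin b (u + t *: v) = 0 by rewrite H /lin trmx0 mulmx0 mxE.
  by rewrite linDr linZr bv mulr0 addr0 => /eqP; rewrite gt_eqF.
have bt (t : R) : be (u + t *: v) = r by rewrite /be linDr linZr bv mulr0 addr0.
have qt (t : R) : q (u + t *: v) = r + t ^+ 2 * q v.
  rewrite /q !(bilDl, bilDr, bilZl, bilZr) uv vu.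
  by rewrite (bil_sharp Apos) -/u -/r; ring.
have Bt (t : R) : B (u + t *: v) = B u + t * (bil Em u v + bil Em v u) + t ^+ 2 * B v.
  by rewrite /B !(bilDl, bilDr, bilZl, bilZr); ring.
have eqt (t : R) := eqB _ (Vt t).
have := eqt 0; have := eqt 1; have := eqt (-1); have := eqt 2; have := eqt (-2).
rewrite !bt !qt !Bt; move: m0; move: (q v) (B u) (B v) (bil Em u v + bil Em v u).
move=> m B0 B2 B1 m0 e1 e2 e3 e4 e5.
(* The coefficients of [1], [t^2] and [t^4]; adding the values at [t] and [-t] removes the odd
   powers. *)
pose p0 := eps * r * B0 - 2 * c * ((r + k * r ^+ 2) ^+ 2 + eps ^+ 2 * r * r ^+ 2).
pose p1 := eps * (r * B2 + m * B0) -
  2 * c * (2 * (r + k * r ^+ 2) * m + eps ^+ 2 * m * r ^+ 2).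
pose p2 := eps * m * B2 - 2 * c * m ^+ 2.
have P0 : p0 = 0 by rewrite /p0; lra.
have P1 : p0 + p1 + p2 = 0 by rewrite /p0 /p1 /p2; lra.
have P2 : p0 + 4 * p1 + 16 * p2 = 0 by rewrite /p0 /p1 /p2; lra.
have P1' : p1 = 0 by lra.
have P2' : p2 = 0 by lra.
(* The value at [t^2 = - r / m], multiplied by [m^2]. *)
have : p0 * m ^+ 2 - r * m * p1 + r ^+ 2 * p2 = - (2 * c * k ^+ 2 * r ^+ 4 * m ^+ 2).
  by rewrite /p0 /p1 /p2; ring.
rewrite P0 P1' P2' => H; apply: (@mulfI _ (k ^+ 2 * r ^+ 4 * m ^+ 2)); last by lra.
have rr : r ^+ 4 != 0 by rewrite expf_neq0// gt_eqF.
have mm : m ^+ 2 != 0 by rewrite expf_neq0// gt_eqF.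
exact: mulf_neq0 (mulf_neq0 (expf_neq0 2 k0) rr) mm.
Qed.

(** Where [b = 0] the even part is just [q X = 0]. Elsewhere [c = 0], and the even part alone, now
    linear homogeneous in [X] and [Y], determines both; in particular [eps] may be zero. *)
Lemma parallel_forms :
  (forall l y, bil (Xm l) y y = 0) /\ (b != 0 -> Em = 0).
Proof.
have [b0|b0] := eqVneq b 0.
  split=> [l y|]; last by [].
  have [->|Vy] := eqVneq y 0; first by rewrite /bil !mul0mx mxE.
  have [] := even_odd l Vy.
  have -> : be y = 0 by rewrite /be b0 /lin mul0mx mxE.
  rewrite b0 mxE !(expr0n, mulr0, mul0r, addr0, subr0)/= => /eqP + _.
  by rewrite ?mulr0 mulf_eq0 (gt_eqF (proj2 Apos _ Vy))/= => /eqP.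
have c0 := divergence_factor_eq0 b0.
set u := sharp A b; have r0 : 0 < lin b u by exact: sharp_pos.
set r := lin b u in r0.
have uE w : bil A u w = lin b w by exact: (bil_sharp Apos).
have Yl l y z (t : R) : Y l (y + t *: z) = Y l y + t * Y l z.
  by rewrite /Y mulmxDl -scalemxAl !mxE.
have main l v : v != 0 -> lin b v = 0 ->
    [/\ X l v = 0, X l u = 0, bil (Xm l) u v + bil (Xm l) v u = 0,
        Y l u = 0 & Y l v = 0].
  move=> v0 bv; have m0 : 0 < q v by exact: (proj2 Apos).
  have Xv : X l v = 0.
    have [] := even_odd l v0.
    rewrite /be bv c0 !(expr0n, mulr0, mul0r, addr0, subr0)/= => /eqP + _.
    by rewrite mulf_eq0 (gt_eqF m0)/= => /eqP.
  have Vt (t : R) : slit (u + t *: v).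
    apply/eqP => H; have : lin b (u + t *: v) = 0 by rewrite H /lin trmx0 mulmx0 mxE.
    by rewrite linDr linZr bv mulr0 addr0 => /eqP; rewrite gt_eqF.
  have bt (t : R) : be (u + t *: v) = r by rewrite /be linDr linZr bv mulr0 addr0.
  have qt (t : R) : q (u + t *: v) = r + t ^+ 2 * q v.
    rewrite /q !(bilDl, bilDr, bilZl, bilZr) (bilC v u (proj1 Apos)) !uE bv -/r.
    by ring.
  have Xt (t : R) : X l (u + t *: v) =
      X l u + t * (bil (Xm l) u v + bil (Xm l) v u).
    rewrite /X !(bilDl, bilDr, bilZl, bilZr) -/(X l v) Xv; ring.
  have eqt (t : R) := proj1 (even_odd l (Vt t)).
  have := eqt 1; have := eqt (-1); have := eqt 2; have := eqt (-2); have := eqt 0.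
  rewrite !bt !qt !Xt !Yl c0 !(mulr0, mul0r).
  move: m0; move: (q v) (X l u) (bil (Xm l) u v + _) (Y l u) (Y l v).
  move=> m X0 X1 Y0 Y1 m0 e1 e2 e3 e4 e5.
  have rN0 : r != 0 by rewrite gt_eqF.
  have mN0 : m != 0 by rewrite gt_eqF.
  (* The coefficients of [t^2] and [1] give this system for [X0], [Y0], those of [t^3] and [t] give
     it for [X1], [Y1]. Its determinant is [2 k^2 r^3 m]. *)
  have solve (X' Y' : R) : m * X' + 2 * k * r * m * Y' = 0 ->
      (r - k * r ^+ 2) * X' + 2 * k * r ^+ 2 * Y' = 0 -> X' = 0 /\ Y' = 0.
    move=> f1 f2; have XE : X' = - (2 * k * r * Y').
      apply: (mulfI mN0); lra.
    have H : 2 * k ^+ 2 * r ^+ 3 * Y' = 0 by rewrite -f2 XE; ring.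
    have Y0' : Y' = 0.
      apply: (@mulfI _ (k ^+ 2 * r ^+ 3)); last by lra.
      exact: mulf_neq0 (expf_neq0 2 k0) (expf_neq0 3 rN0).
    by split => //; rewrite XE Y0' mulr0 oppr0.
  have [X00 Y00] : X0 = 0 /\ Y0 = 0 by apply: solve; lra.
  have [X10 Y10] : X1 = 0 /\ Y1 = 0 by apply: solve; lra.
  by split.
have decomp y : exists v (t : R), lin b v = 0 /\ y = v + t *: u.
  exists (y + (- (lin b y / r)) *: u), (lin b y / r); split.
    by rewrite linDr linZr -/r mulNr divfK ?subrr// gt_eqF.
  by rewrite -addrA -scalerDl addNr scale0r addr0.
have [v1 [v10 bv1]] := orthogonal_vector b0.
split=> [l y|_].
  have [v [t [bv ->]]] := decomp y.
  have [_ Xu _ _ _] := main l v1 v10 bv1.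
  have [->|v0] := eqVneq v 0.
    by rewrite add0r bilZl bilZr -/(X l u) Xu !mulr0.
  have [Xv _ Xuv _ _] := main l v v0 bv.
  have -> : bil (Xm l) (v + t *: u) (v + t *: u) =
      X l v + t * (bil (Xm l) u v + bil (Xm l) v u) + t ^+ 2 * X l u.
    by rewrite /X !(bilDl, bilDr, bilZl, bilZr); ring.
  by rewrite Xv Xu Xuv; ring.
have Y0 l y : Y l y = 0.
  have [v [t [bv ->]]] := decomp y.
  have [_ _ _ Yu _] := main l v1 v10 bv1.
  rewrite Yl Yu mulr0 addr0; have [->|v0] := eqVneq v 0; first by rewrite /Y mul0mx mxE.
  by have [_ _ _ _] := main l v v0 bv.
apply/matrixP => l j; rewrite mxE -(Y0 l (delta_mx 0 j)).
by rewrite /Y -rowE !mxE.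
Qed.

End ParallelAlgebra.

(** * Volume and linear changes of variables *)

Section TupleMeasure.
Context {R : realType}.
Local Notation mR := (measurableTypeR R).
Local Notation mu := (@lebesgue_measure R).

Definition row_of_tuple n (t : n.-tuple mR) : 'rV[R]_n := \row_i tnth t i.
Definition tuple_of_row n (v : 'rV[R]_n) : n.-tuple mR := [tuple v 0 i | i < n].

Lemma tuple_of_rowK n : cancel (@tuple_of_row n) (@row_of_tuple n).
Proof. by move=> v; apply/rowP => i; rewrite mxE tnth_mktuple. Qed.

(* Row vectors carry no measurable structure in the library; Borel sets are
   transported from tuples. *)
Definition borel n (A : set 'rV[R]_n) : Prop := measurable (@row_of_tuple n @^-1` A).

Section ConsMeasure.
Variables (m : nat) (nu : {sigma_finite_measure set (m.-tuple mR) -> \bar R}).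

Definition consm (x : mR * m.-tuple mR) : m.+1.-tuple mR := [tuple of x.1 :: x.2].

Lemma measurable_consm : measurable_fun setT consm.
Proof. exact: measurable_cons. Qed.

(** Kept as a separate name so that the measure and sigma-finiteness structures can be attached to
    it and the construction iterated over the dimension. *)
Definition cons_measure : set (m.+1.-tuple mR) -> \bar R :=
  pushforward (mu \x nu)%E consm.

Definition cons_measure_of : {measure set (m.+1.-tuple mR) -> \bar R} :=
  @measure_function_pushforward__canonical__measure_function_Measure
    _ _ _ _ _ (mu \x nu)%E consm measurable_consm.

HB.instance Definition _ := Measure.copy cons_measure cons_measure_of.

Definition unconsm (t : m.+1.-tuple mR) : mR * m.-tuple mR :=
  (thead t, [tuple of behead t]).

Lemma consmK : cancel consm unconsm.
Proof.
move=> [x w]; rewrite /unconsm /consm/= theadE; congr pair.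
by apply: val_inj.
Qed.

Lemma measurable_unconsm : measurable_fun setT unconsm.
Proof.
apply: measurable_fun_pair; first exact: (measurable_tnth ord0).
exact: measurable_behead.
Qed.

Lemma cons_measure_sigma_finite : sigma_finite setT cons_measure.
Proof.
have /sigma_finiteP[F [TF ndF Foo]] := sigma_finiteT mu.
have /sigma_finiteP[G [TG ndG Goo]] := sigma_finiteT nu.
exists (fun i => unconsm @^-1` (F i `*` G i)).
  apply/seteqP; split => // t _.
  have [i _ Fi] : (\bigcup_i F i) (unconsm t).1 by rewrite -TF.
  have [j _ Gj] : (\bigcup_i G i) (unconsm t).2 by rewrite -TG.
  exists (maxn i j) => //; split.
    by move: Fi; exact/subsetPset/ndF/leq_maxl.
  by move: Gj; exact/subsetPset/ndG/leq_maxr.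
move=> i; have [mF Foo_] := Foo i; have [mG Goo_] := Goo i.
have mFG : measurable (F i `*` G i) by exact: measurableX.
split; first by rewrite -[X in measurable X]setTI; exact: measurable_unconsm.
rewrite /cons_measure /pushforward (_ : consm @^-1` _ = F i `*` G i); last first.
  by apply/funext => x; rewrite /preimage/mkset consmK.
by rewrite product_measure1E// lte_mul_pinfty// ge0_fin_numE.
Qed.

HB.instance Definition _ :=
  Measure_isSigmaFinite.Build _ _ _ cons_measure cons_measure_sigma_finite.

End ConsMeasure.

Lemma row_of_tuple_cons m (t : R) (w : m.-tuple mR) :
  row_of_tuple (consm (t, w)) =
  row_mx (t%:M : 'rV_1) (row_of_tuple w) :> 'rV[R]_(1 + m).
Proof.
apply/rowP => i; rewrite mxE [RHS]mxE; case: split_ordP => j ->.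
  rewrite (ord1 j) !mxE eqxx mulr1n (_ : lshift m 0 = ord0) ?tnth0//.
  exact: val_inj.
rewrite mxE (_ : rshift 1 j = lift ord0 j) ?tnthS//.
exact: val_inj.
Qed.

Definition slice m (A : set 'rV[R]_m.+1) (t : R) : set 'rV[R]_m :=
  [set v | A (row_mx (t%:M : 'rV_1) v : 'rV_(1 + m))].

Lemma slice_preimage m (A : set 'rV[R]_m.+1) t :
  @row_of_tuple m @^-1` slice A t = xsection (@consm m @^-1` (@row_of_tuple m.+1 @^-1` A)) t.
Proof.
apply/seteqP; split => w; rewrite /xsection/mkset.
  by move=> H; apply/mem_set; rewrite /preimage/mkset row_of_tuple_cons.
by move/set_mem; rewrite /preimage/mkset row_of_tuple_cons.
Qed.

Lemma measurable_consm_preimage m (A : set 'rV[R]_m.+1) : borel A ->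
  measurable (@consm m @^-1` (@row_of_tuple m.+1 @^-1` A)).
Proof.
by move=> bA; rewrite -[X in measurable X]setTI; exact: measurable_consm.
Qed.

Lemma borel_slice m (A : set 'rV[R]_m.+1) t : borel A -> borel (slice A t).
Proof.
move=> bA; rewrite /borel slice_preimage; apply: measurable_xsection.
exact: measurable_consm_preimage.
Qed.

Lemma volumeS m (A : set 'rV[R]_m.+1) :
  volume A = (\int[mu]_t volume (slice A t))%E.
Proof. by []. Qed.

(** Peeling off one coordinate, [volume] satisfies the same recursion as the iterated product
    measure. The identification provides monotonicity, measurability of slice volumes and
    Tonelli. *)
Lemma borel_measure n :
  exists nu : {sigma_finite_measure set (n.-tuple mR) -> \bar R},
  forall A : set 'rV[R]_n, borel A -> volume A = nu (@row_of_tuple n @^-1` A).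
Proof.
elim: n => [|m [nu nuE]].
  exists (\d_([tuple] : 0.-tuple mR)) => A _.
  rewrite /= diracE indicE; suff -> : (0 \in A) = ([tuple] \in @row_of_tuple 0 @^-1` A) by [].
  have t0 : row_of_tuple ([tuple] : 0.-tuple mR) = 0 by apply/rowP => -[].
  by apply/idP/idP => /set_mem H; apply/mem_set; move: H; rewrite /= t0.
exists (cons_measure nu) => A bA; rewrite volumeS.
rewrite /cons_measure /pushforward /product_measure1/=.
apply: eq_integral => t _.
by rewrite nuE ?slice_preimage//; exact: borel_slice.
Qed.

Lemma volume_ge0 n (A : set 'rV[R]_n) : borel A -> (0 <= volume A)%E.
Proof. by move=> bA; have [nu nuE] := borel_measure n; rewrite nuE. Qed.

Lemma measurable_volume_slice m (A : set 'rV[R]_m.+1) : borel A ->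
  measurable_fun setT ((fun t => volume (slice A t)) : mR -> \bar R).
Proof.
move=> bA; have [nu nuE] := borel_measure m.
rewrite (_ : (fun t => _) = nu \o xsection (@consm m @^-1` (@row_of_tuple m.+1 @^-1` A))).
  exact: measurable_fun_xsection (measurable_consm_preimage bA).
by apply/funext => t /=; rewrite nuE ?slice_preimage//; exact: borel_slice.
Qed.

Lemma borel_preimage n p (f : 'rV[R]_n -> 'rV[R]_p) (A : set 'rV[R]_p) :
  (forall i, measurable_fun setT ((fun t => f (row_of_tuple t) 0 i) : n.-tuple mR -> mR)) ->
  borel A -> borel (f @^-1` A).
Proof.
move=> mf bA; pose g t := tuple_of_row (f (row_of_tuple t)).
have mg : measurable_fun setT g.
  apply/measurable_fun_tnthP => i; apply: eq_measurable_fun (mf i) => t _.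
  by rewrite /g/= tnth_mktuple.
rewrite /borel (_ : _ @^-1` _ = g @^-1` (@row_of_tuple p @^-1` A)).
  by rewrite -[X in measurable X]setTI; exact: mg.
by apply/seteqP; split => t /=; rewrite /g tuple_of_rowK.
Qed.

Lemma borel_affine n p (M : 'M[R]_(n, p)) w (A : set 'rV[R]_p) : borel A ->
  borel [set y | A (y *m M + w)].
Proof.
apply: borel_preimage => i.
rewrite (_ : (fun t => _) = (fun t => \sum_j (tnth t j * M j i) + w 0 i)).
  apply: measurable_funD; last exact: measurable_cst.
  apply: measurable_sum => j; apply: measurable_funM; last exact: measurable_cst.
  exact: measurable_tnth.
apply/funext => t; rewrite !mxE; congr (_ + _); apply: eq_bigr => j _.
by rewrite mxE.
Qed.

(** Lebesgue measure is [|d|] times its pushforward under [t |-> d t + e], since the two agree on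
    half-open intervals; the formula is then integration against an image measure. *)
Lemma ge0_integral_affine (d e : R) (f : R -> \bar R) : d != 0 ->
  measurable_fun setT (f : mR -> \bar R) -> (forall t, (0 <= f t)%E) ->
  (\int[mu]_t f (d * t + e)%R = (`|d|^-1)%:E * \int[mu]_t f t)%E.
Proof.
move=> d0 mf f0.
have d_gt0 : 0 < `|d| by rewrite normr_gt0.
pose psi (t : mR) : mR := d * t + e.
have mpsi : measurable_fun setT psi.
  by apply: measurable_funD => //; exact: measurable_funM.
have nd : 0 <= `|d| by [].
pose nuP : {measure set mR -> \bar R} :=
  @measure_function_pushforward__canonical__measure_function_Measure
    _ _ _ _ _ mu psi mpsi.
have muE A : measurable A -> mu A = mscale (NngNum nd) nuP A.
  apply: lebesgue_measure_unique => _ [[a b] _ <-] /=.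
  rewrite lebesgue_measure_itv/= /mscale /= /nuP /= /pushforward.
  have [dp|dn] := ltP 0 d.
    rewrite (_ : psi @^-1` _ = [set` `](a - e) / d, (b - e) / d]]).
      rewrite lebesgue_measure_itv/= !lte_fin ltr_pM2r ?invr_gt0// ltrD2r.
      case: ifPn => _; last by rewrite mule0.
      by rewrite -!EFinB -EFinM gtr0_norm//; congr EFin; field.
    apply/seteqP; split => t /=; rewrite !in_itv/= /psi.
      by rewrite ltr_pdivrMr// ler_pdivlMr// ltrBlDr lerBrDr mulrC.
    by rewrite ltr_pdivrMr// ler_pdivlMr// ltrBlDr lerBrDr mulrC.
  (* A negative factor reverses the interval: the preimage of []a, b]] is closed on the left
     instead, with the same length. *)
  have dn' : d < 0 by rewrite lt_neqAle d0.
  rewrite (_ : psi @^-1` _ = [set` `[(b - e) / d, (a - e) / d[]).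
    rewrite lebesgue_measure_itv/= !lte_fin ltr_nM2r ?invr_lt0// ltrD2r.
    case: ifPn => _; last by rewrite mule0.
    by rewrite -!EFinB -EFinM ltr0_norm//; congr EFin; field.
  apply/seteqP; split => t /=; rewrite !in_itv/= /psi.
    by rewrite ltr_ndivlMr// ler_ndivrMr// ltrBlDr lerBrDr mulrC => /andP[-> ->].
  by rewrite ltr_ndivlMr// ler_ndivrMr// ltrBlDr lerBrDr mulrC => /andP[-> ->].
have -> : (\int[mu]_t f t = \int[mscale (NngNum nd) nuP]_t f t)%E.
  by apply: eq_measure_integral => A mA _; exact: muE.
rewrite ge0_integral_mscale//=.
rewrite muleA -EFinM mulVf ?mul1e ?gt_eqF//.
rewrite [in RHS]/= ge0_integral_pushforward//.
Qed.

End TupleMeasure.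

(** * Volume under invertible linear maps *)

Section LinearChange.
Context {R : realType}.
Local Notation mR := (measurableTypeR R).
Local Notation mu := (@lebesgue_measure R).

Lemma row_mx_translate m (t : R) (v : 'rV[R]_m) (w : 'rV[R]_(1 + m)) :
  row_mx (t%:M : 'rV_1) v + w =
  row_mx ((1 * t + w 0 0)%:M : 'rV_1) (v + rsubmx w).
Proof.
have wE : w = row_mx ((w 0 0)%:M : 'rV_1) (rsubmx w).
  rewrite -[LHS]hsubmxK [lsubmx w]mx11_scalar mxE; congr (row_mx (w 0 _)%:M _).
  exact: val_inj.
by rewrite {1}wE add_row_mx mul1r; congr row_mx; rewrite raddfD.
Qed.

Lemma volume_translate n (A : set 'rV[R]_n) w : borel A ->
  volume [set y | A (y + w)] = volume A.
Proof.
elim: n A w => [|m IH] A w bA.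
  congr volume; apply/seteqP; split => y /=; have -> : y + w = y by apply/rowP => -[].
    by [].
  by [].
rewrite !volumeS; pose w0 : R := w 0 0.
have sE t : slice [set y | A (y + w)] t =
    [set v | slice A (1 * t + w0) (v + (rsubmx (w : 'rV_(1 + m))))].
  by apply/funext => v; rewrite /slice/=; congr A; exact: row_mx_translate.
rewrite (eq_integral (fun t : mR => volume (slice A ((1 : R) * t + w0)))); last first.
  by move=> t _; rewrite sE IH//; exact: borel_slice.
rewrite (ge0_integral_affine w0 (oner_neq0 R) (measurable_volume_slice bA)).
  by rewrite normr1 invr1 mul1e.
by move=> t; apply: volume_ge0; exact: borel_slice.
Qed.

Definition linvol n (M : 'M[R]_n) : Prop := forall A : set 'rV[R]_n, borel A ->
  volume [set y | A (y *m M)] = ((`|\det M|^-1)%:E * volume A)%E.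

Lemma borel_mul n p (M : 'M[R]_(n, p)) (A : set 'rV[R]_p) : borel A ->
  borel [set y | A (y *m M)].
Proof.
move=> bA; have := borel_affine M 0 bA.
by rewrite (_ : [set y | _] = [set y | A (y *m M)])//; apply/funext => y /=; rewrite addr0.
Qed.

(** Cancellation rather than composition: row reduction multiplies the given matrix on the left by
    known ones until the product is known, and these factors then have to be removed. *)
Lemma linvol_cancel n (P Q : 'M[R]_n) : P \in unitmx -> Q \in unitmx ->
  linvol P -> linvol (P *m Q) -> linvol Q.
Proof.
move=> uP uQ lP lPQ A bA.
have := lPQ A bA; have := lP _ (borel_mul Q bA).
rewrite (_ : [set y | _ ] = [set y | A (y *m (P *m Q))]) => [->|]; last first.
  by apply/funext => y /=; rewrite mulmxA.
have dP : `|\det P| != 0 by rewrite normr_eq0 -unitfE -unitmxE.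
have dQ : `|\det Q| != 0 by rewrite normr_eq0 -unitfE -unitmxE.
move=> /(congr1 (fun z => `|\det P|%:E * z)%E).
rewrite !muleA -!EFinM mulfV// mul1e => ->; congr (_%:E * _)%E.
by rewrite det_mulmx normrM invfM mulVKf.
Qed.

(** On the slice with first coordinate [t] the map is [T] followed by translation by [t r], so only
    [det T] matters there; integrating over [t] contributes the factor from [d]. *)
Lemma linvol_block m (d : R) (r : 'rV[R]_m) (T : 'M[R]_m) : d != 0 ->
  T \in unitmx -> linvol T ->
  linvol (block_mx (d%:M : 'M[R]_1) r 0 T : 'M[R]_(1 + m)).
Proof.
move=> d0 uT lT A bA; rewrite !volumeS.
have sE t : slice [set y | A (y *m (block_mx (d%:M : 'M[R]_1) r 0 T : 'M[R]_(1 + m)))] t =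
    [set v | [set z | slice A (d * t + 0) (z + t *: r)] (v *m T)].
  apply/seteqP; split => v; rewrite /slice/= mul_row_block.
    by rewrite -scalar_mxM mulmx0 addr0 mul_scalar_mx [_ *: r + _]addrC addr0 mulrC.
  by rewrite -scalar_mxM mulmx0 addr0 mul_scalar_mx [_ *: r + _]addrC addr0 mulrC.
have mv := measurable_volume_slice bA.
have v0 t : (0 <= volume (slice A t))%E by apply: volume_ge0; exact: borel_slice.
have tr t : volume [set z | slice A (d * t + 0) (z + t *: r)] = volume (slice A (d * t + 0)).
  by apply: volume_translate; exact: borel_slice.
rewrite (eq_integral (fun t : mR => (`|\det T|^-1)%:E * volume (slice A (d * t + 0)%R))%E); last first.
  move=> t _; rewrite sE lT ?tr//.
  have := borel_affine 1%:M (t *: r) (borel_slice (d * t + 0) bA).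
  by rewrite (_ : [set y | _] = [set z | slice A (d * t + 0) (z + t *: r)])//;
    apply/funext => y /=; rewrite mulmx1.
rewrite ge0_integralZl//=; last first.
  have mpsi : measurable_fun setT ((fun t => d * t + 0) : mR -> mR).
    by apply: measurable_funD => //; exact: measurable_funM.
  exact: (measurableT_comp mv mpsi).
rewrite (ge0_integral_affine 0 d0 mv v0) muleA -EFinM; congr (_%:E * _)%E.
by rewrite det_ublock det_scalar1 normrM invfM mulrC.
Qed.

Lemma slice_swap m (A : set 'rV[R]_m.+2) t u :
  slice (slice [set y | A (y *m tperm_mx 0 1)] t) u = slice (slice A u) t.
Proof.
apply/funext => v; rewrite /slice/=; congr A.
rewrite -xcolE; apply/rowP => i; rewrite mxE.
pose a : 'rV[R]_(1 + (1 + m)) := row_mx (t%:M : 'rV_1) (row_mx (u%:M : 'rV_1) v).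
pose b : 'rV[R]_(1 + (1 + m)) := row_mx (u%:M : 'rV_1) (row_mx (t%:M : 'rV_1) v).
have i0 (c : 'rV[R]_(1 + (1 + m))) : c 0 (0 : 'I_m.+2) = c 0 (lshift _ 0).
  by congr (c 0 _); exact: val_inj.
have i1 (c : 'rV[R]_(1 + (1 + m))) : c 0 (1 : 'I_m.+2) = c 0 (rshift 1 (lshift m 0)).
  by congr (c 0 _); exact: val_inj.
rewrite -/a -/b; case: tpermP => [->|->|].
- by rewrite i1 i0 /a /b row_mxEr !row_mxEl.
- by rewrite i1 i0 /a /b row_mxEr !row_mxEl.
move: i; change (forall i : 'I_(1 + (1 + m)), i <> 0 -> i <> 1 -> a 0 i = b 0 i).
move=> i; case: (split_ordP i) => j ->.
  by move=> H; case: H; rewrite (ord1 j); exact: val_inj.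
case: (split_ordP j) => j' ->.
  by move=> _ H; case: H; rewrite (ord1 j'); exact: val_inj.
by move=> _ _; rewrite /a /b !row_mxEr.
Qed.

(** Exchanging the first two coordinates exchanges the two outer integrals, which is Tonelli. *)
Lemma linvol_swap m : linvol (tperm_mx 0 1 : 'M[R]_m.+2).
Proof.
move=> A bA; rewrite det_perm.
have -> : `|(-1) ^+ (perm.odd_perm (tperm (0 : 'I_m.+2) 1))|^-1 = 1 :> R.
  by rewrite normrX normrN1 expr1n invr1.
rewrite mul1e !volumeS.
under eq_integral do rewrite volumeS.
under [RHS]eq_integral do rewrite volumeS.
under eq_integral => t _ do under eq_integral => u _ do rewrite slice_swap.
have [nu nuE] := @borel_measure R m.
pose C : set ((mR * mR) * m.-tuple mR) := [set x | A (row_of_tuple (consm (x.1.1, consm (x.1.2, x.2))))].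
have mC : measurable C.
  rewrite (_ : C = (fun x => consm (x.1.1, consm (x.1.2, x.2))) @^-1` (@row_of_tuple R m.+2 @^-1` A))//.
  rewrite -[X in measurable X]setTI; apply: (_ : measurable_fun setT _) => //.
  apply: (measurableT_comp (@measurable_consm R m.+1)).
  apply: measurable_fun_pair => /=; first exact: measurableT_comp.
  apply: (measurableT_comp (@measurable_consm R m)).
  apply: measurable_fun_pair => //=; exact: measurableT_comp.
pose f (x : mR * mR) := volume (slice (slice A x.1) x.2).
have fE : f = nu \o xsection C.
  apply/funext => -[t u]; rewrite /f/= nuE; last by do 2!apply: borel_slice.
  congr (nu _); apply/funext => w; rewrite /xsection /preimage /mkset inE /C/=.
  by rewrite row_of_tuple_cons row_of_tuple_cons.
have mf : measurable_fun setT f by rewrite fE; exact: measurable_fun_xsection.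
have f0 x : (0 <= f x)%E by apply: volume_ge0; do 2!apply: borel_slice.
have H := @fubini_tonelli _ _ _ _ _ mu mu f mf f0.
exact: (esym H).
Qed.

(** Induction on the dimension. If the first column of [M] is zero below the corner, [linvol_block]
    applies. Otherwise a block triangular [N] and one swap of rows bring [M] to that form. *)
Lemma linvol_unit n (M : 'M[R]_n) : M \in unitmx -> linvol M.
Proof.
elim: n M => [|n IH] M uM.
  move=> A bA; rewrite det_mx00 normr1 invr1 mul1e; congr volume.
  by apply/funext => y /=; congr A; apply/rowP => -[].
have ublock (X : 'M[R]_(1 + n)) : X \in unitmx -> dlsubmx X = 0 -> linvol X.
  move=> uX X0; have XE : X = block_mx (ulsubmx X 0 0)%:M (ursubmx X) 0 (drsubmx X).
    by rewrite -[LHS]submxK X0 {1}[ulsubmx X]mx11_scalar.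
  move: uX; rewrite XE; move: (ulsubmx X 0 0) (ursubmx X) (drsubmx X) => d r T.
  rewrite unitmxE det_ublock det_scalar1 unitfE mulf_eq0 negb_or => /andP[d0 dT].
  have uT : T \in unitmx by rewrite unitmxE unitfE.
  by apply: linvol_block => //; exact: IH.
pose c := dlsubmx (M : 'M[R]_(1 + n)); pose c0 := ulsubmx (M : 'M[R]_(1 + n)) 0 0.
have [cz|cN] := eqVneq c 0; first exact: ublock.
case: n => [|n] in IH M uM ublock c c0 cN *.
  by move/eqP: cN; case; apply/matrixP => -[].
have [j cj] : exists j, c j 0 != 0.
  apply/existsP; apply: contraT; rewrite negb_exists => /forallP H.
  by move/eqP: cN; case; apply/matrixP => i k; rewrite (ord1 k) [RHS]mxE; apply/eqP/negPn/H.
(* Chosen so that adding [r *m c] cancels the corner entry [c0]. *)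
pose r : 'rV[R]_n.+1 := (- (c0 / c j 0)) *: delta_mx 0 j.
have rc : (r *m c) 0 0 = - c0.
  by rewrite /r -scalemxAl mxE -rowE [row _ _ _ _]mxE mulNr divfK.
(* The column [c] has rank one, so this change of basis moves it to a multiple of the first basis
   vector. The first column of [N *m M] is then supported in row [1], and swapping rows [0] and [1]
   puts that entry in the corner. *)
pose T := invmx (col_ebase c).
have uT : T \in unitmx by rewrite unitmx_inv col_ebase_unit.
have rk1 : \rank c = 1%N.
  apply/eqP; rewrite eqn_leq rank_leq_col lt0n mxrank_eq0; exact: cN.
have Tc i : i != 0 -> (T *m c) i 0 = 0.
  move=> i0; rewrite -{1}(mulmx_ebase c) /T -!mulmxA mulKmx ?col_ebase_unit//.
  rewrite mxE big1// => k _; rewrite mxE rk1 (ord1 k).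
  by case: i i0 => -[//|i] Hi _; rewrite /= mul0r.
pose N : 'M[R]_(1 + n.+1) := block_mx 1%:M r 0 T.
have uN : N \in unitmx by rewrite unitmxE det_ublock det1 mul1r -unitmxE.
have lN : linvol N by apply: linvol_block => //; exact: IH.
have NME : (N *m (M : 'M[R]_(1 + n.+1)) : 'M[R]_(1 + n.+1)) =
    block_mx (ulsubmx (M : 'M[R]_(1 + n.+1)) + r *m c)
      (ursubmx (M : 'M[R]_(1 + n.+1)) + r *m drsubmx (M : 'M[R]_(1 + n.+1)))
      (T *m c) (T *m drsubmx (M : 'M[R]_(1 + n.+1))).
  rewrite -[in LHS](submxK (M : 'M[R]_(1 + n.+1))) mulmx_block.
  by rewrite !mul1mx !mul0mx !add0r.
pose S : 'M[R]_n.+2 := tperm_mx 0 1.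
have uS : S \in unitmx by exact: unitmx_perm.
have NM : (N : 'M[R]_n.+2) *m M \in unitmx by rewrite unitmx_mul uM andbT.
have lSNM : linvol (S *m (N *m M)).
  apply: ublock; first by rewrite unitmx_mul uS.
  rewrite -xrowE NME.
  apply/matrixP => i k; rewrite (ord1 k) [RHS]mxE 3!mxE.
  have [->|i0] := eqVneq i 0.
    rewrite (_ : rshift 1 0 = 1 :> 'I_n.+2); last exact: val_inj.
    rewrite tpermR (_ : 0 = lshift n.+1 (0 : 'I_1) :> 'I_(1 + n.+1)); last exact: val_inj.
    apply: etrans (block_mxEul _ _ _ _ _ _) _.
    by rewrite mxE rc subrr.
  rewrite tpermD; last 2 first.
  - by apply/eqP => /(congr1 val).
  - by apply: contra i0 => /eqP /(congr1 val) /= [] i0; apply/eqP/val_inj.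
  apply: etrans (block_mxEdl _ _ _ _ _ _) _.
  exact: Tc.
apply: (linvol_cancel uN uM lN).
exact: (linvol_cancel uS NM (@linvol_swap n) lSNM).
Qed.

End LinearChange.

(** * Linear isometries between pairs of an inner product and a covector *)

Section Isometry.
Context {R : realType}.

(** Completing the square in the first coordinate leaves the Schur complement [S], which is positive
    definite: its value at [v] is that of the form at [(- lin r v / al, v)]. *)
Lemma cholesky n (A : 'M[R]_n) : posdef A ->
  exists2 L : 'M[R]_n, L \in unitmx & A = L *m L^T.
Proof.
elim: n A => [|n IH] A Apos.
  by exists 1%:M; [exact: unitmx1|apply/matrixP => -[]].
pose B := A : 'M[R]_(1 + n).
pose al : R := ulsubmx B 0 0; pose r := ursubmx B; pose A' := drsubmx B.
have At : B^T = B := proj1 Apos.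
have dl : dlsubmx B = r^T by rewrite /r trmx_ursub At.
have A't : A'^T = A' by rewrite /A' trmx_drsub At.
have BE : B = block_mx (al%:M : 'M[R]_1) r r^T A'.
  by rewrite -[LHS]submxK dl {1}[ulsubmx B]mx11_scalar.
have rE (v : 'rV[R]_n) : v *m r^T = (lin r v)%:M.
  by rewrite [LHS]mx11_scalar linC.
have rE' (v : 'rV[R]_n) : r *m v^T = (lin r v)%:M by rewrite [LHS]mx11_scalar.
have bilB (c : R) (v : 'rV[R]_n) :
    bil B (row_mx (c%:M : 'M[R]_1) v) (row_mx (c%:M : 'M[R]_1) v) =
    c ^+ 2 * al + 2 * c * lin r v + bil A' v v.
  rewrite /bil {1}BE mul_row_block tr_row_mx mul_row_col !mulmxDl.
  rewrite tr_scalar_mx !mul_scalar_mx -!scalemxAl !mul_mx_scalar.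
  by rewrite rE rE' !mxE eqxx !mulr1n; ring.
have al0 : 0 < al.
  have := proj2 Apos (row_mx (1%:M : 'M[R]_1) 0 : 'rV[R]_(1 + n)).
  rewrite -[bil A]/(bil B) bilB expr1n mul1r /bil !mul0mx /lin trmx0 mulmx0 !mxE.
  rewrite !mulr0 !addr0; apply; apply/eqP => /(congr1 (@lsubmx _ 1 1 n)).
  by rewrite row_mxKl linear0 => /matrixP /(_ 0 0) /eqP; rewrite !mxE eqxx oner_eq0.
have alN0 : al != 0 by rewrite gt_eqF.
pose S := A' - al^-1 *: (r^T *m r).
have bilS v : bil S v v = bil A' v v - (lin r v) ^+ 2 / al.
  rewrite /bil /S mulmxBr mulmxBl -scalemxAr -scalemxAl mulmxA.
  rewrite -[v *m r^T *m r *m v^T]mulmxA rE rE' -scalar_mxM scale_scalar_mx.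
  by move: (v *m A' *m v^T) => M1; rewrite !mxE eqxx mulr1n; ring.
have Spos : posdef S.
  split.
    by rewrite /S linearB/= A't linearZ/= trmx_mul trmxK.
  move=> v v0; have := proj2 Apos (row_mx ((- (lin r v / al))%:M : 'M[R]_1) v : 'rV[R]_(1 + n)).
  rewrite -[bil A]/(bil B) bilB bilS.
  rewrite (_ : _ + bil A' v v = bil A' v v - lin r v ^+ 2 / al); last by field.
  apply; apply: contra_neq v0 => /(congr1 (@rsubmx _ 1 1 n)).
  by rewrite row_mxKr linear0.
have [L' uL' SE] := IH S Spos.
pose sq := Num.sqrt al; have sq0 : sq != 0 by rewrite gt_eqF// sqrtr_gt0.
have sq2 : sq * sq = al by rewrite -expr2 sqr_sqrtr// ltW.
pose L : 'M[R]_(1 + n) := block_mx (sq%:M : 'M[R]_1) 0 (sq^-1 *: r^T) L'.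
have uL : L \in unitmx.
  by rewrite unitmxE det_lblock det_scalar1 unitrM unitfE sq0 -unitmxE.
suff BL : B = L *m L^T by exists L.
rewrite [LHS]BE /L tr_block_mx mulmx_block tr_scalar_mx !trmx0 !mul0mx !mulmx0 !addr0.
rewrite -scalar_mxM sq2 linearZ/= trmxK mul_scalar_mx scalerA divff// scale1r.
rewrite mul_mx_scalar scalerA divff// scale1r -SE /S -scalemxAl -scalemxAr scalerA.
by rewrite -invfM sq2 addrC subrK.
Qed.

Lemma posdef1 n : posdef (1%:M : 'M[R]_n).
Proof.
split=> [|y y0]; first exact: trmx1.
rewrite bil_lin mulmx1 linE; under eq_bigr do rewrite -expr2.
rewrite lt_neqAle sumr_ge0 ?andbT; last by move=> i _; exact: sqr_ge0.
rewrite eq_sym psumr_neq0; last by move=> i _; exact: sqr_ge0.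
have [i yi] : exists i, y 0 i != 0.
  apply/existsP; apply: contraT; rewrite negb_exists => /forallP H.
  by move/eqP: y0; case; apply/rowP => i; rewrite mxE; apply/eqP/negPn/H.
apply/hasP; exists i; first exact: mem_index_enum.
by rewrite lt_neqAle sqr_ge0 eq_sym expf_neq0.
Qed.

(** The Householder reflection along [u = c - c']. Equal lengths give [<c, u> = |u|^2 / 2], so [c]
    is moved by exactly [u]. *)
Lemma exists_reflection n (c c' : 'rV[R]_n) : lin c c = lin c' c' ->
  exists H : 'M[R]_n, H *m H^T = 1%:M /\ c *m H^T = c'.
Proof.
move=> cc; have [->|ncc] := eqVneq c c'.
  by exists 1%:M; rewrite trmx1 !mulmx1.
have [u uE] : exists u, u = c - c' by exists (c - c').
have u0 : u != 0 by rewrite uE subr_eq0.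
pose w := lin u u.
have w0 : w != 0.
  by rewrite gt_eqF// /w -[lin u u]/((u *m u^T) 0 0) -[u in u *m _]mulmx1; exact: (proj2 (posdef1 n)).
pose H := 1%:M - (2 / w) *: (u^T *m u).
have Ht : H^T = H by rewrite /H linearB/= trmx1 linearZ/= trmx_mul trmxK.
have uu : u *m u^T = w%:M by rewrite [LHS]mx11_scalar.
have cu : c *m u^T = (w / 2)%:M.
  rewrite [LHS]mx11_scalar; congr (_%:M); rewrite -/(lin c u) /w uE.
  rewrite -scaleN1r !linDl !linDr !linZl !linZr cc (linC c' c); by field.
exists H; rewrite Ht; split.
  pose X := (2 / w) *: (u^T *m u).
  have XX : X *m X = X + X.
    rewrite /X -scalemxAl -scalemxAr mulmxA -[u^T *m u *m u^T]mulmxA uu mul_mx_scalar.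
    by rewrite -scalemxAl !scalerA -scalerDl; congr (_ *: _); field.
  rewrite /H -/X mulmxBl mul1mx mulmxBr mulmx1 XX.
  have -> : X - (X + X) = - X by rewrite opprD addrA subrr sub0r.
  by rewrite opprK subrK.
rewrite /H mulmxBr mulmx1 -scalemxAr mulmxA cu mul_scalar_mx scalerA.
have -> : 2 / w * (w / 2) = 1 by field.
by rewrite scale1r uE opprB addrC subrK.
Qed.

(** The length of the covector is the only invariant of the pair: Cholesky factors make both inner
    products standard, and a reflection then matches the covectors. *)
Lemma posdef_isometry n (A A' : 'M[R]_n) (b b' : 'rV[R]_n) : posdef A -> posdef A' ->
  bil (invmx A) b b = bil (invmx A') b' b' ->
  exists T : 'M[R]_n, [/\ T \in unitmx, A' = T *m A *m T^T & b' = b *m T^T].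
Proof.
move=> Apos A'pos bb.
have [L uL AE] := cholesky Apos; have [L' uL' A'E] := cholesky A'pos.
have nrm (X K : 'M[R]_n) (d : 'rV[R]_n) : K \in unitmx -> X = K *m K^T ->
    bil (invmx X) d d = lin (d *m invmx K^T) (d *m invmx K^T).
  move=> uK XE; have uKt : K^T \in unitmx by rewrite unitmx_tr.
  have uX : X \in unitmx by rewrite XE unitmx_mul uK.
  have -> : invmx X = invmx K^T *m invmx K.
    have XK : X *m (invmx K^T *m invmx K) = 1%:M.
      by rewrite XE !mulmxA mulmxK// mulmxV.
    by rewrite -[RHS](mulKmx uX) XK mulmx1.
  by rewrite /bil /lin trmx_mul trmx_inv trmxK !mulmxA.
rewrite (nrm _ _ _ uL AE) (nrm _ _ _ uL' A'E) in bb.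
have [H [HH cH]] := exists_reflection bb.
have uH : H \in unitmx by have [] := mulmx1_unit HH.
have uLt : L^T \in unitmx by rewrite unitmx_tr.
have uLt' : L'^T \in unitmx by rewrite unitmx_tr.
exists (L' *m H *m invmx L); split.
- by rewrite !unitmx_mul uL' uH unitmx_inv.
- rewrite AE !trmx_mul trmx_inv !mulmxA mulmxKV// mulmxK//.
  by rewrite -[L' *m H *m H^T]mulmxA HH mulmx1.
- by rewrite !trmx_mul trmx_inv !mulmxA cH mulmxKV.
Qed.

End Isometry.

(** * The derivative of a determinant *)

Section Jacobi.
Context {R : realType} {n p : nat}.
Local Notation E := 'rV[R]_p.

Lemma diff_pd_prod (f : 'I_n -> E -> R) x : (forall m, differentiable (f m) x) ->
  differentiable (fun z => \prod_m f m z) x /\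
  forall i, pd i (fun z => \prod_m f m z) x =
    \sum_m pd i (f m) x * \prod_(m' | m' != m) f m' x.
Proof.
move=> df.
have main (r : seq 'I_n) : uniq r -> differentiable (fun z => \prod_(m <- r) f m z) x /\
  forall i, pd i (fun z => \prod_(m <- r) f m z) x =
    \sum_(m <- r) pd i (f m) x * \prod_(m' <- r | m' != m) f m' x.
  elim: r => [|m r IH] /=.
    have -> : (fun z => \prod_(m <- [::]) f m z) = (fun=> 1 : R).
      by apply/funext => z; rewrite big_nil.
    by move=> _; split=> [|i]; [exact: differentiable_cst|rewrite pd_cst big_nil].
  move=> /andP[mr ur]; have {IH ur} [IHd IH] := IH ur.
  have -> : (fun z => \prod_(k <- m :: r) f k z) =
      (fun z => f m z * \prod_(k <- r) f k z).
    by apply/funext => z; rewrite big_cons.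
  split=> [|i]; first exact: differentiableM.
  rewrite (pdM i (df m) IHd) IH big_cons addrC; congr (_ + _).
    rewrite mulrC; congr (_ * _); rewrite big_cons eqxx /=.
    rewrite [RHS]big_seq_cond [LHS]big_seq; apply: eq_bigl => k.
    by case: (boolP (k \in r)) => //= kr; apply/esym/negP => /eqP km; rewrite -km kr in mr.
  rewrite mulr_sumr big_seq [RHS]big_seq; apply: eq_bigr => k kr.
  rewrite big_cons ifT; last by apply/eqP => mk; rewrite mk kr in mr.
  by rewrite mulrCA.
exact: main (index_enum_uniq _).
Qed.

Lemma pd_det (a : E -> 'M[R]_n) x (i : 'I_p) :
  (forall k l, differentiable (fun z => a z k l) x) ->
  differentiable (fun z => \det (a z)) x /\
  pd i (fun z => \det (a z)) x =
    \tr ((\matrix_(k, l) pd i (fun z => a z k l) x) *m \adj (a x)).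
Proof.
move=> da; set D := \matrix_(k, l) _.
have DE k l : pd i (fun z => a z k l) x = D k l by rewrite mxE.
clearbody D.
have dp (s : 'S_n) := diff_pd_prod (fun m => da m (s m)).
have dterm (s : 'S_n) :
    differentiable (fun z => (-1) ^+ s * \prod_m a z m (s m)) x.
  by apply: differentiableM; [exact: differentiable_cst|exact: (proj1 (dp s))].
have [ds pds] := diff_pd_sum (index_enum ('S_n : finType)) dterm.
split; first exact: ds.
transitivity (\sum_(s : 'S_n) \sum_m (-1) ^+ s * (D m (s m) * \prod_(k | k != m) a x k (s k))).
  rewrite [LHS]pds; apply: eq_bigr => s _.
  rewrite (pdZ i _ (proj1 (dp s))) (proj2 (dp s) i) mulr_sumr.
  by apply: eq_bigr => m _; rewrite DE.
rewrite exchange_big/= /mxtrace; apply: eq_bigr => m _.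
(* The part of the Leibniz sum that differentiates row [m] is the determinant with that row replaced
   by its derivative; expanding along the row produces the cofactors of [a x]. *)
pose Am : 'M[R]_n := \matrix_(k, l) if k == m then D k l else a x k l.
transitivity (\det Am).
  apply: eq_bigr => s _; congr (_ * _); rewrite [RHS](bigD1 m)//= mxE eqxx.
  by congr (_ * _); apply: eq_bigr => k km; rewrite mxE (negbTE km).
rewrite (expand_det_row _ m) mxE; apply: eq_bigr => l _.
rewrite mxE eqxx; congr (_ * _); rewrite mxE /cofactor; congr (_ * \det _).
by apply/matrixP => k' l'; rewrite !mxE eq_sym (negbTE (neq_lift _ _)).
Qed.

End Jacobi.

(** * The Busemann-Hausdorff density *)

Section Indicatrix.
Context {R : realType}.
Local Notation mR := (measurableTypeR R).
Local Notation mu := (@lebesgue_measure R).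

Lemma le_volume n (A B : set 'rV[R]_n) : borel A -> borel B -> A `<=` B ->
  (volume A <= volume B)%E.
Proof.
move=> bA bB AB; have [nu nuE] := @borel_measure R n; rewrite !nuE//.
by apply: le_measure; rewrite ?inE// => t /AB.
Qed.

Lemma borelU n (A B : set 'rV[R]_n) : borel A -> borel B -> borel (A `|` B).
Proof. by move=> bA bB; rewrite /borel preimage_setU; exact: measurableU. Qed.

Lemma borelC n (A : set 'rV[R]_n) : borel A -> borel (~` A).
Proof. by move=> bA; rewrite /borel preimage_setC; exact: measurableC. Qed.

Definition mfun_row n (g : 'rV[R]_n -> R) : Prop :=
  measurable_fun setT ((fun t => g (row_of_tuple t)) : n.-tuple mR -> mR).

Lemma borel_lt n (g : 'rV[R]_n -> R) (r : R) : mfun_row g -> borel [set y | g y < r].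
Proof.
move=> mg; rewrite /borel.
rewrite (_ : _ @^-1` _ = (fun t => g (row_of_tuple t)) @^-1` `]-oo, r[%classic).
  by rewrite -[X in measurable X]setTI; apply: mg => //; exact: measurable_itv.
by apply/seteqP; split => t /=; rewrite in_itv.
Qed.

Lemma mfun_coord n (i : 'I_n) : mfun_row (fun y : 'rV[R]_n => y 0 i).
Proof.
rewrite /mfun_row (_ : (fun t => _) = (fun t : n.-tuple mR => tnth t i)).
  exact: measurable_tnth.
by apply/funext => t; rewrite mxE.
Qed.

Lemma mfun_cst n (c : R) : mfun_row (fun _ : 'rV[R]_n => c).
Proof. exact: measurable_cst. Qed.

Lemma mfunD n (f g : 'rV[R]_n -> R) : mfun_row f -> mfun_row g ->
  mfun_row (fun y => f y + g y).
Proof. exact: measurable_funD. Qed.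

Lemma mfunM n (f g : 'rV[R]_n -> R) : mfun_row f -> mfun_row g ->
  mfun_row (fun y => f y * g y).
Proof. exact: measurable_funM. Qed.

Lemma mfun_sum n I (r : seq I) (f : I -> 'rV[R]_n -> R) :
  (forall k, mfun_row (f k)) -> mfun_row (fun y => \sum_(k <- r) f k y).
Proof. by move=> mf; apply: measurable_sum => k; exact: mf. Qed.

Lemma mfun_comp n (h : R -> R) (f : 'rV[R]_n -> R) : continuous h -> mfun_row f ->
  mfun_row (fun y => h (f y)).
Proof.
move=> ch mf; apply: (measurableT_comp (f := h)) => //.
exact: continuous_measurable_fun.
Qed.

Lemma mfun_bil n (A : 'M[R]_n) : mfun_row (fun y => bil A y y).
Proof.
rewrite (_ : (fun y => _) = (fun y : 'rV_n => \sum_k \sum_l A k l * y 0 k * y 0 l)).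
  apply: mfun_sum => k; apply: mfun_sum => l.
  apply: mfunM; last exact: mfun_coord.
  by apply: mfunM; [exact: mfun_cst|exact: mfun_coord].
by apply/funext => y; rewrite bilE.
Qed.

Lemma mfun_lin n (b : 'rV[R]_n) : mfun_row (lin b).
Proof.
rewrite (_ : lin b = (fun y : 'rV_n => \sum_k b 0 k * y 0 k)).
  by apply: mfun_sum => k; apply: mfunM; [exact: mfun_cst|exact: mfun_coord].
by apply/funext => y; rewrite linE.
Qed.

Definition cube n (r : R) : set 'rV[R]_n := [set y | forall i, `|y 0 i| < r].

Lemma borel_cube n (r : R) : borel (@cube n r).
Proof.
rewrite /borel (_ : _ @^-1` _ =
    \bigcap_(i in [set: 'I_n]) (@row_of_tuple R n @^-1` [set y | `|y 0 i| < r])).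
  apply: fin_bigcap_measurable => [|i _]; first exact: finite_finset.
  by apply: borel_lt; apply: mfun_comp; [exact: norm_continuous|exact: mfun_coord].
by apply/seteqP; split => t /= H i; [move=> _|]; exact: H.
Qed.

Lemma volume_set0 n : volume (set0 : set 'rV[R]_n) = 0%E.
Proof.
by have [nu nuE] := @borel_measure R n; rewrite nuE ?/borel preimage_set0 ?measure0.
Qed.

Lemma volume_cube n (r : R) : 0 < r -> volume (@cube n r) = ((r *+ 2) ^+ n)%:E.
Proof.
move=> r0; elim: n => [|m IH].
  by rewrite /= indicE mem_set ?expr0// => -[].
rewrite volumeS.
have sE t : volume (slice (@cube m.+1 r) t) =
    (((r *+ 2) ^+ m)%:E * (\1_(`]-r, r[%classic : set mR) t)%:E)%E.
  have [tr|tr] := boolP (t \in (`]-r, r[%classic : set R)).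
    rewrite indicE tr mule1 -IH; congr volume; apply/seteqP; split => v /= H i.
      by rewrite -(row_mxEr (t%:M : 'rV_1) v 0 i); exact: (H (rshift 1 i)).
    move: i; change (forall i : 'I_(1 + m), `|(row_mx (t%:M : 'rV_1) v) 0 i| < r).
    move=> i; case: (split_ordP i) => j ->; last by rewrite row_mxEr.
    rewrite row_mxEl (ord1 j) mxE eqxx mulr1n ltr_norml.
    by move: tr; rewrite inE/= in_itv.
  rewrite indicE (negbTE tr) mule0 -(volume_set0 m); congr volume.
  apply/seteqP; split => v //= H; move/negP: tr; apply; rewrite inE/= in_itv/=.
  have : `|(row_mx (t%:M : 'rV_1) v) 0 (lshift m 0)| < r by exact: (H (lshift m (0 : 'I_1))).
  by rewrite row_mxEl mxE eqxx mulr1n ltr_norml.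
under eq_integral do rewrite sE.
rewrite ge0_integralZl//=; last 2 first.
- by apply/measurable_EFinP; exact: measurable_indic.
- by rewrite lee_fin exprn_ge0// mulrn_wge0// ltW.
rewrite integral_indic//= setIT lebesgue_measure_itv/= lte_fin ifT; last first.
  by rewrite (lt_trans _ r0)// oppr_lt0.
by rewrite -EFinB -EFinM exprSr opprK mulr2n.
Qed.

Variables (n : nat) (eps k : R).

Definition Fq (A : 'M[R]_n) (b y : 'rV[R]_n) : R :=
  Num.sqrt (bil A y y) + eps * lin b y + k * (lin b y ^+ 2 / Num.sqrt (bil A y y)).

Definition indicatrix (A : 'M[R]_n) (b : 'rV[R]_n) : set 'rV[R]_n :=
  [set y | Fq A b y < 1].

Lemma Fq_phi A b y : posdef A -> slit y ->
  Fq A b y = Num.sqrt (bil A y y) * quadratic_phi eps k (lin b y / Num.sqrt (bil A y y)).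
Proof.
move=> Apos Vy; have al0 : Num.sqrt (bil A y y) != 0.
  by rewrite gt_eqF// sqrtr_gt0; exact: (proj2 Apos).
by rewrite /Fq /quadratic_phi; field.
Qed.

Lemma Fq0 A b : Fq A b 0 = 0.
Proof.
rewrite /Fq /bil !mul0mx mxE sqrtr0 /lin trmx0 mulmx0 mxE.
by rewrite expr0n/= mul0r !mulr0 !addr0.
Qed.

Lemma borel_indicatrix A b : posdef A -> borel (indicatrix A b).
Proof.
move=> Apos; pose al y := Num.sqrt (bil A y y).
have mal : mfun_row al.
  by apply: mfun_comp; [exact: sqrt_continuous|exact: mfun_bil].
have mb := mfun_lin b.
(* [al (F - 1)], which is free of quotients and has the sign of [F - 1] off the origin. At the
   origin [g] is [0], so that point is put back as the set where [al <= 0]. *)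
pose g y := al y * al y + eps * (lin b y * al y) + k * (lin b y * lin b y) + (-1) * al y.
have mg : mfun_row g.
  have mc c := @mfun_cst n c.
  exact: mfunD (mfunD (mfunD (mfunM mal mal) (mfunM (mc _) (mfunM mb mal)))
    (mfunM (mc _) (mfunM mb mb))) (mfunM (mc _) mal).
rewrite (_ : indicatrix A b = [set y | g y < 0] `|` ~` [set y | - 1 * al y < 0]).
  apply: borelU; first exact: borel_lt.
  by apply: borelC; apply: borel_lt; exact: (mfunM (@mfun_cst n (-1)) mal).
apply/funext => y; apply/propext; rewrite /indicatrix/=.
have [->|Vy] := eqVneq y 0.
  have al00 : al 0 = 0 by rewrite /al /bil !mul0mx mxE sqrtr0.
  by rewrite Fq0 ltr01; split => // _; right; rewrite al00 mulr0 ltxx.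
have al0 : 0 < al y by rewrite sqrtr_gt0; exact: (proj2 Apos).
have -> : (g y < 0) = (Fq A b y < 1).
  rewrite -[in RHS](ltr_pM2l al0) mulr1 -subr_lt0 [RHS](_ : _ = (g y < 0))//.
  by congr (_ < 0); rewrite /g /Fq -/(al y); have := al0; move: (al y) (lin b y) => p q p0;
    field; rewrite gt_eqF.
split=> [|[//|]]; first by left.
by rewrite mulN1r oppr_lt0 al0.
Qed.

(** On the compact range of [s], [phi] lies between positive constants [c1] and [c2]. Hence [F] is
    comparable to [alpha], and the indicatrix is caught between two cubes. *)
Lemma volume_indicatrix A b b0 : posdef A -> regular_phi (quadratic_phi eps k) b0 ->
  Num.sqrt (bil (invmx A) b b) < b0 ->
  exists2 v : R, 0 < v & volume (indicatrix A b) = v%:E.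
Proof.
move=> Apos rphi bb0; pose al y := Num.sqrt (bil A y y).
set B := Num.sqrt _ in bb0; have B0 : - B <= B by rewrite ge0_cp// sqrtr_ge0.
have cphi : {within `[- B, B], continuous (quadratic_phi eps k)}.
  apply: continuous_subspaceT => s; apply: differentiable_continuous.
  exact/derivable1_diffP.
have [s1 s1B min1] := EVT_min B0 cphi; have [s2 s2B max2] := EVT_max B0 cphi.
set c1 := quadratic_phi eps k s1 in min1; set c2 := quadratic_phi eps k s2 in max2.
have c1_gt0 : 0 < c1.
  have [_ _ + _] := rphi; apply; apply: le_lt_trans bb0; rewrite ler_norml.
  by move: s1B; rewrite in_itv.
have al0 y : slit y -> 0 < al y by move=> Vy; rewrite sqrtr_gt0; exact: (proj2 Apos).
have sB y : slit y -> lin b y / al y \in `[- B, B].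
  move=> Vy; rewrite in_itv/= -ler_norml; exact: (s_bound b Apos Vy).
have lowF y : slit y -> c1 * al y <= Fq A b y.
  by move=> Vy; rewrite Fq_phi// mulrC ler_pM2l ?al0// min1// sB.
have upF y : slit y -> Fq A b y <= c2 * al y.
  by move=> Vy; rewrite Fq_phi// [leRHS]mulrC ler_pM2l ?al0// max2// sB.
have c2_gt0 : 0 < c2.
  by apply: lt_le_trans c1_gt0 _; exact: min1.
have bI := borel_indicatrix b Apos.
have [r r0 rI] : exists2 r : R, 0 < r & @cube n r `<=` indicatrix A b.
  pose K := \sum_i \sum_j `|A i j|.
  have K0 : 0 <= K by apply: sumr_ge0 => i _; exact: sumr_ge0.
  pose r := (Num.sqrt K * c2 + 1)^-1.
  have d0 : 0 < Num.sqrt K * c2 + 1.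
    by rewrite ltr_wpDl// mulr_ge0// ?sqrtr_ge0// ltW.
  have r0 : 0 < r by rewrite invr_gt0.
  exists r => // y yr; rewrite /indicatrix/=.
  have [->|Vy] := eqVneq y 0; first by rewrite Fq0 ltr01.
  apply: le_lt_trans (upF y Vy) _.
  have alr : al y <= Num.sqrt K * r.
    rewrite -[X in _ * X](gtr0_norm r0) -sqrtr_sqr -sqrtrM// /al ler_wsqrtr//.
    rewrite bilE /K mulr_suml; apply: ler_sum => i _; rewrite mulr_suml.
    apply: ler_sum => j _; apply: le_trans (ler_norm _) _; rewrite !normrM -mulrA.
    by rewrite ler_wpM2l// expr2 ler_pM// ltW// yr.
  apply: (@le_lt_trans _ _ (c2 * (Num.sqrt K * r))); first by rewrite ler_pM2l.
  by rewrite mulrA [c2 * _]mulrC ltr_pdivrMr// mul1r ltrDl.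
have [M M0 IM] : exists2 M : R, 0 < M & indicatrix A b `<=` @cube n M.
  (* By Cauchy-Schwarz [|y_i|] is at most the dual norm of the [i]-th coordinate form times [alpha],
     and [alpha <= 1 / c1] on the indicatrix. *)
  pose m i := Num.sqrt (bil (invmx A) (delta_mx 0 i) (delta_mx 0 i)) / c1.
  have m0 i : 0 <= m i by rewrite divr_ge0// ?sqrtr_ge0// ltW.
  exists (1 + \sum_i m i); first by rewrite ltr_pwDl// sumr_ge0.
  move=> y; rewrite /indicatrix/= => Fy i.
  apply: (@le_lt_trans _ _ (m i)); last first.
    rewrite (bigD1 i)//= addrCA ltrDl ltr_pwDl// sumr_ge0//.
  have [->|Vy] := eqVneq y 0; first by rewrite mxE normr0.
  have aly : al y <= c1^-1.
    by rewrite -[leRHS]mul1r ler_pdivlMr// mulrC; exact: le_trans (lowF y Vy) (ltW Fy).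
  have -> : y 0 i = lin (delta_mx 0 i) y.
    rewrite linE (bigD1 i)//= big1 => [|j ji]; rewrite mxE.
      by rewrite !eqxx mul1r addr0.
    by rewrite (negbTE ji) andbF mul0r.
  apply: (@le_trans _ _ (Num.sqrt (bil (invmx A) (delta_mx 0 i) (delta_mx 0 i)) * al y)).
    rewrite -sqrtrM ?sqnorm_ge0// -sqrtr_sqr ler_wsqrtr//; exact: lin_cauchy.
  by rewrite ler_wpM2l// sqrtr_ge0.
have lo : (0 < volume (indicatrix A b))%E.
  apply: (lt_le_trans _ (le_volume (@borel_cube n r) bI rI)).
  by rewrite volume_cube// lte_fin exprn_gt0// pmulrn_lgt0.
have hi : (volume (indicatrix A b) < +oo)%E.
  apply: le_lt_trans (le_volume bI (@borel_cube n M) IM) _.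
  by rewrite volume_cube// ltry.
exists (fine (volume (indicatrix A b))); first by rewrite fine_gt0// lo hi.
by rewrite fineK// fin_numElt (lt_trans _ lo) ?ltNyr//= hi.
Qed.

End Indicatrix.

(** * The logarithmic derivative of the density when [|beta|] is locally constant *)

Section BusemannHausdorff.
Context {R : realType} {n : nat}.
Local Notation E := 'rV[R]_n.
Variables (U : set E) (a : E -> 'M[R]_n) (b : E -> E).
Hypotheses (oU : open U)
  (sa : forall k l, smooth_on U (fun x => a x k l))
  (sb : forall k, smooth_on U (fun x => b x 0 k))
  (apos : forall x, U x -> posdef (a x)).

Let w x := sharp (a x) (b x).
Let N x := bil (invmx (a x)) (b x) (b x).

Lemma sharp_diff x j : U x -> differentiable (fun z => w z 0 j) x.
Proof.
move=> Ux; have da i k : differentiable (fun z => a z i k) x.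
  exact: smooth_on_diff (sa i k) Ux.
have ddet : differentiable (fun z => \det (a z)) x.
  exact: (proj1 (pd_det (Ordinal (leq_ltn_trans (leq0n _) (ltn_ord j))) da)).
have dadj k : differentiable (fun z => (\adj (a z)) k j) x.
  rewrite (_ : (fun z => _) =
      (fun z => (-1) ^+ (j + k) * \det (row' j (col' k (a z))))); last first.
    by apply/funext => z; rewrite mxE.
  apply: differentiableM; first exact: differentiable_cst.
  apply: (proj1 (pd_det j _)) => i m.
  by rewrite (_ : (fun z => _) = (fun z => a z (lift j i) (lift k m)))//;
    apply/funext => z; rewrite !mxE.
have sumb : differentiable (fun z => \sum_k b z 0 k * (\adj (a z)) k j) x.
  apply: (proj1 (diff_pd_sum _ _)) => k.
  by apply: differentiableM => //; exact: smooth_on_diff (sb k) Ux.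
have d0 : \det (a x) != 0 by rewrite -unitfE -unitmxE (posdef_unit (apos Ux)).
apply: (@differentiable_eq_on _ _ U
  (fun z => (\det (a z))^-1 * \sum_k b z 0 k * (\adj (a z)) k j)) => //.
  move=> z Uz; rewrite /w /sharp /invmx (posdef_unit (apos Uz)) -scalemxAr mxE.
  by rewrite mxE.
by apply: differentiableM => //; exact: differentiableV.
Qed.

Lemma sqnorm_lin x : N x = \sum_j b x 0 j * w x 0 j.
Proof. by rewrite /N sqnormE linE. Qed.

Lemma sqnorm_diff x : U x -> differentiable N x.
Proof.
move=> Ux; rewrite (_ : N = (fun x => \sum_j b x 0 j * w x 0 j)); last first.
  by apply/funext => z; exact: sqnorm_lin.
apply: (proj1 (diff_pd_sum _ _)) => k.
by apply: differentiableM; [exact: smooth_on_diff (sb k) Ux|exact: sharp_diff].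
Qed.

(** Differentiating [w a = b] expresses the derivative of the dual vector [w] through those of [a]
    and [b], so no derivative of an inverse matrix is needed. *)
Lemma pd_sqnorm l x : U x ->
  pd l N x = 2 * lin (pd_row_form b l x) (w x) - bil (pd_mx a l x) (w x) (w x).
Proof.
move=> Ux; have db k : differentiable (fun z => b z 0 k) x.
  exact: smooth_on_diff (sb k) Ux.
have dw k : differentiable (fun z => w z 0 k) x by exact: sharp_diff.
have da i k : differentiable (fun z => a z i k) x.
  exact: smooth_on_diff (sa i k) Ux.
pose dwr : E := \row_k pd l (fun z => w z 0 k) x.
have NE : N = (fun x => \sum_j b x 0 j * w x 0 j).
  by apply/funext => z; exact: sqnorm_lin.
have -> : pd l N x = lin (b x) dwr + lin (pd_row_form b l x) (w x).
  rewrite NE (proj2 (diff_pd_sum _ (fun k => differentiableM (db k) (dw k))) l).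
  rewrite !linE -big_split/=; apply: eq_bigr => k _.
  by rewrite (pdM l (db k) (dw k)) !mxE [X in _ + X]mulrC.
have rel : dwr *m a x + w x *m pd_mx a l x = pd_row_form b l x.
  apply/rowP => j; rewrite !mxE -big_split/=.
  rewrite (pd_eq_on (g := fun z => \sum_k w z 0 k * a z k j) l oU Ux); last first.
    move=> z Uz; rewrite -[in LHS](mulmxKV (posdef_unit (apos Uz)) (b z)).
    by rewrite [LHS]mxE.
  rewrite (proj2 (diff_pd_sum _ (fun k => differentiableM (dw k) (da k j))) l).
  apply: eq_bigr => k _; rewrite (pdM l (dw k) (da k j)) !mxE addrC.
  by rewrite [X in _ + X]mulrC.
have -> : lin (b x) dwr = lin (dwr *m a x) (w x).
  by rewrite -(bil_sharp (apos Ux)) (bilC _ _ (proj1 (apos Ux))) bil_lin.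
have -> : dwr *m a x = pd_row_form b l x + (-1) *: (w x *m pd_mx a l x).
  by rewrite -rel scaleN1r addrK.
by rewrite linDl linZl -bil_lin; ring.
Qed.

Lemma sqnorm_line l x : (forall z, U z -> pd l N z = 0) -> U x ->
  \forall t \near (0 : R), U (t *: delta_mx 0 l + x) /\ N (t *: delta_mx 0 l + x) = N x.
Proof.
move=> N0 Ux.
have cl : {for (0 : R), continuous (fun t : R => t *: delta_mx 0 l + x)}.
  apply: (@differentiable_continuous _ R E); apply: differentiableD.
    exact: differentiableZl.
  exact: differentiable_cst.
have : \forall t \near (0 : R), U (t *: delta_mx 0 l + x).
  by apply: cl; rewrite scale0r add0r; exact: (open_nbhs_nbhs (conj oU Ux)).
move=> /nbhs_ballP[r /= r0 rU].
have inU (t : R) : `|t| < r -> U (t *: delta_mx 0 l + x).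
  by move=> tr; apply: rU; rewrite /ball/= sub0r normrN.
apply/nbhs_ballP; exists r => //= t; rewrite /ball/= sub0r normrN => tr.
split; first exact: inU.
apply/eqP; rewrite -subr_eq0.
have H (s : R) : 0 <= s <= 1 -> U (s *: (t *: delta_mx 0 l) + x).
  move=> /andP[s0 s1]; rewrite scalerA; apply: inU; rewrite normrM.
  by rewrite (le_lt_trans _ tr)// ler_piMl// ger0_norm.
rewrite (@line_increment _ _ N x (t *: delta_mx 0 l) 0 0) ?mul0r ?addr0// => s s01.
  exact/sqnorm_diff/H.
rewrite (bigD1 l)//= (N0 _ (H s s01)) mulr0 big1 ?mulr0 ?addr0// => i il.
by rewrite !mxE (negbTE il) andbF mulr0 mul0r.
Qed.

Variables (eps k b0 : R) (F : E -> E -> R).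
Hypotheses (rphi : regular_phi (quadratic_phi eps k) b0)
  (bnorm : forall x, U x -> Num.sqrt (N x) < b0)
  (FE : forall x y, U x -> F x y = Fq eps k (a x) (b x) y).

Lemma posdef_det (A : 'M[R]_n) : posdef A -> 0 < \det A.
Proof.
move=> /cholesky[L uL ->]; rewrite det_mulmx det_tr -expr2 lt_neqAle sqr_ge0 andbT.
by rewrite eq_sym expf_neq0// -unitfE -unitmxE.
Qed.

(** Equal [N] gives an isometry [T] between the two points, which carries one indicatrix to the
    other. Volumes change by [|det T|^-1] and [det a] by [(det T)^2], so
    [ln sigma - (ln (det a)) / 2] is the same at both points. *)
Lemma BH_ratio x x' : U x -> U x' -> N x = N x' ->
  ln (BH_density F x') = ln (BH_density F x) - 2^-1 * ln (\det (a x))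
    + 2^-1 * ln (\det (a x')).
Proof.
move=> Ux Ux' NN.
have [T [uT aT bT]] := posdef_isometry (apos Ux) (apos Ux') NN.
have [v v0 vE] := volume_indicatrix (apos Ux) rphi (bnorm Ux).
have b10 : Num.sqrt (bil (invmx (1%:M : 'M[R]_n)) 0 0) < b0.
  by rewrite /bil !mul0mx mxE sqrtr0; case: rphi.
have [v1 v10 v1E] := volume_indicatrix (posdef1 n) rphi b10.
(* The unit ball is the indicatrix with [beta = 0], so its volume is positive and finite by the same
   lemma. *)
have ballE : [set y : E | \sum_i y 0 i ^+ 2 < 1] = indicatrix eps k 1%:M 0.
  apply/funext => y; apply/propext; rewrite /indicatrix/= /Fq.
  rewrite /lin mul0mx mxE expr0n/= mul0r !mulr0 !addr0 bil_lin mulmx1 linE.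
  under [in X in _ <-> X]eq_bigr do rewrite -expr2.
  have S0 : 0 <= \sum_i y 0 i ^+ 2 by apply: sumr_ge0 => i _; exact: sqr_ge0.
  by rewrite -{2}[1]sqrtr1 ltr_sqrt.
have indF z : U z -> [set y : E | F z y < 1] = indicatrix eps k (a z) (b z).
  by move=> Uz; apply/funext => y; rewrite /indicatrix/= FE.
have dT : 0 < `|\det T| by rewrite normr_gt0 -unitfE -unitmxE.
have vol' : volume (indicatrix eps k (a x') (b x')) = (`|\det T|^-1 * v)%:E.
  rewrite (_ : indicatrix eps k (a x') (b x') =
      [set y | indicatrix eps k (a x) (b x) (y *m T)]); last first.
    apply/funext => y; rewrite /indicatrix/= /Fq aT bT.
    have -> : bil (T *m a x *m T^T) y y = bil (a x) (y *m T) (y *m T).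
      by rewrite /bil trmx_mul !mulmxA.
    by have -> : lin (b x *m T^T) y = lin (b x) (y *m T) by rewrite /lin trmx_mul mulmxA.
  rewrite (linvol_unit uT) ?vE//; exact: borel_indicatrix (apos Ux).
rewrite /BH_density ballE !indF// v1E vE vol' /=.
have dx0 := posdef_det (apos Ux); have dx0' := posdef_det (apos Ux').
have -> : v1 / (`|\det T|^-1 * v) = v1 / v * `|\det T| by field; rewrite !gt_eqF.
have detE : \det (a x') = `|\det T| ^+ 2 * \det (a x).
  by rewrite aT !det_mulmx det_tr real_normK ?num_real//; ring.
have -> : ln (v1 / v * `|\det T|) = ln (v1 / v) + ln `|\det T|.
  by rewrite lnM ?posrE ?divr_gt0.
have -> : ln (\det (a x')) = 2 * ln `|\det T| + ln (\det (a x)).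
  by rewrite detE lnM ?posrE ?exprn_gt0// lnXn// mulr_natl.
by field.
Qed.

(** A partial derivative sees only a short coordinate segment. There [N] is constant and [BH_ratio]
    replaces the density by an explicit function of [det a], so no regularity of the density is
    presupposed. *)
Lemma pd_ln_BH l x : (forall z, U z -> pd l N z = 0) -> U x ->
  pd l (fun z => ln (BH_density F z)) x = 2^-1 * \tr (pd_mx a l x *m invmx (a x)).
Proof.
move=> N0 Ux; have da i m : differentiable (fun z => a z i m) x.
  exact: smooth_on_diff (sa i m) Ux.
have [ddet pddet] := pd_det l da; rewrite -/(pd_mx a l x) in pddet.
have d0 := posdef_det (apos Ux); have dN0 : \det (a x) != 0 by rewrite gt_eqF.
have [dln dlnE] := is_derive1_ln d0.
have dlnE' : derive1 (@ln R) (\det (a x)) = (\det (a x))^-1 by rewrite derive1E.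
have dl : differentiable (fun z => ln (\det (a z))) x.
  by apply: (differentiable_comp ddet); exact/derivable1_diffP.
pose K := ln (BH_density F x) - 2^-1 * ln (\det (a x)).
transitivity (pd l (fun z => K + 2^-1 * ln (\det (a z))) x).
  apply: etrans (derive_line _ _ _) _; apply: etrans (esym (derive_line _ _ _)).
  apply: near_eq_derive; have := sqnorm_line N0 Ux; apply: filterS => t [Ut Nt].
  by rewrite (BH_ratio Ux Ut (esym Nt)) /K.
rewrite (pdD l (differentiable_cst _ _) (differentiableM (differentiable_cst _ _) dl)).
rewrite pd_cst add0r (pdZ l _ dl) (pd_comp l ddet dln) dlnE' pddet.
rewrite /invmx (posdef_unit (apos Ux)) -scalemxAr mxtraceZ.
by [].
Qed.

End BusemannHausdorff.

(** * The spray of an (alpha, beta)-metric in a chart *)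

Section MatrixSmoothness.
Context {R : realType} {p : nat}.
Local Notation E := 'rV[R]_p.

Lemma smooth_on_det (U : set E) n (M : E -> 'M[R]_n) : open U ->
  (forall i j, smooth_on U (fun z => M z i j)) -> smooth_on U (fun z => \det (M z)).
Proof.
move=> oU sM; apply: smooth_on_sum => // s _; apply: smooth_onM => //.
  exact: smooth_on_cst.
by apply: smooth_on_prod => // i _; exact: sM.
Qed.

Lemma smooth_on_invmx (U : set E) n (M : E -> 'M[R]_n) i j : open U ->
  (forall i j, smooth_on U (fun z => M z i j)) ->
  (forall z, U z -> M z \in unitmx) -> smooth_on U (fun z => invmx (M z) i j).
Proof.
move=> oU sM uM; have sd := smooth_on_det oU sM.
have sc : smooth_on U (fun z => (-1) ^+ (j + i) * \det (row' j (col' i (M z)))).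
  apply: smooth_onM => //; first exact: smooth_on_cst.
  apply: smooth_on_det => // k l; apply: (smooth_on_eq oU _ (sM (lift j k) (lift i l))).
  by move=> z _; rewrite !mxE.
have d0 z : U z -> \det (M z) != 0 by move=> /uM; rewrite unitmxE unitfE.
apply: (smooth_on_eq oU _ (smooth_onM oU (smooth_onV oU sd d0) sc)) => z Uz.
by rewrite /invmx (uM z Uz) !mxE.
Qed.

End MatrixSmoothness.

Section LocalSpray.
Context {R : realType} {n : nat}.
Local Notation E := 'rV[R]_n.
Variables (U : set E) (a : E -> 'M[R]_n) (b : E -> E) (phi : R -> R) (b0 : R).
Variable F : E -> E -> R.
Hypotheses (oU : open U)
  (sa : forall k l, smooth_on U (fun x => a x k l))
  (sb : forall k, smooth_on U (fun x => b x 0 k))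
  (apos : forall x, U x -> posdef (a x))
  (rphi : regular_phi phi b0)
  (bnorm : forall x, U x -> Num.sqrt (bil (invmx (a x)) (b x) (b x)) < b0)
  (FE : forall x y, U x -> slit y -> F x y = alpha_beta phi (a x) (b x) y).

Variable x : E.
Hypothesis Ux : U x.
Let o := @open_slit R n.
Let Ax := apos Ux.
Let bx := bnorm Ux.

Lemma smooth_local_F : smooth_on slit (F x).
Proof.
by apply: (smooth_on_eq o _ (smooth_F rphi Ax bx)) => y Vy; rewrite FE.
Qed.

Lemma pd_local_F i y : slit y -> pd i (F x) y = pd i (alpha_beta phi (a x) (b x)) y.
Proof. by move=> Vy; apply: (pd_eq_on i o Vy) => z Vz; exact: FE. Qed.

Lemma pd2_local_F i j y : slit y ->
  pd j (pd i (F x)) y = pd j (pd i (alpha_beta phi (a x) (b x))) y.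
Proof. by move=> Vy; apply: (pd_eq_on j o Vy) => z Vz; exact: pd_local_F. Qed.

Lemma pd_sq (f : E -> R) (i : 'I_n) (y : E) : smooth_on slit f -> slit y ->
  pd i (fun z => f z ^+ 2) y = 2 * (f y * pd i f y).
Proof.
move=> sf Vy; rewrite (pd_eq_on (g := fun z => f z * f z) i o Vy) => [|z _ //].
rewrite (pd_on_slitM i sf sf Vy); move: (pd i f y) => q; ring.
Qed.

Lemma fundamentalE y i j : slit y ->
  fundamental F x y i j = pd i (F x) y * pd j (F x) y + F x y * pd j (pd i (F x)) y.
Proof.
move=> Vy; rewrite mxE; have sF := smooth_local_F; have sFi := smooth_on_pd i sF.
have e1 z : slit z -> dy i (sq F) x z = 2 * (F x z * pd i (F x) z).
  by move=> Vz; exact: pd_sq.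
have -> : dy j (dy i (sq F)) x y = 2 * (F x y * pd j (pd i (F x)) y
    + pd i (F x) y * pd j (F x) y).
  apply: etrans (pd_eq_on j o Vy e1) _.
  by rewrite (pd_on_slitZ j _ (smooth_onM o sF sFi) Vy) (pd_on_slitM j sF sFi Vy).
set q := pd j (pd i _) y; move: q (pd i _ y) (pd j _ y) (F x y) => q r s f.
by field.
Qed.

Lemma fundamental_metric y : slit y -> fundamental F x y = metric phi (a x) (b x) y.
Proof.
move=> Vy; apply/matrixP => i j.
rewrite (fundamentalE i j Vy) [RHS]mxE (pd_local_F i Vy) (pd_local_F j Vy).
by rewrite (pd2_local_F i j Vy) (FE Ux Vy).
Qed.

(** The derivative of [F] in [x^m] in closed form, from which smoothness and homogeneity in [y] can
    be read off. *)
Definition horizontal m y : R :=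
  bil (pd_mx a m x) y y * (ab_norm (a x) y)^-1 * (2^-1 * ab_slope phi (a x) (b x) y)
  + derive1 phi (ab_ratio (a x) (b x) y) * lin (pd_row_form b m x) y.

Lemma smooth_horizontal m : smooth_on slit (horizontal m).
Proof.
apply: smooth_onD; first exact: o.
  apply: smooth_onM; [exact: o| |].
    exact: (smooth_onM o (smooth_bil _) (smooth_alV Ax)).
  by apply: (smooth_onZ _ o); exact: smooth_P rphi Ax bx.
apply: smooth_onM; [exact: o| |exact: smooth_lin].
exact: smooth_phi1 rphi Ax bx.
Qed.

Lemma dx_local_F m y : slit y ->
  differentiable (fun z => F z y) x /\ dx m F x y = horizontal m y.
Proof.
move=> Vy.
have da i j : differentiable (fun z => a z i j) x by exact: smooth_on_diff (sa i j) Ux.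
have db i : differentiable (fun z => b z 0 i) x by exact: smooth_on_diff (sb i) Ux.
have dterm k l : differentiable (fun z => a z k l * (y 0 k * y 0 l)) x.
  by apply: differentiableM => //; exact: differentiable_cst.
have dterms k : differentiable (fun z => \sum_l a z k l * (y 0 k * y 0 l)) x.
  exact: (proj1 (diff_pd_sum _ _)).
have QE : (fun z => bil (a z) y y) = (fun z => \sum_k \sum_l a z k l * (y 0 k * y 0 l)).
  apply/funext => z; rewrite bilE; apply: eq_bigr => k _; apply: eq_bigr => l _.
  by rewrite mulrA.
have BE : (fun z => lin (b z) y) = (fun z => \sum_k b z 0 k * y 0 k).
  by apply/funext => z; rewrite linE.
have dbk k : differentiable (fun z => b z 0 k * y 0 k) x.
  by apply: differentiableM => //; exact: differentiable_cst.
have dQ : differentiable (fun z => bil (a z) y y) x.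
  by rewrite QE; exact: (proj1 (diff_pd_sum _ _)).
have dB : differentiable (fun z => lin (b z) y) x.
  by rewrite BE; exact: (proj1 (diff_pd_sum _ _)).
have pQ : pd m (fun z => bil (a z) y y) x = bil (pd_mx a m x) y y.
  rewrite QE (proj2 (diff_pd_sum _ dterms) m) bilE; apply: eq_bigr => k _.
  rewrite (proj2 (diff_pd_sum _ (dterm k)) m); apply: eq_bigr => l _.
  rewrite (pdM m (da k l) (differentiable_cst _ _)) pd_cst mulr0 add0r mxE.
  by rewrite mulrC mulrA.
have pB : pd m (fun z => lin (b z) y) x = lin (pd_row_form b m x) y.
  rewrite BE (proj2 (diff_pd_sum _ dbk) m) linE; apply: eq_bigr => k _.
  by rewrite (pdM m (db k) (differentiable_cst _ _)) pd_cst mulr0 add0r mxE mulrC.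
have Q0 : 0 < bil (a x) y y by exact: (proj2 Ax).
have [dphi dphiE] := derive_phi rphi 0 (s_lt Ax bx Vy).
have [dF pF] := pd_alpha_beta m dQ dB Q0 dphi.
have EF z : U z -> F z y = Num.sqrt (bil (a z) y y) * phi (lin (b z) y / Num.sqrt (bil (a z) y y)).
  by move=> Uz; rewrite FE.
split.
  by apply: (differentiable_eq_on oU Ux _ dF) => z Uz; rewrite EF.
apply: etrans (pd_eq_on m oU Ux EF) _.
rewrite pF pQ pB /horizontal -/(ab_norm (a x) y) -/(ab_ratio (a x) (b x) y).
rewrite -/(ab_slope phi (a x) (b x) y) invfM; congr (_ + _).
by rewrite -!mulrA; congr (_ * _); rewrite mulrCA.
Qed.

Lemma dx_sq_local m y : slit y -> dx m (sq F) x y = 2 * (F x y * horizontal m y).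
Proof.
move=> Vy; have [dF <-] := dx_local_F m Vy.
have E2 : (fun z => sq F z y) = (fun z => F z y * F z y) by [].
apply: etrans (congr1 (fun g => pd m g x) E2) _.
rewrite (pdM m dF dF) -/(dx m F x y); move: (dx m F x y) => q; ring.
Qed.

Lemma dy_dx_sq_local l m y : slit y -> dy l (dx m (sq F)) x y =
  2 * (pd l (F x) y * horizontal m y + F x y * pd l (horizontal m) y).
Proof.
move=> Vy; have sF := smooth_local_F; have sX := smooth_horizontal m.
apply: etrans (pd_eq_on l o Vy (fun z Vz => dx_sq_local m Vz)) _.
rewrite (pd_on_slitZ l _ (smooth_onM o sF sX) Vy) (pd_on_slitM l sF sX Vy).
by rewrite addrC [horizontal m y * _]mulrC.
Qed.

Lemma spray_smooth i : smooth_on slit (fun y => spray F i x y).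
Proof.
have sF := smooth_local_F; have sX := smooth_horizontal.
have sg k l : smooth_on slit (fun y => fundamental F x y k l).
  have sf := smooth_F rphi Ax bx; have sk := smooth_on_pd k sf.
  have sl := smooth_on_pd l sf; have skl := smooth_on_pd l sk.
  apply: (smooth_on_eq o _ (smooth_onD o (smooth_onM o sk sl) (smooth_onM o sf skl))).
  by move=> y Vy; rewrite (fundamental_metric Vy) mxE.
apply: (smooth_onZ _ o); apply: smooth_on_sum; first exact: o.
move=> l _; apply: smooth_onM; first exact: o.
  apply: smooth_on_invmx => //.
  by move=> y Vy; rewrite fundamental_metric//; exact: metric_unit rphi Ax bx _ Vy.
apply: smooth_onB; first exact: o.
  apply: smooth_on_sum; first exact: o.
  move=> m _; apply: smooth_onM; [exact: o| |exact: smooth_on_slit_coord].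
  apply: (smooth_on_eq (f := fun y => 2 * (pd l (F x) y * horizontal m y +
    F x y * pd l (horizontal m) y)) o).
    by move=> y Vy; rewrite dy_dx_sq_local.
  apply: (smooth_onZ _ o); apply: smooth_onD; first exact: o.
    by apply: smooth_onM; [exact: o|exact: smooth_on_pd|].
  by apply: smooth_onM; [exact: o| |exact: smooth_on_pd].
apply: (smooth_on_eq (f := fun y => 2 * (F x y * horizontal l y)) o).
  by move=> y Vy; rewrite dx_sq_local.
by apply: (smooth_onZ _ o); apply: smooth_onM; first exact: o.
Qed.

Lemma spray_equation l y : slit y ->
  \sum_i (pd l (F x) y * pd i (F x) y + F x y * pd i (pd l (F x)) y) * spray F i x y =
  2^-1 * (\sum_m (pd l (F x) y * horizontal m y + F x y * pd l (horizontal m) y) * y 0 m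
          - F x y * horizontal l y).
Proof.
move=> Vy; set g := fundamental F x y.
have ug : g \in unitmx.
  by rewrite /g fundamental_metric//; exact: metric_unit rphi Ax bx _ Vy.
pose r : 'cV[R]_n := \col_l (\sum_m dy l (dx m (sq F)) x y * y 0 m - dx l (sq F) x y).
have GE i : spray F i x y = 4^-1 * (invmx g *m r) i 0.
  by rewrite /spray mxE; congr (_ * _); apply: eq_bigr => k _; rewrite mxE.
transitivity (\sum_i g l i * (4^-1 * (invmx g *m r) i 0)).
  by apply: eq_bigr => i _; rewrite GE (fundamentalE l i Vy).
transitivity (4^-1 * (g *m (invmx g *m r)) l 0).
  by rewrite mxE mulr_sumr; apply: eq_bigr => i _; rewrite mulrCA.
rewrite mulKVmx// mxE dx_sq_local//.
have -> : \sum_m dy l (dx m (sq F)) x y * y 0 m = 2 * \sum_m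
    (pd l (F x) y * horizontal m y + F x y * pd l (horizontal m) y) * y 0 m.
  by rewrite mulr_sumr; apply: eq_bigr => m _; rewrite dy_dx_sq_local// mulrA.
by move: (\sum_m _) (F x y * _) => p q; field.
Qed.

Lemma horizontalZ m (t : R) y : 0 < t -> horizontal m (t *: y) = t * horizontal m y.
Proof.
move=> t0; rewrite /horizontal /ab_slope !(alZ _ _ t0) !(sZ _ _ _ t0).
rewrite bilZl bilZr linZr invfM; have tN0 : t != 0 by rewrite gt_eqF.
move: (ab_norm (a x) y)^-1 (bil _ _ _) (lin (pd_row_form b m x) y) => r q p.
by field.
Qed.

Lemma euler_horizontal m y : slit y -> \sum_i y 0 i * pd i (horizontal m) y = horizontal m y.
Proof.
move=> Vy; apply: euler_homogeneous; first exact: smooth_on_diff (smooth_horizontal m) Vy.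
by move=> t; exact: horizontalZ.
Qed.

Lemma local_F_gt0 y : slit y -> 0 < F x y.
Proof. by move=> Vy; rewrite (FE Ux Vy); exact: F_gt0 rphi Ax bx _ Vy. Qed.

Lemma slitZ (t : R) (y : E) : 0 < t -> slit y -> slit (t *: y).
Proof.
move=> t0 Vy; apply: contra_neq Vy => /eqP; rewrite scaler_eq0 gt_eqF//=.
by move=> /eqP.
Qed.

Lemma local_FZ (t : R) y : 0 < t -> slit y -> F x (t *: y) = t * F x y.
Proof. by move=> t0 Vy; rewrite (FE Ux Vy) (FE Ux (slitZ t0 Vy)) FZ. Qed.

Lemma euler_local_F y : slit y -> \sum_i y 0 i * pd i (F x) y = F x y.
Proof.
move=> Vy; apply: euler_homogeneous; first exact: smooth_on_diff smooth_local_F Vy.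
by move=> t t0; exact: local_FZ.
Qed.

Lemma euler2_local_F j y : slit y -> \sum_i y 0 i * pd j (pd i (F x)) y = 0.
Proof.
move=> Vy; rewrite -[RHS](euler2_F rphi Ax bx j Vy); apply: eq_bigr => i _.
by rewrite (pd2_local_F i j Vy).
Qed.

Lemma pd2_local_F_sym i j y : slit y -> pd j (pd i (F x)) y = pd i (pd j (F x)) y.
Proof.
by move=> Vy; rewrite (pd2_local_F i j Vy) (pd2_local_F j i Vy); exact: pd2_F_sym rphi Ax bx _ _ _ Vy.
Qed.

Lemma pd_local_FZ i (t : R) y : 0 < t -> slit y -> pd i (F x) (t *: y) = pd i (F x) y.
Proof.
move=> t0 Vy; rewrite (pd_local_F i Vy) (pd_local_F i (slitZ t0 Vy)).
rewrite (pd_F rphi Ax bx i Vy) (pd_F rphi Ax bx i (slitZ t0 Vy)).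
rewrite /ab_slope /ab_dir (sZ _ _ _ t0) (alZ _ _ t0) -scalemxAl mxE invfM.
by rewrite mulrACA divff ?mul1r// gt_eqF.
Qed.

(* The constants [C i l] left by integrating a vanishing third derivative
   satisfy [\sum_i F_i C i l = 0] by homogeneity; evaluated at [y = C _ l], Euler's
   identity turns this into [F y = 0]. *)
Lemma isotropic_connection (c : R) : (1 < n)%N ->
  (forall i j k l y, slit y ->
    pd3 j k l (fun z => spray F i x z) y = c * radial_pd3 i j k l (F x) y) ->
  exists H : 'I_n -> 'M[R]_n, [/\ forall i, (H i)^T = H i,
    forall l i y, slit y -> pd l (fun z => spray F i x z) y =
      \sum_j H i l j * y 0 j + c * (pd l (F x) y * y 0 i + F x y * (i == l)%:R)
  & forall l y, slit y -> horizontal l y =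
      \sum_i pd i (F x) y * (\sum_j H i l j * y 0 j) + 2 * c * (F x y * pd l (F x) y)].
Proof.
move=> n1 BF; have sF := smooth_local_F; have sc := @smooth_on_slit_coord R n.
have sFc i : smooth_on slit (fun z : E => F x z * z 0 i) by exact: smooth_onM.
pose h i (z : E) := spray F i x z + (- c) * (F x z * z 0 i).
have sh i : smooth_on slit (h i).
  by apply: smooth_onD => //; [exact: spray_smooth|exact: smooth_onZ].
have h3 i j k l y : slit y -> pd3 j k l (h i) y = 0.
  move=> Vy; rewrite (pd3D j k l (spray_smooth i) (smooth_onZ _ o (sFc i)) Vy).
  by rewrite (pd3Z j k l _ (sFc i) Vy) (BF i j k l y Vy) pd3_radial// mulNr subrr.
have Gh i z : spray F i x z = h i z + c * (F x z * z 0 i) by rewrite /h; ring.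
have [H' H'E] := choice (fun i => affine_gradient n1 (sh i) (h3 i)).
have [C HC] := choice H'E.
have X1 l y : slit y -> horizontal l y =
    \sum_i pd i (F x) y * pd l (h i) y + 2 * c * (F x y * pd l (F x) y).
  move=> Vy; apply: (isotropic_berwald_first_order sF smooth_horizontal local_F_gt0
    euler_local_F euler2_local_F pd2_local_F_sym euler_horizontal spray_equation sh) => //.
have X2 l y : slit y -> horizontal l y =
    \sum_i pd i (F x) y * (\sum_j H' i l j * y 0 j) + \sum_i C i l * pd i (F x) y
    + 2 * c * (F x y * pd l (F x) y).
  move=> Vy; rewrite (X1 l y Vy) -big_split/=; congr (_ + _); apply: eq_bigr => i _.
  by rewrite (proj2 (HC i) l y Vy) mulrDr [C i l * _]mulrC.
have FC l y : slit y -> \sum_i C i l * pd i (F x) y = 0.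
  (* Compared at [y] and [2 y], every term of [X2] has degree one except the one in [C], which has
     degree zero and must vanish. *)
  move=> Vy; have t0 : 0 < 2 :> R by [].
  have := X2 l _ (slitZ t0 Vy); rewrite horizontalZ// (X2 l y Vy) local_FZ//.
  rewrite (pd_local_FZ l t0 Vy).
  rewrite [X in _ = X + _ + _ -> _](_ : _ =
      2 * \sum_i pd i (F x) y * (\sum_j H' i l j * y 0 j)); last first.
    rewrite mulr_sumr; apply: eq_bigr => i _; rewrite (pd_local_FZ i t0 Vy) mulrCA.
    by congr (_ * _); rewrite mulr_sumr; apply: eq_bigr => j _; rewrite mxE mulrCA.
  rewrite [X in _ = _ + X + _ -> _](_ : _ = \sum_i C i l * pd i (F x) y); last first.
    by apply: eq_bigr => i _; rewrite (pd_local_FZ i t0 Vy).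
  move: (\sum_i C i l * _) (\sum_i _) (F x y) (pd l (F x) y) => p q r s; lra.
have C0 i l : C i l = 0.
  pose v : E := \row_i C i l; have [v0|Vv] := eqVneq v 0.
    by have /rowP/(_ i) := v0; rewrite !mxE.
  have := FC l v Vv; rewrite (eq_bigr (fun i => v 0 i * pd i (F x) v)); last first.
    by move=> m _; rewrite mxE.
  by rewrite (euler_local_F Vv) => F0; have := local_F_gt0 Vv; rewrite F0 ltxx.
exists H'; split=> [i|l i y Vy|l y Vy]; first exact: (proj1 (HC i)).
  have := proj2 (HC i) l y Vy; rewrite C0 addr0 => <-.
  apply: etrans (pd_eq_on l o Vy (fun z _ => Gh i z)) _.
  rewrite (pd_on_slitD l (sh i) (smooth_onZ _ o (sFc i)) Vy).
  rewrite (pd_on_slitZ l _ (sFc i) Vy) (pd_on_slitM l sF (sc i) Vy) pd_coord.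
  by rewrite addrC [pd l (F x) y * _]mulrC [l == i]eq_sym addrC [_ * pd _ _ _ + _]addrC.
rewrite (X2 l y Vy) [X in _ + X + _]big1 ?addr0// => i _.
by rewrite C0 mul0r.
Qed.

End LocalSpray.

(** * Isotropic Berwald curvature implies isotropic S-curvature *)

Section QuadraticForward.
Context {R : realType} {n : nat}.
Local Notation E := 'rV[R]_n.

Lemma trace_alternating_sym (X S : 'M[R]_n) :
  (forall y, bil X y y = 0) -> S^T = S -> \tr (X *m S) = 0.
Proof.
move=> X0 St; have XE i j : bil X (delta_mx 0 i) (delta_mx 0 j) = X i j.
  by rewrite /bil -rowE trmx_delta -colE !mxE.
have Xt : X^T = - X.
  apply/matrixP => i j; rewrite !mxE.
  have := X0 (delta_mx 0 i + delta_mx 0 j).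
  rewrite bilDl !bilDr !X0 !XE add0r addr0 => /eqP.
  by rewrite addrC addr_eq0 => /eqP.
have : \tr (X *m S) = - \tr (X *m S).
  by rewrite -[in LHS]mxtrace_tr trmx_mul St Xt mulmxN raddfN mxtrace_mulC.
by move: (\tr _) => t; lra.
Qed.

Lemma derive1_quadratic (eps k s : R) : derive1 (quadratic_phi eps k) s = eps + 2 * k * s.
Proof.
rewrite derive1E; have H : is_derive s (1 : R) (quadratic_phi eps k) (eps + 2 * k * s).
  rewrite /quadratic_phi; apply: is_derive_eq.
  by rewrite /GRing.scale/=; ring.
by rewrite derive_val.
Qed.

Variables (U : set E) (a : E -> 'M[R]_n) (b : E -> E) (eps k b0 : R).
Variable F : E -> E -> R.
Local Notation phi := (quadratic_phi eps k).
Hypotheses (n1 : (1 < n)%N) (k0 : k != 0) (oU : open U)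
  (sa : forall k l, smooth_on U (fun x => a x k l))
  (sb : forall k, smooth_on U (fun x => b x 0 k))
  (apos : forall x, U x -> posdef (a x))
  (rphi : regular_phi phi b0)
  (bnorm : forall x, U x -> Num.sqrt (bil (invmx (a x)) (b x) (b x)) < b0)
  (FE : forall x y, U x -> F x y = Fq eps k (a x) (b x) y).

Lemma Fq_alpha_beta x y : U x -> slit y -> F x y = alpha_beta phi (a x) (b x) y.
Proof. by move=> Ux Vy; rewrite FE// Fq_phi//; exact: apos. Qed.

Hypothesis BF : forall x, U x -> exists c, forall i j k l y, slit y ->
  pd3 j k l (fun z => spray F i x z) y = c * radial_pd3 i j k l (F x) y.

Section Point.
Variables (x : E) (c : R) (H : 'I_n -> 'M[R]_n).
Hypothesis Ux : U x.
Hypothesis horizontalE : forall l y, slit y -> horizontal a b phi x l y =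
  \sum_i pd i (F x) y * (\sum_j H i l j * y 0 j) + 2 * c * (F x y * pd l (F x) y).

Let A := a x.
Let w := sharp A (b x).
Let Apos := apos Ux.
(** The connection matrix in direction [l]. With it, [bil (Xm l) y y] is half the covariant
    derivative of [alpha^2], and row [l] of [Em] is the covariant derivative of [beta]. *)
Let Gam l : 'M[R]_n := \matrix_(j, i) H i l j.
Let Xm l := 2^-1 *: pd_mx a l x - A *m (Gam l)^T.
Let Em : 'M[R]_n := \matrix_(l, j) (pd_row_form b l x - b x *m (Gam l)^T) 0 j.

Lemma slope_quadratic y : ab_slope phi A (b x) y = 1 - k * ab_ratio A (b x) y ^+ 2.
Proof.
rewrite /ab_slope derive1_quadratic /quadratic_phi; move: (ab_ratio _ _ _) => s.
by ring.
Qed.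

Lemma pd_quadratic l y : slit y -> pd l (F x) y =
  (y *m A) 0 l / ab_norm A y * (1 - k * ab_ratio A (b x) y ^+ 2)
  + (eps + 2 * k * ab_ratio A (b x) y) * b x 0 l.
Proof.
move=> Vy; rewrite (pd_local_F Fq_alpha_beta Ux l Vy) (pd_F rphi Apos (bnorm Ux) l Vy).
by rewrite slope_quadratic derive1_quadratic.
Qed.

Lemma EmE l j : Em l j = pd_row_form b l x 0 j - (b x *m (Gam l)^T) 0 j.
Proof. by rewrite [LHS]mxE [LHS]mxE [X in _ + X]mxE. Qed.

Lemma XmE l y : bil (Xm l) y y = 2^-1 * bil (pd_mx a l x) y y - bil A y (y *m Gam l).
Proof.
rewrite /bil mulmxBr mulmxBl -scalemxAr -scalemxAl [LHS]mxE.
by rewrite [X in X + _]mxE [X in _ + X]mxE trmx_mul !mulmxA.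
Qed.

Lemma connection_forms :
  (forall l y, bil (Xm l) y y = 0) /\ (b x != 0 -> Em = 0).
Proof.
apply: (@parallel_forms _ _ A (b x) eps k c Xm Em n1 Apos k0) => l y Vy al s.
have GE i : \sum_j H i l j * y 0 j = (y *m Gam l) 0 i.
  by rewrite mxE; apply: eq_bigr => j _; rewrite mxE mulrC.
have YE : (y *m Em^T) 0 l = lin (pd_row_form b l x) y - lin (b x) (y *m Gam l).
  have -> : lin (b x) (y *m Gam l) = lin (b x *m (Gam l)^T) y.
    by rewrite /lin trmx_mul mulmxA.
  rewrite mxE !linE -sumrB; apply: eq_bigr => j _.
  have -> : Em^T j l = Em l j by rewrite [LHS]mxE.
  by rewrite EmE mulrC mulrBl.
have := horizontalE l Vy.
rewrite (eq_bigr (fun i => (1 - k * s ^+ 2) / al * ((y *m A) 0 i * (y *m Gam l) 0 i)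
   + (eps + 2 * k * s) * (b x 0 i * (y *m Gam l) 0 i))); last first.
  by move=> i _; rewrite (pd_quadratic i Vy) GE -[ab_norm A y]/al -[ab_ratio A (b x) y]/s; ring.
rewrite big_split/= -!mulr_sumr -!linE -bil_lin (pd_quadratic l Vy) -[ab_norm A y]/al -[ab_ratio A (b x) y]/s.
rewrite /horizontal derive1_quadratic slope_quadratic -[ab_norm A y]/al -[ab_ratio A (b x) y]/s XmE YE.
rewrite (Fq_alpha_beta Ux Vy) /alpha_beta /quadratic_phi -[ab_norm A y]/al -[ab_ratio A (b x) y]/s => /eqP.
rewrite -subr_eq0 => /eqP H0; apply/eqP; rewrite -subr_eq0; apply/eqP.
rewrite -[RHS]H0.
move: (bil _ _ _) (bil _ _ _) (lin _ _) (lin _ _) => p q r t.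
by ring.
Qed.

(** If [b x = 0], both terms of [pd_sqnorm] contain [w = 0]. Otherwise metricity and parallelism
    turn both into [2 b(w Gam)], and they cancel. *)
Lemma pd_sqnorm_connection l : pd l (fun z => bil (invmx (a z)) (b z) (b z)) x = 0.
Proof.
have [X0 E0] := connection_forms.
rewrite (pd_sqnorm oU sa sb apos l Ux) -/A -/w.
have [b00|bN0] := eqVneq (b x) 0.
  by rewrite /w /sharp b00 mul0mx /lin /bil trmx0 !mulmx0 !mxE mulr0 subr0.
have XE := X0 l w; rewrite XmE in XE.
have YE : lin (pd_row_form b l x) w = lin (b x) (w *m Gam l).
  have -> : lin (b x) (w *m Gam l) = lin (b x *m (Gam l)^T) w.
    by rewrite /lin trmx_mul mulmxA.
  have /matrixP := E0 bN0; move=> Z; congr lin; apply/rowP => j.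
  by have := Z l j; rewrite EmE [RHS]mxE => /eqP; rewrite subr_eq0 => /eqP.
rewrite YE -(bil_sharp Apos) -/A -/w; move: XE.
by move: (bil _ _ _) (bil _ _ _) => p q; lra.
Qed.

(** [Xm l] is alternating, so its trace against the symmetric [invmx A] is zero; the two halves of
    [Xm l] give the two sides. *)
Lemma trace_connection l :
  2^-1 * \tr (pd_mx a l x *m invmx A) = \sum_i H i l i.
Proof.
have [X0 _] := connection_forms.
have uA := posdef_unit Apos.
have := trace_alternating_sym (X0 l) (S := invmx A).
rewrite trmx_inv (proj1 Apos) => /(_ erefl).
rewrite mulmxBl raddfB/= -scalemxAl mxtraceZ => /eqP.
rewrite subr_eq0 => /eqP ->.
rewrite mxtrace_mulC mulmxA mulVmx// mul1mx mxtrace_tr /mxtrace.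
by apply: eq_bigr => i _; rewrite mxE.
Qed.

End Point.

Lemma isotropic_S_local x : U x -> forall c, (forall i j k l y, slit y ->
    pd3 j k l (fun z => spray F i x z) y = c * radial_pd3 i j k l (F x) y) ->
  forall y, slit y -> S_curvature F x y = n.+1%:R * c * F x y.
Proof.
move=> Ux c Bc y Vy.
have conn z d (Uz : U z) := isotropic_connection oU sa sb apos rphi bnorm Fq_alpha_beta Uz (c := d) n1.
(* Needed on all of [U], since the density is differentiated along segments; each point has its own
   factor [d] and connection. *)
have N0 l z : U z -> pd l (fun z => bil (invmx (a z)) (b z) (b z)) z = 0.
  move=> Uz; have [d Bd] := BF Uz; have [H [_ _ hE]] := conn z d Uz Bd.
  exact: (pd_sqnorm_connection Uz hE).
have [H [Ht GH hE]] := conn x c Ux Bc.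
rewrite /S_curvature.
have -> : \sum_m y 0 m * pd m (fun z => ln (BH_density F z)) x =
    \sum_m \sum_j y 0 m * H j m j.
  apply: eq_bigr => m _; rewrite -mulr_sumr -(trace_connection Ux hE m).
  by rewrite (pd_ln_BH oU sa sb apos rphi bnorm FE (N0 m) Ux).
have -> : \sum_m dy m (spray F m) x y =
    \sum_m \sum_j H m m j * y 0 j + c * (F x y + n%:R * F x y).
  have eu := euler_local_F apos rphi bnorm Fq_alpha_beta Ux Vy.
  rewrite (eq_bigr (fun m => \sum_j H m m j * y 0 j
    + c * (y 0 m * pd m (F x) y + F x y))).
    rewrite big_split/= -mulr_sumr big_split/= eu.
    by rewrite (sumr_const _ (F x y)) card_ord mulr_natl.
  by move=> m _; rewrite [dy m _ x y](GH m m y Vy) eqxx mulr1 [pd m (F x) y * _]mulrC.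
rewrite exchange_big/= addrAC (_ : \sum_j _ - _ = 0) ?add0r.
  by rewrite -natr1; ring.
(* What remains are the contractions [H m m j y_j] and [y_m H j m j], equal because each [H i] is
   symmetric. *)
apply/eqP; rewrite subr_eq0; apply/eqP; rewrite exchange_big/=.
rewrite [RHS]exchange_big/=.
apply: eq_bigr => i _; apply: eq_bigr => j _.
by rewrite mulrC -[in LHS](Ht i) mxE.
Qed.

End QuadraticForward.

(** * Charts *)

Section Charts.
Context {R : realType} {n : nat} {M : manifold R n}.
Implicit Types (a : riemannian_metric M) (b : one_form M) (phi : R -> R).
Local Notation img i := (Defs.coord i @` @dom _ _ M i).

Lemma posdef_chart a i x : img i x -> posdef (a i x).
Proof.
move=> [p ip <-]; split; first exact: mcoef_sym.
by move=> y y0; exact: mcoef_posdef.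
Qed.

Lemma alphaE a i x y : alpha a i x y = Num.sqrt (bil (a i x) y y).
Proof. by rewrite bilE. Qed.

Lemma betaE b i x y : beta b i x y = lin (b i x) y.
Proof. by rewrite linE. Qed.

Lemma regular_chart phi a b : regular_alpha_beta phi a b -> exists r,
  regular_phi phi r /\ forall i x, img i x ->
    Num.sqrt (bil (invmx (a i x)) (b i x) (b i x)) < r.
Proof.
move=> [r [r0 dphi phi0 phi2 bn]]; exists r; split=> // i x [p ip <-].
by rewrite bilE; exact: bn.
Qed.

Lemma quadratic_metricE eps k a b i x y :
  quadratic_metric eps k a b i x y = Fq eps k (a i x) (b i x) y.
Proof. by rewrite /quadratic_metric alphaE betaE. Qed.

Lemma matsumoto_metricE (r : R) a b i x y : regular_phi matsumoto_phi r ->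
  Num.sqrt (bil (invmx (a i x)) (b i x) (b i x)) < r -> img i x -> slit y ->
  matsumoto_metric a b i x y = alpha_beta matsumoto_phi (a i x) (b i x) y.
Proof.
move=> rphi bn ix Vy; have Apos := posdef_chart a ix.
have al0 := al_gt0 Apos Vy; have [_ _ phi0 _] := rphi.
(* Positivity of [phi] means [s < 1], so the denominator [alpha - beta] does not vanish. *)
have := phi0 _ (s_lt Apos bn Vy); rewrite invr_gt0 subr_gt0 => s1.
rewrite /matsumoto_metric alphaE betaE -(s_al (b i x) Apos Vy) -/(ab_norm (a i x) y).
rewrite /alpha_beta /matsumoto_phi; move: al0 s1.
move: (ab_norm _ _) (ab_ratio _ _ _) => q s q0 s1.
have qN0 : q != 0 by rewrite gt_eqF.
have sN0 : 1 - s != 0 by rewrite gt_eqF// subr_gt0.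
rewrite -{2}[q]mul1r -mulrBl; by field; rewrite qN0 sN0.
Qed.

End Charts.

Theorem theorem4p1 (R : realType) (n : nat) (hn : (3 <= n)%N)
  (M : manifold R n) (a a' : riemannian_metric M) (b b' : one_form M)
  (hb : nonzero_form b) (hb' : nonzero_form b')
  (eps k : R) (hk : k != 0)
  (hF : regular_alpha_beta (quadratic_phi eps k) a b)
  (hF' : regular_alpha_beta matsumoto_phi a' b')
  (hproj : projectively_equivalent
             (quadratic_metric eps k a b) (matsumoto_metric a' b'))
  (hB' : isotropic_berwald (matsumoto_metric a' b')) :
  isotropic_berwald (quadratic_metric eps k a b) <->
  isotropic_S (quadratic_metric eps k a b).
Proof.
have n1 : (1 < n)%N by exact: ltnW.
have [b0 [rphi bn]] := regular_chart hF; have [b0' [rphi' bn']] := regular_chart hF'.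
have oU ch : open (Defs.coord ch @` @dom _ _ M ch) by exact: img_open.
have FE ch x y : (Defs.coord ch @` dom ch) x -> slit y -> quadratic_metric eps k a b ch x y =
    alpha_beta (quadratic_phi eps k) (a ch x) (b ch x) y.
  move=> ix Vy; rewrite quadratic_metricE.
  exact: (Fq_phi _ _ _ (posdef_chart a ix) Vy).
have FE' ch x y : (Defs.coord ch @` dom ch) x -> slit y -> matsumoto_metric a' b' ch x y =
    alpha_beta matsumoto_phi (a' ch x) (b' ch x) y.
  by move=> ix Vy; exact: (matsumoto_metricE rphi' (bn' ch x ix) ix Vy).
split=> [[c Bc]|[c Sc]]; last first.
  have [c' Bc'] := hB'; have [P [_ PZ GP]] := hproj.
  exists c => ch p y i j k0 l dp Vy /=.
  have ix : (Defs.coord ch @` dom ch) (Defs.coord ch p) by exists p.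
  have sG m := spray_smooth (oU ch) (@mcoef_smooth R n M a ch) (@fcoef_smooth R n M b ch)
    (@posdef_chart R n M a ch) rphi (bn ch) (FE ch) ix m.
  have sG' m := spray_smooth (oU ch) (@mcoef_smooth R n M a' ch) (@fcoef_smooth R n M b' ch)
    (@posdef_chart R n M a' ch) rphi' (bn' ch) (FE' ch) ix m.
  have sF := smooth_local_F (@posdef_chart R n M a ch) rphi (bn ch) (FE ch) ix.
  have sF' := smooth_local_F (@posdef_chart R n M a' ch) rphi' (bn' ch) (FE' ch) ix.
  (* At a fixed point of [M] the density term of the S-curvature is a linear form in [y], with
     coefficients [lam]. *)
  apply: (radial_pd3_of_divergence (P := P ch (Defs.coord ch p)) (c' := c' p)
    (lam := fun m => pd m (fun x' => ln (BH_density (quadratic_metric eps k a b ch) x')) (Defs.coord ch p))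
    sG sG' sF sF') => //.
  - by move=> z t Vz t0; exact: (local_FZ (FE' ch) ix t0 Vz).
  - by move=> z t Vz t0; exact: PZ.
  - by move=> m z Vz; exact: GP.
  - by move=> m m1 m2 m3 z Vz; exact: Bc'.
  - by move=> z Vz; exact: Sc.
exists c => ch p y dp Vy.
have ix : (Defs.coord ch @` dom ch) (Defs.coord ch p) by exists p.
apply: (isotropic_S_local n1 hk (oU ch) (@mcoef_smooth R n M a ch) (@fcoef_smooth R n M b ch)
  (@posdef_chart R n M a ch) rphi (bn ch) (fun x y _ => quadratic_metricE eps k a b ch x y) _ ix) => //.
  move=> _ [q dq <-]; exists (c q) => i j m l z Vz; exact: Bc.
by move=> i j m l z Vz; exact: Bc.
Qed.
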